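(* For every $N\ge4$, with $\Lambda=(\mathbb{Z}/N\mathbb{Z})^2$, all $i,j\in\Lambda$ and all $0<\beta^*\le\frac1{12}$, \[ \frac{4}{\beta^*}(G_{ii}-G_{ij})-\frac{4}{(\beta^* )^2}M_{(4\beta^* )^{-1}}\ \le\ \operatorname{Var}^*_{\Lambda,\beta^*}(U_{ij})=E^*_{\Lambda,\beta^*}[U_{ij}^2]\ \le\ \frac{4}{\beta^*}(G_{ii}-G_{ij}). \] Consequently $E^*_{\Lambda,\beta^*}[U_{ij}^2]\sim\frac{4}{\beta^*}(G_{ii}-G_{ij})$ as $\beta^*\to0$.
   Context: $\Lambda=(\mathbb{Z}/N\mathbb{Z})^2$ is the $N\times N$ box with periodic boundary conditions containing $0$. $G$ is the Green's function $G_{ij}=\lim_{\lambda\downarrow0}\sum_{t\ge0}(P_i(X_t=j)-1/|\Lambda|)e^{-\lambda t}$, with $P_i$ the law of simple random walk on $\Lambda$ started at $i$. $\Omega^*_\Lambda=\{k\in 2\pi\mathbb{Z}^\Lambda:\sum_{i}k_i=0\}$ and the lattice Coulomb gas at inverse temperature $\beta^*$ is $P^*_{\Lambda,\beta^*}=\frac{1}{Z^*_{\Lambda,\beta^*}}\sum_{k\in\Omega^*_\Lambda}e^{-\frac{\beta^*}{4}k^tGk}\delta_k$, $Z^*_{\Lambda,\beta^*}=\sum_{k\in\Omega^*_\Lambda}e^{-\frac{\beta^*}{4}k^tGk}$; $E^*$, $\operatorname{Var}^*$ are expectation and variance under it. The voltage between $i$ and $j$ is $U_{ij}(k)=\sum_{\ell\in\Lambda}(G_{i\ell}-G_{j\ell})k_\ell$.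 For $\beta\ge3$, $\varphi(\beta):=480(3e^{-\beta})^4$ and $M_\beta:=\frac{2\varphi(\beta)(1+\varphi(\beta))}{(1-\varphi(\beta))^3}$. *)

(* Defs.v *)
From HB Require Import structures.
From mathcomp Require Import all_boot all_order all_algebra.
From mathcomp Require Import all_classical all_reals all_analysis.
Set Implicit Arguments. Unset Strict Implicit. Unset Printing Implicit Defensive.
Import Order.TTheory GRing.Theory Num.Theory.
Import numFieldNormedType.Exports.
Local Open Scope classical_set_scope.
Local Open Scope ring_scope.

(* The torus Lambda = (Z/NZ)^2 ; 'Z_N is Z/NZ for N >= 2 (we always assume N >= 4). *)
Definition Lam (N : nat) : finType := ('Z_N * 'Z_N)%type.

Definition srw_dirs (N : nat) : seq ('Z_N * 'Z_N) :=
  [:: (1, 0); (-1, 0); (0, 1); (0, -1)]%R.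

Definition srwP (R : realType) (N : nat) (x y : Lam N) : R :=
  (4%:R)^-1 * (count (fun d : 'Z_N * 'Z_N => (x + d)%R == y) (srw_dirs N))%:R.

Fixpoint srw_pt (R : realType) (N : nat) (t : nat) (x y : Lam N) : R :=
  match t with
  | 0 => (x == y)%:R
  | t'.+1 => \sum_(z : Lam N) srw_pt R t' x z * srwP R z y
  end.

Definition green (R : realType) (N : nat) (i j : Lam N) : R :=
  lim ((fun lam : R =>
          limn (fun n : nat => \sum_(t < n)
             ((srw_pt R t i j - (#|Lam N|%:R)^-1) * expR (- (lam * t%:R)))))
       @ 0^'+).

Definition OmegaStar (R : realType) (N : nat) : set {ffun Lam N -> R} :=
  [set k | (forall l, exists z : int, k l = 2 * pi * z%:~R) /\ \sum_(l : Lam N) k l = 0].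
Arguments OmegaStar : clear implicits.

Definition quadG (R : realType) (N : nat) (k : {ffun Lam N -> R}) : R :=
  \sum_(a : Lam N) \sum_(b : Lam N) k a * green R a b * k b.

Definition cg_weight (R : realType) (N : nat) (bs : R) (k : {ffun Lam N -> R}) : R :=
  expR (- (bs / 4 * quadG k)).

Definition cg_Z (R : realType) (N : nat) (bs : R) : \bar R :=
  \esum_(k in OmegaStar R N) (cg_weight bs k)%:E.

Definition signed_esum (R : realType) (T : choiceType) (S : set T) (f : T -> R) : \bar R :=
  (\esum_(x in S) ((fun y => (f y)%:E)^\+ x) - \esum_(x in S) ((fun y => (f y)%:E)^\- x))%E.

Definition cg_E (R : realType) (N : nat) (bs : R) (F : {ffun Lam N -> R} -> R) : R :=
  fine (signed_esum (OmegaStar R N) (fun k => F k * cg_weight bs k)) / fine (cg_Z N bs).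
Arguments cg_E {R} N bs F.

Definition cg_Var (R : realType) (N : nat) (bs : R) (F : {ffun Lam N -> R} -> R) : R :=
  cg_E N bs (fun k => (F k - cg_E N bs F) ^+ 2).
Arguments cg_Var {R} N bs F.

Definition voltage (R : realType) (N : nat) (i j : Lam N) (k : {ffun Lam N -> R}) : R :=
  \sum_(l : Lam N) (green R i l - green R j l) * k l.
Arguments voltage R {N} i j k.

Definition phi_beta (R : realType) (b : R) : R := 480 * (3 * expR (- b)) ^+ 4.
Definition M_beta (R : realType) (b : R) : R :=
  2 * phi_beta b * (1 + phi_beta b) / (1 - phi_beta b) ^+ 3.

(* Main.v *)
(** By Poisson summation the Coulomb gas is dual to the integer-valued field [u] on the torus, grounded
    at [j], with weight [exp (- b * energy u)], [b = (4 * bs)^-1]: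
      [E* (cosh (bs / 2 * al * U)) = exp (bs / 2 * al ^ 2 * (G_ii - G_ij)) * E_u (cos (al * u_i))].
    Comparing the terms of order [al ^ 2] gives
      [E* (U ^ 2) = 4 / bs * (G_ii - G_ij) - 4 / bs ^ 2 * E_u (u_i ^ 2)],
    so everything reduces to [0 <= E_u (u_i ^ 2) <= M_b]. If [u_i = n + 1 > 0], some set [B] containing
    [i] but not [j] has the property that [u] decreases strictly across its boundary; subtracting the
    indicator of [B] lowers the energy by at least the length of the boundary. Counting the
    contours of given length yields [P (u_i = n + 1) <= phi (b) * P (u_i = n)], and [M_b] is the
    resulting bound of the second moment. Poisson summation itself comes from Polya's elementary
    proof of the theta identity, extended to several variables by Schur complements. *)
Require Import Defs.
From HB Require Import structures.
From mathcomp Require Import all_boot all_order all_algebra.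
From mathcomp Require Import all_classical all_reals all_analysis.
From mathcomp Require Import finmap ring lra zify.
Import Order.TTheory GRing.Theory Num.Theory.
Import numFieldNormedType.Exports.
Local Open Scope classical_set_scope.
Local Open Scope ring_scope.
Set Implicit Arguments. Unset Strict Implicit. Unset Printing Implicit Defensive.

(** * Absolutely convergent real sums *)

Section RealSums.
Context {R : realType}.
Implicit Types T : choiceType.

(** No constant of Poisson summation is ever computed: the identity at [al = 0] fixes it, and
    quotients of sums remove it. Nor is anything differentiated under a sum: with [t = al ^ 2],
    quadratic bounds of [ch] and [cos] and a quartic remainder of [ch] give inequalities for all
    small [t], and [t -> 0] finishes. The topological obstacle is that a contour on the torus may
    wind around it and fall into several pieces, so that it is not given by one closed walk. Walks
    shorter than [N] cannot wind, and in a cut of minimal boundary a separating one is the whole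
    contour; otherwise all pieces have length at least [N]. The value of [phi] leaves just enough
    room for the count: there are at most [19 / 10 * 10 ^ l] contours of length [l >= 4], and with
    [q = exp (- b) <= 1 / 20] they contribute at most [38000 * q ^ 4], while
    [480 * (3 * q) ^ 4 = 38880 * q ^ 4]. *)

Definition absum T (f : T -> R) : Prop :=
  (\esum_(x in [set: T]) (`|f x|)%:E < +oo)%E.

(** This is the signed sum inside [cg_E], over a whole type: once the charges are indexed by integer
    vectors, expectations are quotients of two such sums. It has its usual meaning only together
    with [absum]. *)
Definition rsum T (f : T -> R) : R := fine (signed_esum [set: T] f).

Lemma absum_le T (g f : T -> R) :
  (forall x, `|f x| <= `|g x|) -> absum g -> absum f.
Proof.
move=> fg; apply: le_lt_trans; apply: le_esum => x _.
by rewrite lee_fin.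
Qed.

Lemma eq_rsum T (f g : T -> R) : f =1 g -> rsum f = rsum g.
Proof. by move=> fg; congr rsum; apply/funext. Qed.

Lemma eq_absum T (f g : T -> R) : f =1 g -> absum f -> absum g.
Proof. by move=> fg; apply: absum_le => x; rewrite fg. Qed.

Lemma absum_esum T (f : T -> R) : (forall x, 0 <= f x) -> absum f ->
  \esum_(x in [set: T]) (f x)%:E = (fine (\esum_(x in [set: T]) (f x)%:E))%:E.
Proof.
move=> f0; rewrite /absum; under eq_esum do rewrite ger0_norm//.
move=> fin; rewrite fineK// ge0_fin_numE//.
by apply: esum_ge0 => x _; rewrite lee_fin.
Qed.

Lemma rsum_nonneg T (f : T -> R) : (forall x, 0 <= f x) ->
  rsum f = fine (\esum_(x in [set: T]) (f x)%:E).
Proof.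
move=> f0; rewrite /rsum /signed_esum [X in (_ - X)%E]esum1 ?sube0.
  congr fine; apply: eq_esum => x _; rewrite funeposE; apply/max_idPl.
  by rewrite lee_fin.
by move=> x _; rewrite funenegE; apply/max_idPr; rewrite -EFinN lee_fin oppr_le0.
Qed.

Lemma absum_rsum T (f : T -> R) : (forall x, 0 <= f x) -> absum f ->
  \esum_(x in [set: T]) (f x)%:E = (rsum f)%:E.
Proof. by move=> f0 sf; rewrite rsum_nonneg// -absum_esum. Qed.

Lemma rsum_split T (f u v : T -> R) :
  (forall x, 0 <= u x) -> (forall x, 0 <= v x) -> absum u -> absum v ->
  (forall x, f x = u x - v x) -> rsum f = rsum u - rsum v.
Proof.
move=> u0 v0 su sv fuv.
rewrite /rsum {1}/signed_esum (_ : (fun y => (f y)%:E) = (EFin \o u) \- (EFin \o v))%E; last first.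
  by apply/funext => x /=; rewrite fuv EFinB.
rewrite esumB//; [|by move=> x _; rewrite lee_fin..].
by rewrite /= !absum_rsum// -EFinB.
Qed.

Lemma absumD T (f g : T -> R) : absum f -> absum g -> absum (fun x => f x + g x).
Proof.
move=> sf sg; apply: (@absum_le _ (fun x => `|f x| + `|g x|)).
  by move=> x; rewrite [leRHS]ger0_norm ?addr_ge0// ler_normD.
rewrite /absum; under eq_esum do rewrite ger0_norm ?addr_ge0// EFinD.
by rewrite esumD// lte_add_pinfty.
Qed.

Lemma absum_abs T (f : T -> R) : absum f -> absum (fun x => `|f x|).
Proof. by apply: absum_le => x; rewrite normr_id. Qed.

Lemma absumZ T (c : R) (f : T -> R) : absum f -> absum (fun x => c * f x).
Proof.
(* A natural factor is repeated addition, and a real factor is dominated by the next natural number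
   above its absolute value. *)
move=> sf; suff K n (g : T -> R) : absum g -> absum (fun x => n%:R * g x).
  apply: (@absum_le _ (fun x => (Num.truncn `|c|).+1%:R * f x)); last exact: K.
  move=> x; rewrite !normrM ler_wpM2r// [leRHS]ger0_norm// ltW//.
  by rewrite truncnS_gt.
elim: n => [sg|n IH sg].
  by apply: absum_le sg => x; rewrite mul0r normr0.
by apply: eq_absum (absumD sg (IH sg)) => x; rewrite -addn1 natrD; ring.
Qed.

Lemma absumN T (f : T -> R) : absum f -> absum (fun x => - f x).
Proof. by apply: absum_le => x; rewrite normrN. Qed.

Lemma absumB T (f g : T -> R) : absum f -> absum g -> absum (fun x => f x - g x).
Proof. by move=> sf sg; apply: absumD => //; apply: absumN. Qed.

Definition rpos T (f : T -> R) x := Num.max (f x) 0.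

Lemma rpos_ge0 T (f : T -> R) x : 0 <= rpos f x.
Proof. by rewrite /rpos le_max lexx orbT. Qed.

Lemma rposE T (f : T -> R) x : f x = rpos f x - rpos (fun x => - f x) x.
Proof. by rewrite /rpos; case: (leP (f x) 0); case: (leP (- f x) 0); lra. Qed.

Lemma rpos_le T (f : T -> R) x : rpos f x <= `|f x|.
Proof. by rewrite /rpos ge_max ler_norm normr_ge0. Qed.

Lemma rpos_absum T (f : T -> R) : absum f -> absum (rpos f).
Proof. by apply: absum_le => x; rewrite ger0_norm ?rpos_ge0 ?rpos_le. Qed.

Lemma rsum_rpos T (f : T -> R) : absum f ->
  rsum f = rsum (rpos f) - rsum (rpos (fun x => - f x)).
Proof.
move=> sf; apply: rsum_split; do ?exact: rpos_ge0.
- exact: rpos_absum.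
- by apply: rpos_absum; apply: absumN.
- exact: rposE.
Qed.

Lemma rsumD_ge0 T (f g : T -> R) : (forall x, 0 <= f x) -> (forall x, 0 <= g x) ->
  absum f -> absum g -> rsum (fun x => f x + g x) = rsum f + rsum g.
Proof.
move=> f0 g0 sf sg; rewrite rsum_nonneg; last by move=> x; rewrite addr_ge0.
under eq_esum do rewrite EFinD.
by rewrite esumD ?absum_rsum// => x _; rewrite lee_fin.
Qed.

Lemma rsumD T (f g : T -> R) : absum f -> absum g ->
  rsum (fun x => f x + g x) = rsum f + rsum g.
Proof.
move=> sf sg; have sf' := absumN sf; have sg' := absumN sg.
rewrite (rsum_rpos sf) (rsum_rpos sg).
rewrite (@rsum_split _ _ (fun x => rpos f x + rpos g x)
  (fun x => rpos (fun x => - f x) x + rpos (fun x => - g x) x)).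
- rewrite !rsumD_ge0; do ?[exact: rpos_absum|exact: rpos_ge0]; ring.
- by move=> x; rewrite addr_ge0 ?rpos_ge0.
- by move=> x; rewrite addr_ge0 ?rpos_ge0.
- by apply: absumD; apply: rpos_absum.
- by apply: absumD; apply: rpos_absum.
- by move=> x; rewrite {1}(rposE f) {1}(rposE g); ring.
Qed.

Lemma rsum_ge0 T (f : T -> R) : (forall x, 0 <= f x) -> 0 <= rsum f.
Proof.
by move=> f0; rewrite rsum_nonneg// fine_ge0// esum_ge0// => x _; rewrite lee_fin.
Qed.

Lemma rsumN T (f : T -> R) : absum f -> rsum (fun x => - f x) = - rsum f.
Proof.
move=> sf; apply/eqP; rewrite -addr_eq0 -rsumD//; last exact: absumN.
rewrite rsum_nonneg; last by move=> x; rewrite addNr.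
by rewrite esum1// => x _; rewrite addNr.
Qed.

Lemma rsumB T (f g : T -> R) : absum f -> absum g ->
  rsum (fun x => f x - g x) = rsum f - rsum g.
Proof. by move=> sf sg; rewrite rsumD ?rsumN//; exact: absumN. Qed.

Lemma ler_rsum T (f g : T -> R) : absum f -> absum g ->
  (forall x, f x <= g x) -> rsum f <= rsum g.
Proof.
by move=> sf sg fg; rewrite -subr_ge0 -rsumB// rsum_ge0// => x; rewrite subr_ge0.
Qed.

Lemma ler_rsum_norm T (f : T -> R) : absum f -> `|rsum f| <= rsum (fun x => `|f x|).
Proof.
move=> sf; have sa := absum_abs sf; rewrite ler_norml -rsumN// !ler_rsum//.
- by move=> x; rewrite ler_norm.
- exact: absumN.
- by move=> x; rewrite lerNl -normrN ler_norm.
Qed.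

Lemma reindex_bij T1 T2 (h : T1 -> T2) : bijective h -> set_bij [set: T1] [set: T2] h.
Proof.
case=> h' hK h'K; split => //.
- by move=> x y _ _ /(can_inj hK).
- by move=> y _; exists (h' y).
Qed.

Lemma absum_reindex T1 T2 (h : T1 -> T2) (f : T2 -> R) : bijective h ->
  absum f <-> absum (fun x => f (h x)).
Proof. by move=> /reindex_bij hb; rewrite /absum (reindex_esum _ _ _ _ hb). Qed.

Lemma rsum_reindex T1 T2 (h : T1 -> T2) (f : T2 -> R) : bijective h ->
  rsum f = rsum (fun x => f (h x)).
Proof.
move=> /reindex_bij hb; rewrite /rsum /signed_esum.
rewrite !(reindex_esum _ _ _ _ hb); congr (fine (_ - _)%E); apply: eq_esum => x _.
  by rewrite !funeposE.
by rewrite !funenegE.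
Qed.

Lemma esum_pair T1 T2 (f : T1 * T2 -> R) : (forall x, 0 <= f x) ->
  \esum_(z in [set: T1 * T2]) (f z)%:E =
  \esum_(x in [set: T1]) \esum_(y in [set: T2]) (f (x, y))%:E.
Proof.
move=> f0; rewrite esum_esum; last by move=> *; rewrite lee_fin.
by congr esum; [apply/seteqP; split|apply/funext => -[]].
Qed.

Lemma absum_pair T1 T2 (f : T1 * T2 -> R) :
  (forall x, absum (fun y => f (x, y))) ->
  absum (fun x => rsum (fun y => `|f (x, y)|)) -> absum f.
Proof.
move=> s1 s2; rewrite /absum esum_pair//.
under eq_esum do rewrite (absum_rsum (fun y => normr_ge0 _) (absum_abs (s1 _))).
move: s2; rewrite /absum; apply: le_lt_trans; apply: le_esum => x _.
by rewrite lee_fin ler_norm.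
Qed.

Lemma absum_pairl T1 T2 (f : T1 * T2 -> R) x : absum f -> absum (fun y => f (x, y)).
Proof.
rewrite /absum esum_pair//; apply: le_lt_trans.
rewrite -[leLHS](@esum_set1 _ _ x (fun x => \esum_(y in [set: T2]) `|f (x, y)|%:E)%E).
  rewrite (esum_mkcond [set x]) => //.
  by apply: le_esum => z _; case: ifP => //; rewrite esum_ge0.
exact: esum_ge0.
Qed.

Lemma absum_pairr T1 T2 (f : T1 * T2 -> R) :
  absum f -> absum (fun x => rsum (fun y => f (x, y))).
Proof.
move=> sf; have sf1 x := absum_pairl x sf.
apply: (@absum_le _ (fun x => rsum (fun y => `|f (x, y)|))).
  move=> x; rewrite [leRHS]ger0_norm; first exact: ler_rsum_norm.
  exact: rsum_ge0.
rewrite /absum; under eq_esum do rewrite ger0_norm ?rsum_ge0//.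
under eq_esum do rewrite -(absum_rsum (fun y => normr_ge0 _) (absum_abs (sf1 _))).
by rewrite -(@esum_pair _ _ (fun z => `|f z|)).
Qed.

Lemma rsum_pair_ge0 T1 T2 (f : T1 * T2 -> R) : (forall z, 0 <= f z) -> absum f ->
  rsum f = rsum (fun x => rsum (fun y => f (x, y))).
Proof.
move=> f0 sf; rewrite rsum_nonneg// esum_pair// [RHS]rsum_nonneg; last first.
  by move=> x; exact: rsum_ge0.
congr fine; apply: eq_esum => x _; rewrite absum_rsum//.
exact: absum_pairl.
Qed.

Lemma rsum_pair T1 T2 (f : T1 * T2 -> R) : absum f ->
  rsum f = rsum (fun x => rsum (fun y => f (x, y))).
Proof.
move=> sf; have sf' := absumN sf; rewrite rsum_rpos// !rsum_pair_ge0;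
  do ?[exact: rpos_absum|exact: rpos_ge0].
rewrite -rsumB; do ?[by apply: absum_pairr; exact: rpos_absum].
apply: eq_rsum => x.
by rewrite (rsum_rpos (absum_pairl x sf)).
Qed.

Lemma absum_swap T1 T2 (f : T1 * T2 -> R) : absum f -> absum (fun z => f (z.2, z.1)).
Proof.
have B : bijective (fun z : T2 * T1 => (z.2, z.1)).
  by exists (fun z : T1 * T2 => (z.2, z.1)) => -[].
by move=> /(absum_reindex f B).
Qed.

Lemma rsum_exchange T1 T2 (f : T1 -> T2 -> R) : absum (fun z => f z.1 z.2) ->
  rsum (fun x => rsum (fun y => f x y)) = rsum (fun y => rsum (fun x => f x y)).
Proof.
move=> sf; rewrite -(rsum_pair sf) -(rsum_pair (absum_swap sf)).
rewrite (@rsum_reindex _ _ (fun z : T2 * T1 => (z.2, z.1)))//.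
by exists (fun z : T1 * T2 => (z.2, z.1)) => -[].
Qed.

Lemma esumZ T (c : R) (f : T -> R) : 0 < c -> (forall x, 0 <= f x) ->
  \esum_(x in [set: T]) (c * f x)%:E = (c%:E * \esum_(x in [set: T]) (f x)%:E)%E.
Proof.
move=> c0 f0; rewrite /esum -ereal_sup_pZl// image_comp; congr ereal_sup.
by apply: eq_imagel => A _ /=; rewrite ge0_mule_fsumr// => x; rewrite lee_fin.
Qed.

Lemma rsumZ_ge0 T (c : R) (f : T -> R) : 0 <= c -> (forall x, 0 <= f x) ->
  absum f -> rsum (fun x => c * f x) = c * rsum f.
Proof.
move=> c0 f0 sf; rewrite rsum_nonneg; last by move=> x; rewrite mulr_ge0.
move: c0; rewrite le_eqVlt => /predU1P[<-|c0].
  by rewrite esum1 ?mul0r// => x _; rewrite mul0r.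
by rewrite esumZ// absum_rsum.
Qed.

Lemma rsumZ T (c : R) (f : T -> R) : absum f ->
  rsum (fun x => c * f x) = c * rsum f.
Proof.
wlog c0 : c / 0 <= c => [W sf|sf].
  case: (leP 0 c) => c0; first exact: W.
  rewrite -[c]opprK mulNr -W//; last by rewrite oppr_ge0 ltW.
  rewrite -rsumN; last exact: absumZ.
  by apply: eq_rsum => x; rewrite mulNr.
have sf' := absumN sf; rewrite (rsum_rpos sf) mulrBr.
rewrite -!rsumZ_ge0; do ?[exact: rpos_absum|exact: rpos_ge0|exact: c0].
rewrite -rsumB; do ?[by apply: absumZ; exact: rpos_absum].
by apply: eq_rsum => x; rewrite -mulrBr -rposE.
Qed.

Lemma rsum_finite T (A : {fset T}) (f : T -> R) :
  (forall x, x \notin A -> f x = 0) -> absum f /\ rsum f = \sum_(x <- A) f x.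
Proof.
have H (g : T -> R) : (forall x, 0 <= g x) -> (forall x, x \notin A -> g x = 0) ->
    \esum_(x in [set: T]) (g x)%:E = (\sum_(x <- A) g x)%:E.
  move=> g0 gA; transitivity (\esum_(x in [set` A]) (g x)%:E).
    rewrite [RHS]esum_mkcond; apply: eq_esum => x _.
    by case: ifPn => //; rewrite notin_setE /= => /negP/gA ->.
  rewrite esum_fset//; last by move=> *; rewrite lee_fin.
  by rewrite fsbig_finite//= set_fsetK sumEFin.
have H2 (g : T -> R) : (forall x, 0 <= g x) -> (forall x, x \notin A -> g x = 0) ->
    rsum g = \sum_(x <- A) g x.
  by move=> g0 gA; rewrite rsum_nonneg// H.
move=> fA; have sf : absum f.
  by rewrite /absum H ?ltry// => x /fA ->; rewrite normr0.
split=> //; rewrite rsum_rpos// !H2; do ?[exact: rpos_ge0].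
- by rewrite -sumrB; apply: eq_bigr => x _; rewrite -rposE.
- by move=> x /fA; rewrite /rpos => ->; rewrite oppr0 maxxx.
- by move=> x /fA; rewrite /rpos => ->; rewrite maxxx.
Qed.

Lemma cvg_bigsum {U : Type} (F : set_system U) (I : Type) (r : seq I) (P : pred I)
    (f : I -> U -> R) (l : I -> R) : Filter F ->
  (forall i, P i -> f i x @[x --> F] --> l i) ->
  \sum_(i <- r | P i) f i x @[x --> F] --> \sum_(i <- r | P i) l i.
Proof.
move=> FF cf; elim: r => [|i r IH].
  by rewrite big_nil; under eq_cvg do rewrite big_nil; exact: cvg_cst.
rewrite big_cons; under eq_cvg do rewrite big_cons.
by case: ifPn => // Pi; apply: cvgD => //; exact: cf.
Qed.

(** Dominated convergence. A finite set [A] carries all but [e / 4] of the sum of [g]; on [A]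
    finitely many terms converge, and off [A] the bound [|f - F n| <= 2 * g] leaves at most
    [e / 2]. *)
Lemma rsum_cvg T (g f : T -> R) (F : nat -> T -> R) : absum g ->
  (forall n x, `|F n x| <= g x) -> (forall x, F n x @[n --> \oo] --> f x) ->
  rsum (F n) @[n --> \oo] --> rsum f.
Proof.
move=> sg Fg cF.
have g0 x : 0 <= g x by apply: le_trans (Fg 0%N x).
have fg x : `|f x| <= g x.
  by apply: (cvgr_to_le (cvg_norm (cF x))); apply: nearW.
have sF n : absum (F n).
  by apply: absum_le sg => x; rewrite [leRHS]ger0_norm.
have sf : absum f by apply: absum_le sg => x; rewrite [leRHS]ger0_norm.
apply/cvgrPdist_le => /= e e0.
have [A gA] : exists A : {fset T}, rsum g - e / 4 <= \sum_(x <- A) g x.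
  have e4 : 0 < e / 4 by rewrite divr_gt0.
  have : (((rsum g) - e / 4)%:E < \esum_(x in [set: T]) (g x)%:E)%E.
    by rewrite absum_rsum// lte_fin ltrBlDr ltrDl.
  move=> /ereal_sup_gt[_ [B [finB _] <-]] H.
  exists (fset_set B); move: H; rewrite fsbig_finite//= sumEFin lte_fin.
  exact: ltW.
pose h n x : R := `|f x - F n x|.
have h2 n x : h n x <= 2 * g x.
  by rewrite (le_trans (ler_normB _ _))// mulr_natl mulr2n lerD.
pose r (u : T -> R) x := if x \in A then u x else 0.
pose q (u : T -> R) x := if x \in A then 0 else u x.
have ruE u : absum (r u) /\ rsum (r u) = \sum_(x <- A) u x.
  have [|s1 ->] := @rsum_finite T A (r u); first by move=> x /negPf xA; rewrite /r xA.
  by split=> //; apply: eq_big_seq => x xA; rewrite /r xA.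
have quE (u : T -> R) : absum u -> absum (q u) /\ rsum (q u) = rsum u - \sum_(x <- A) u x.
  move=> su; have [s1 e1] := ruE u; rewrite -e1 -rsumB//; split.
    apply: absum_le su => x; rewrite /q; case: ifP => // _.
    by rewrite normr0.
  by apply: eq_rsum => x; rewrite /q /r; case: ifP; rewrite (subrr, subr0).
have hA : \sum_(x <- A) h n x @[n --> \oo] --> (0 : R).
  have := @cvg_bigsum nat \oo _ A xpredT (fun x n => h n x) (fun=> 0) _.
  rewrite big1//; apply => x _.
  rewrite -(normr0 R); apply: cvg_norm; rewrite -(subrr (f x)).
  by apply: cvgB; [exact: cvg_cst|exact: cF].
have e2 : 0 < e / 2 by rewrite divr_gt0.
move/cvgr0Pnorm_le : hA => /(_ _ e2); apply: filterS => n.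
rewrite ger0_norm; last by apply: sumr_ge0 => *; exact: normr_ge0.
move=> hn.
have sh : absum (h n) by apply: absum_abs; exact: absumB.
rewrite -rsumB// (le_trans (ler_rsum_norm _))//; first exact: absumB.
have [sq eq] := quE _ sh.
rewrite (_ : rsum _ = \sum_(x <- A) h n x + rsum (q (h n))); last by rewrite eq; ring.
have sg2 : absum (fun x => 2 * g x) by exact: absumZ.
have [sq2 eq2] := quE _ sg2.
have : rsum (q (h n)) <= rsum (q (fun x => 2 * g x)).
  by apply: ler_rsum => // x; rewrite /q; case: ifP.
rewrite eq2 rsumZ// -mulr_sumr; lra.
Qed.

End RealSums.

(** * Gaussian, trigonometric and binomial estimates *)

Section Estimates.
Context {R : realType}.
Implicit Types (x y a t : R).

Lemma nneseries_geometric_lty (q : R) : 0 <= q < 1 ->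
  (\esum_(i in [set: nat]) (q ^+ i)%:E < +oo)%E.
Proof.
move=> /andP[q0 q1]; rewrite -nneseries_esumT; last by move=> n; rewrite lee_fin exprn_ge0.
apply: (@le_lt_trans _ _ ((1 - q)^-1)%:E); last exact: ltry.
apply: lime_le; first by apply: is_cvg_nneseries => n _ _; rewrite lee_fin exprn_ge0.
apply: nearW => n; rewrite sumEFin lee_fin.
rewrite big_mkord -[leRHS]mul1r ler_pdivlMr ?subr_gt0//.
rewrite mulrC -opprB mulNr -subrX1 opprB lerBlDr lerDl exprn_ge0//.
Qed.

Lemma absum_geometric_int (q : R) : 0 <= q < 1 -> absum (fun j : int => q ^+ `|j|%N).
Proof.
move=> q01; have /andP[q0 q1] := q01; rewrite /absum.
under eq_esum do rewrite ger0_norm ?exprn_ge0//.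
rewrite (esumID (range Posz)); last by move=> *; rewrite lee_fin exprn_ge0.
rewrite !setTI (_ : ~` range Posz = range Negz); last first.
  apply/seteqP; split => [[n|n] //= H|_ [n _ <-] [m _]//]; last by exists n.
  by exfalso; apply: H; exists n.
rewrite !esum_image; [|by move=> ? ? _ _ []..].
rewrite lte_add_pinfty ?nneseries_geometric_lty//=.
apply: le_lt_trans (nneseries_geometric_lty q01); apply: le_esum => n _.
by rewrite lee_fin exprS ler_piMl ?exprn_ge0// ltW.
Qed.

Lemma absz_le_sqr (j : int) : (`|j|%N%:R : R) <= j%:~R ^+ 2.
Proof.
have -> : (j%:~R : R) ^+ 2 = (`|j|%N%:R) ^+ 2.
  by rewrite natr_absz intr_norm real_normK ?num_real.
by rewrite -natrX ler_nat; case: `|j|%N => // n; rewrite expnS expn1 leq_pmulr.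
Qed.

(** From [(j + x) ^ 2 - j ^ 2 / 2 + x ^ 2 = (j + 2 * x) ^ 2 / 2 >= 0], and [|j| <= j ^ 2] for
    integers. *)
Lemma gauss_le_geometric (k x : R) (j : int) : 0 < k ->
  expR (- (k * (j%:~R + x) ^+ 2)) <= expR (k * x ^+ 2) * expR (- (k / 2)) ^+ `|j|%N.
Proof.
move=> k0; rewrite -expRM_natl -expRD ler_expR.
have /(ler_wpM2l (ltW k0)) := absz_le_sqr j.
by have := mulr_ge0 (ltW k0) (sqr_ge0 (j%:~R + 2 * x)); nra.
Qed.

Lemma absum_gauss (k x : R) : 0 < k ->
  absum (fun j : int => expR (- (k * (j%:~R + x) ^+ 2))).
Proof.
move=> k0; pose q := expR (- (k / 2)).
have q01 : 0 <= q < 1 by rewrite expR_ge0 expR_lt1 oppr_lt0 divr_gt0.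
apply: absum_le (absumZ (expR (k * x ^+ 2)) (absum_geometric_int q01)) => j.
rewrite !ger0_norm ?mulr_ge0 ?expR_ge0 ?exprn_ge0 ?expR_ge0//.
exact: gauss_le_geometric.
Qed.

(** An integer translation moves [x] into [[0, 1)]. The uniformity serves when one coordinate is
    summed around a centre that depends on the others. *)
Lemma gauss_bound (k : R) : 0 < k -> exists2 K : R, 0 <= K & forall x,
  rsum (fun j : int => expR (- (k * (j%:~R + x) ^+ 2))) <= K.
Proof.
move=> k0; pose q := expR (- (k / 2)).
have q01 : 0 <= q < 1 by rewrite expR_ge0 expR_lt1 oppr_lt0 divr_gt0.
have sq := absum_geometric_int q01.
exists (expR k * rsum (fun j : int => q ^+ `|j|%N)) => [|x].
  by rewrite mulr_ge0 ?expR_ge0 ?rsum_ge0// => j; rewrite exprn_ge0 ?expR_ge0.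
rewrite -rsumZ// (@rsum_reindex _ _ _ (fun j : int => j - Num.floor x)); last first.
  by exists (fun j : int => j + Num.floor x) => j; rewrite ?subrK ?addrK.
have sg : absum (fun j : int => expR (- (k * ((j - Num.floor x)%:~R + x) ^+ 2))).
  apply: eq_absum (absum_gauss (x - (Num.floor x)%:~R) k0) => j.
  by congr (expR (- (k * _ ^+ 2))); rewrite rmorphB /=; ring.
apply: ler_rsum => //; first exact: absumZ.
move=> j; rewrite (_ : (j - Num.floor x)%:~R + x = j%:~R + (x - (Num.floor x)%:~R)); last first.
  by rewrite rmorphB /=; ring.
apply: le_trans (gauss_le_geometric _ _ k0) _.
rewrite ler_pM2r ?exprn_gt0 ?expR_gt0// ler_expR ler_piMr ?(ltW k0)//.
have /andP[f1 f2] := floor_itv x.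
by rewrite expr_le1// ?subr_ge0// lerBlDr ltW// addrC -[X in _ + X](rmorph1 (intmul 1)) -rmorphD.
Qed.

Lemma sin_mvt t : 0 <= t -> exists2 c, 0 <= c <= t & sin t = cos c * t.
Proof.
move=> t0; have [|c] := @MVT_segment R sin cos 0 t t0 (fun x _ => is_derive_sin x).
  by apply: continuous_subspaceT => x; exact: continuous_sin.
by rewrite in_itv /= => ct; rewrite sin0 !subr0 => ->; exists c.
Qed.

Lemma ler_cos x y : 0 <= x -> x <= y -> y <= pi -> cos y <= cos x.
Proof.
move=> x0; rewrite le_eqVlt => /predU1P[->//|xy] yp.
by rewrite ltW// ltr_cos// in_itv /= ?x0 ?yp ?(ltW (le_lt_trans x0 xy)) ?(ltW (lt_le_trans xy yp)).
Qed.

Lemma sin_norm2 t : sin `|t| ^+ 2 = sin t ^+ 2.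
Proof. by rewrite !sin2cos2 cos_norm. Qed.

Lemma pi_ge1 : 1 <= pi :> R.
Proof. by apply: le_trans (pi_ge2 R); rewrite ler1n. Qed.

Lemma cos_ge_cos1 t : `|t| <= 1 -> cos 1 <= cos t.
Proof. by move=> t1; rewrite -(cos_norm t) ler_cos ?pi_ge1. Qed.

Lemma sin2_ge t : `|t| <= 1 -> t ^+ 2 * cos t ^+ 2 <= sin t ^+ 2.
Proof.
move=> t1; rewrite -(sin_norm2 t) -(cos_norm t) -(real_normK (num_real t)).
have [c /andP[c0 ct] ->] := sin_mvt (normr_ge0 t).
have ct1 : cos `|t| <= cos c by rewrite ler_cos// (le_trans t1) ?pi_ge1.
have : 0 < cos `|t| by rewrite (lt_le_trans (@cos1_gt0 R))// cos_ge_cos1 ?normr_id.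
move=> p; rewrite exprMn mulrC ler_wpM2r ?exprn_ge0 ?normr_ge0//.
by rewrite lerXn2r ?nnegrE ?(ltW p)// (le_trans (ltW p)).
Qed.

Lemma sin2_le t : sin t ^+ 2 <= t ^+ 2.
Proof.
rewrite -(sin_norm2 t) -(real_normK (num_real t)).
have [c _ ->] := sin_mvt (normr_ge0 t).
by rewrite exprMn ler_piMl ?sqr_ge0// -(real_normK (num_real (cos c))) expr_le1 ?cos_max.
Qed.

Lemma onesub_expR_le y : 1 - y <= expR (- y).
Proof. exact: expR_ge1Dx. Qed.

Lemma onesub_expR_ge y : y < 1 -> expR (- (y / (1 - y))) <= 1 - y.
Proof.
move=> y1; have p : 0 < 1 - y by rewrite subr_gt0.
rewrite expRN -[leRHS]invrK lef_pV2 ?posrE ?expR_gt0 ?invr_gt0//.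
apply: le_trans (expR_ge1Dx _); rewrite le_eqVlt; apply/orP; left; apply/eqP.
by field; rewrite gt_eqF.
Qed.

Lemma cos2_expR_le t : `|t| <= 1 -> cos t ^+ 2 <= expR (- (t ^+ 2 * (1 - t ^+ 2))).
Proof.
move=> t1; rewrite cos2sin2; apply: le_trans (onesub_expR_le _) _.
rewrite ler_expR lerN2; apply: le_trans (sin2_ge t1).
by rewrite ler_wpM2l ?sqr_ge0// cos2sin2 lerB// sin2_le.
Qed.

Lemma cos2_expR_ge t : `|t| < 1 -> expR (- (t ^+ 2 / (1 - t ^+ 2))) <= cos t ^+ 2.
Proof.
move=> t1; apply: (@le_trans _ _ (1 - t ^+ 2)); last by rewrite cos2sin2 lerB// sin2_le.
by apply: onesub_expR_ge; rewrite -(real_normK (num_real t)) expr_lt1.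
Qed.

(** With [h = t / 2], [sin t ^ 2 = 4 * sin h ^ 2 * cos h ^ 2 >= t ^ 2 * cos h ^ 4]. The range
    reaches beyond [pi / 2], which leaves room for a phase in the cosine sums. *)
Lemma cos2_gauss t : `|t| <= 2 -> cos t ^+ 2 <= expR (- (cos 1 ^+ 4 * t ^+ 2)).
Proof.
move=> t2; rewrite cos2sin2; apply: le_trans (onesub_expR_le _) _.
rewrite ler_expR lerN2; pose h := t / 2.
have h1 : `|h| <= 1 by rewrite normrM [X in _ * X]ger0_norm ?invr_ge0// ler_pdivrMr// mul1r.
rewrite (_ : t = h *+ 2); last by rewrite /h mulr2n; field.
rewrite sin_mulr2n !mulr2n.
have c1 := cos_ge_cos1 h1; have c0 := @cos1_gt0 R; have s := sin2_ge h1.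
have cc : cos 1 ^+ 2 <= cos h ^+ 2 by rewrite lerXn2r ?nnegrE ?(ltW c0)// (le_trans (ltW c0)).
have c4 : cos 1 ^+ 4 <= cos h ^+ 4.
  by rewrite -[4%N]/(2 * 2)%N !exprM lerXn2r ?nnegrE ?sqr_ge0.
have := ler_wpM2r (sqr_ge0 h) c4; have := ler_wpM2r (sqr_ge0 (cos h)) s.
nra.
Qed.

(** Normalising by the central coefficient gives a Gaussian limit without Stirling's formula. The
    value is 0 for [p > n]. *)
Definition binr (n p : nat) : R := 'C(n.*2, n + p)%:R / 'C(n.*2, n)%:R.

Lemma bin_mid_gt0 n : 0 < 'C(n.*2, n)%:R :> R.
Proof. by rewrite ltr0n bin_gt0 -addnn leq_addr. Qed.

Lemma binr0 n : binr n 0 = 1.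
Proof. by rewrite /binr addn0 divff// gt_eqF ?bin_mid_gt0. Qed.

Lemma binr_ge0 n p : 0 <= binr n p.
Proof. by rewrite divr_ge0. Qed.

Lemma binrS n p : (p <= n)%N ->
  binr n p.+1 = binr n p * (1 - (2 * p%:R + 1) / (n%:R + p%:R + 1)).
Proof.
move=> pn; have := mul_bin_left n.*2 (n + p).
rewrite /binr addnS -addnn subnDl => /(congr1 (fun k => k%:R : R)).
have C0 := bin_mid_gt0 n; rewrite -addnn in C0.
move: C0; move: 'C(n + n, n) 'C(n + n, n + p) 'C(n + n, (n + p).+1) => D C B C0.
rewrite !natrM natrB// -natr1 natrD => E.
have d : (n%:R + p%:R + 1 : R) != 0 by rewrite -natrD natr1 pnatr_eq0.
rewrite -[B%:R](mulKf d) E; field.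
by rewrite d gt_eqF.
Qed.

(** Each step of [binrS] brings a factor of at most [exp (- (2 * q + 1) / (n + p))], and the odd
    numbers [2 * q + 1] with [q < p] add up to [p ^ 2]. *)
Lemma binr_le n p : (p <= n)%N -> (0 < n)%N -> binr n p <= expR (- (p%:R ^+ 2 / (n%:R + p%:R))).
Proof.
move=> pn n0; have np : 0 < n%:R + p%:R :> R by rewrite -natrD ltr0n addn_gt0 n0.
suff: forall q, (q <= p)%N -> binr n q <= expR (- (q%:R ^+ 2 / (n%:R + p%:R))) by apply.
elim=> [_|q IH qp]; first by rewrite binr0 expr0n mul0r oppr0 expR0.
rewrite binrS; last by rewrite (leq_trans _ pn)// ltnW.
have nq : 0 < n%:R + q%:R + 1 :> R by rewrite ltr_wpDl// addr_ge0.
apply: (@le_trans _ _ (binr n q * expR (- ((2 * q%:R + 1) / (n%:R + p%:R))))).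
  rewrite ler_wpM2l ?binr_ge0//; apply: le_trans (onesub_expR_le _) _.
  rewrite ler_expR lerN2 ler_pM2l ?ltr_wpDl ?mulr_ge0// lef_pV2 ?posrE//.
  by rewrite -addrA lerD2l natr1 ler_nat.
apply: le_trans (ler_wpM2r (expR_ge0 _) (IH (ltnW qp))) _.
rewrite -expRD ler_expR le_eqVlt; apply/orP; left; apply/eqP.
by rewrite -natr1; field; rewrite gt_eqF.
Qed.

Lemma binr_ge n p : (p < n)%N -> expR (- (p%:R ^+ 2 / (n%:R - p%:R))) <= binr n p.
Proof.
move=> pn; have np : 0 < n%:R - p%:R :> R by rewrite subr_gt0 ltr_nat.
suff: forall q, (q <= p)%N -> expR (- (q%:R ^+ 2 / (n%:R - p%:R))) <= binr n q by apply.
elim=> [_|q IH qp]; first by rewrite binr0 expr0n mul0r oppr0 expR0.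
have qn : (q < n)%N := ltn_trans qp pn.
rewrite binrS; last exact: ltnW.
have nq : 0 < n%:R + q%:R + 1 :> R by rewrite ltr_wpDl// addr_ge0.
have qn0 : 0 < n%:R - q%:R :> R by rewrite subr_gt0 ltr_nat.
apply: (@le_trans _ _ (binr n q * expR (- ((2 * q%:R + 1) / (n%:R - p%:R))))); last first.
  rewrite ler_wpM2l ?binr_ge0//; apply: le_trans (onesub_expR_ge _); last first.
    by rewrite ltr_pdivrMr// mul1r -subr_gt0; rewrite [ltRHS](_ : _ = n%:R - q%:R)//; ring.
  have e1 : 1 - (2 * q%:R + 1) / (n%:R + q%:R + 1) = (n%:R - q%:R) / (n%:R + q%:R + 1) :> R.
    by field; rewrite gt_eqF.
  rewrite ler_expR lerN2 e1 invf_div mulrA divfK ?gt_eqF//.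
  rewrite ler_pM2l ?ltr_wpDl ?mulr_ge0// lef_pV2 ?posrE//.
  by rewrite lerD2l lerN2 ler_nat ltnW.
apply: le_trans (ler_wpM2r (expR_ge0 _) (IH (ltnW qp))).
rewrite -expRD ler_expR le_eqVlt; apply/orP; left; apply/eqP.
by rewrite -natr1; field; rewrite gt_eqF.
Qed.

Lemma binr_gauss n p : (0 < n)%N -> binr n p <= expR (- (p%:R ^+ 2 / (2 * n%:R))).
Proof.
move=> n0; case: (leqP p n) => pn; last first.
  by rewrite /binr bin_small ?mul0r ?expR_ge0// -addnn ltn_add2l.
apply: le_trans (binr_le pn n0) _; rewrite ler_expR lerN2 ler_wpM2l ?sqr_ge0//.
rewrite lef_pV2 ?posrE ?mulr_gt0 ?ltr0n// -?natrD ?ltr0n ?addn_gt0 ?n0//.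
by rewrite mulr_natl mulr2n natrD lerD2l ler_nat.
Qed.

End Estimates.

(** * Poisson summation in one variable *)

Section TrigSums.
Context {R : realType}.
Implicit Types (u c a : R).

Lemma cosD2piz (x : R) (k : int) : cos (x + 2 * pi * k%:~R) = cos x.
Proof.
have H n (y : R) : cos (y + 2 * pi * n%:R) = cos y.
  by rewrite -(periodicn (@cosD2pi R) n y); congr (cos (y + _)); rewrite -mulr_natr mulr2n; ring.
case: k => n; first exact: H.
rewrite NegzE -(H n.+1); congr cos; rewrite rmorphN /=; ring.
Qed.

Lemma cos_mul2 (x y : R) : 2 * cos x * cos y = cos (y + x) + cos (y - x) :> R.
Proof. by rewrite cosD cosB; ring. Qed.

Lemma cos_pow_expand M u c :
  (2 * cos (u / 2)) ^+ M * cos c =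
  \sum_(q < M.+1) 'C(M, q)%:R * cos ((q%:R - M%:R / 2) * u + c).
Proof.
elim: M c => [|M IH] c.
  by rewrite big_ord1 bin0 !mul1r mul0r subrr mul0r add0r.
pose g (q : nat) := cos ((q%:R - M.+1%:R / 2) * u + c).
rewrite exprS mulrAC mulrC cos_mul2 mulrDr !IH.
rewrite [LHS](_ : _ = \sum_(q < M.+1) 'C(M, q)%:R * g q.+1 + \sum_(q < M.+1) 'C(M, q)%:R * g q); last first.
  by congr (_ + _); apply: eq_bigr => q _; congr (_ * cos _); rewrite -!natr1; field.
transitivity (g 0%N + (\sum_(q < M.+1) 'C(M, q.+1)%:R * g q.+1 + \sum_(q < M.+1) 'C(M, q)%:R * g q.+1)); last first.
  rewrite -big_split /= [RHS]big_ord_recl bin0 mul1r; congr (_ + _); apply: eq_bigr => q _.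
  by rewrite lift0 binS natrD mulrDl.
rewrite addrA addrC; congr (_ + _).
transitivity (\sum_(q < M.+2) 'C(M, q)%:R * g q).
  by rewrite [RHS]big_ord_recr /= bin_small// mul0r addr0.
by rewrite big_ord_recl /= bin0 mul1r.
Qed.

(** Rotation by [al] permutes the summands, so it fixes the vector [(S, T)] of cosine and sine sums;
    as [cos al != 1], this vector vanishes. *)
Lemma sum_cos_cycle (l : nat) (P : int) c : (0 < l)%N -> ~~ (l %| P)%Z ->
  \sum_(s < l) cos (2 * pi * P%:~R / l%:R * s%:R + c) = 0 :> R.
Proof.
move=> l0 lP; have lR : 0 < l%:R :> R by rewrite ltr0n.
set al : R := _ / _.
have ca1 : cos al != 1.
  (* Modulo [2 * pi], the angle [al] is twice an angle [h] strictly between 0 and [pi], whose sine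
     is positive. *)
  pose r := (P %% l)%Z.
  have r0 : 0 < r.
    rewrite lt_def modz_ge0 ?andbT; last by rewrite gt_eqF// ltz_nat.
    by apply: contra lP => /eqP/dvdz_mod0P.
  have rl : r < l by rewrite ltz_pmod// ltz_nat.
  pose h : R := pi * r%:~R / l%:R.
  have -> : cos al = cos (h *+ 2).
    rewrite -[RHS](cosD2piz _ (P %/ l)%Z) /al /h {1}(divz_eq P l) rmorphD rmorphM /=.
    congr cos; rewrite mulr2n -/r; field; rewrite gt_eqF//.
  have s0 : 0 < sin h.
    apply: sin_gt0_pi; rewrite divr_gt0 ?mulr_gt0 ?pi_gt0 ?ltr0z//=.
    by rewrite ltr_pdivrMr// ltr_pM2l ?pi_gt0// -[l%:R]/(l%:~R) ltr_int.
  rewrite cos_mulr2n cos2sin2 mulr2n lt_eqF//.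
  by have := exprn_gt0 2 s0; lra.
pose S := \sum_(s < l) cos (al * s%:R + c); pose T := \sum_(s < l) sin (al * s%:R + c).
have all : al * l%:R = 2 * pi * P%:~R by rewrite /al divfK ?gt_eqF.
have shift (f : R -> R) : f (al * l%:R + c) = f c ->
    \sum_(s < l) f (al * s%:R + c + al) = \sum_(s < l) f (al * s%:R + c).
  move=> fl; have : \sum_(s < l.+1) f (al * s%:R + c) = \sum_(s < l.+1) f (al * s%:R + c) by [].
  rewrite {1}big_ord_recr [RHS]big_ord_recl /= fl mulr0 add0r [RHS]addrC => /addIr ->.
  by apply: eq_bigr => s _; rewrite /bump /= add1n -natr1; congr f; ring.
have ES : S = cos al * S - sin al * T.
  rewrite {1}/S -shift; last by rewrite all addrC cosD2piz.
  by rewrite /S /T !mulr_sumr -sumrB; apply: eq_bigr => s _; rewrite cosD; ring.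
have ET : T = sin al * S + cos al * T.
  rewrite {1}/T -shift; last by rewrite all addrC -!cosBpihalf -addrAC cosD2piz.
  by rewrite /S /T !mulr_sumr -big_split; apply: eq_bigr => s _; rewrite sinD /=; ring.
have : S * (2 - 2 * cos al) = 0.
  have := cos2Dsin2 al; move: ES ET; move: (cos al) (sin al) (S) (T) => C s x y.
  move=> ES ET E; have e1 : (1 - C) * x = - (s * y) by lra.
  have e2 : (1 - C) * y = s * x by lra.
  have -> : 2 - 2 * C = (1 - C) * (1 - C) + s * s by lra.
  rewrite mulrDr (mulrCA x) -[X in _ * X](mulrC) e1 mulrN (mulrCA _ s) e2; ring.
move/eqP; rewrite mulf_eq0 => /orP[/eqP//|].
by rewrite -[X in X - _]mulr1 -mulrBr mulf_eq0 pnatr_eq0 /= subr_eq0 eq_sym (negPf ca1).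
Qed.

Lemma rsum_bigsum (T : choiceType) (I : Type) (r : seq I) (f : I -> T -> R) :
  (forall i, absum (f i)) ->
  absum (fun x => \sum_(i <- r) f i x) /\
  rsum (fun x => \sum_(i <- r) f i x) = \sum_(i <- r) rsum (f i).
Proof.
move=> sf; elim: r => [|i r [IH1 IH2]].
  have [s0 e0] := @rsum_finite R T fset0 (fun=> 0) (fun _ _ => erefl).
  rewrite big_nil; split; last by under eq_rsum do rewrite big_nil; rewrite e0 big_nil.
  by apply: eq_absum s0 => x; rewrite big_nil.
have E z : \sum_(j <- i :: r) f j z = f i z + \sum_(j <- r) f j z by rewrite big_cons.
split; first by apply: (eq_absum (fun z => esym (E z))); exact: absumD.
by rewrite (eq_rsum E) rsumD// IH2 big_cons.
Qed.

Lemma rsum_deltas (T : choiceType) (I : Type) (r : seq I) (h : I -> T) (g : I -> R) :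
  absum (fun x => \sum_(i <- r) if x == h i then g i else 0) /\
  rsum (fun x => \sum_(i <- r) if x == h i then g i else 0) = \sum_(i <- r) g i.
Proof.
have H i : absum (fun x => if x == h i then g i else 0) /\
    rsum (fun x => if x == h i then g i else 0) = g i.
  have [|s1 ->] := @rsum_finite R T [fset h i]%fset (fun x => if x == h i then g i else 0).
    by move=> x; rewrite inE => /negPf ->.
  by split=> //; rewrite big_seq_fset1 eqxx.
have [|s1 ->] := @rsum_bigsum T I r (fun i x => if x == h i then g i else 0).
  by move=> i; have [] := H i.
by split=> //; apply: eq_bigr => i _; have [] := H i.
Qed.

(* Polya: expand the cosine power by the binomial theorem and sum over l-th roots of unity. *)
Lemma polya_identity (l n : nat) (r nu0 : int) (th c : R) : (0 < l)%N ->
  let u (s : nat) := (th + 2 * pi * (s%:Z + nu0)%:~R) / l%:R in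
  \sum_(s < l) (4 * cos (u s / 2) ^+ 2) ^+ n * cos (c - r%:~R * u s) =
  l%:R * 'C(n.*2, n)%:R * rsum (fun j : int => binr n (absz (r + l%:Z * j)) * cos (j%:~R * th + c)).
Proof.
move=> l0 u; have lR : 0 < l%:R :> R by rewrite ltr0n.
have lZ : l%:Z != 0 by rewrite eqz_nat gt_eqF.
pose P (q : nat) : int := q%:Z - n%:Z - r.
pose g (q : 'I_n.*2.+1) : R := if (l %| P q)%Z then
  'C(n.*2, q)%:R / 'C(n.*2, n)%:R * cos ((P q %/ l)%Z%:~R * th + c) else 0.
transitivity (l%:R * 'C(n.*2, n)%:R * \sum_(q < n.*2.+1) g q).
  under eq_bigr => s _.
    rewrite (_ : 4 * _ = (2 * cos (u s / 2)) ^+ 2); last by rewrite exprMn -natrX.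
    rewrite -exprM mul2n cos_pow_expand; over.
  rewrite exchange_big /= mulr_sumr; apply: eq_bigr => q _.
  rewrite -mulr_sumr /g; have uE s : (q%:R - n.*2%:R / 2) * u s + (c - r%:~R * u s) = (P q)%:~R * u s + c.
    have -> : n.*2%:R = n%:R * 2 :> R by rewrite -muln2 natrM.
    by rewrite /P !rmorphB /= mulfK ?pnatr_eq0//; ring.
  under eq_bigr do rewrite uE.
  case: ifPn => lP.
    under eq_bigr => s _.
      rewrite (_ : cos _ = cos ((P q %/ l)%Z%:~R * th + c)); last first.
        rewrite -[RHS](cosD2piz _ ((P q %/ l)%Z * (s%:Z + nu0))).
        rewrite -{1}(divzK lP) /u !rmorphM /=; congr cos; field; rewrite gt_eqF//.
      over.
    rewrite sumr_const card_ord -mulr_natl; field.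
    by rewrite gt_eqF ?bin_mid_gt0.
  rewrite mulr0; under eq_bigr => s _.
    rewrite (_ : _ + c = 2 * pi * (P q)%:~R / l%:R * s%:R + ((P q)%:~R * (th + 2 * pi * nu0%:~R) / l%:R + c)); last first.
      by rewrite /u rmorphD /=; field; rewrite gt_eqF.
    over.
  by rewrite sum_cos_cycle ?mulr0.
congr (_ * _); have [_ <-] := @rsum_deltas int _ (index_enum 'I_n.*2.+1) (fun q => (P q %/ l)%Z) g.
apply: eq_rsum => j.
have key (q : 'I_n.*2.+1) : (if j == (P q %/ l)%Z then g q else 0) =
    if q%:Z == n%:Z + (r + l%:Z * j) then binr n (absz (r + l%:Z * j)) * cos (j%:~R * th + c) else 0.
  rewrite /g; case: eqP => [jE|jE].
    case: ifPn => [lP|lP].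
      have Pl : P q = l%:Z * j by rewrite jE mulrC divzK.
      rewrite ifT; last by apply/eqP; rewrite -Pl /P; ring.
      rewrite -jE /binr; congr (_ / _ * _).
      have -> : r + l%:Z * j = q%:Z - n%:Z by rewrite -Pl /P; ring.
      have qn : (q <= n.*2)%N by rewrite -ltnS.
      case: (leqP n q) => nq.
        by rewrite subzn// absz_nat subnKC.
      rewrite -(bin_sub qn) distnC subzn 1?ltnW// absz_nat; congr ('C(_, _)%:R).
      by have := addnn n; lia.
    rewrite ifF//; apply/negbTE; apply: contra lP => /eqP qE.
    by apply/dvdzP; exists j; rewrite /P qE; ring.
  rewrite ifF//; apply/negP => /eqP qE; apply: jE.
  have -> : P q = j * l by rewrite /P qE; ring.
  by rewrite mulzK.
rewrite (eq_bigr _ (fun q _ => key q)).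
set p : int := r + _.
case: (leqP (absz p) n) => pn.
  have q0P : (absz (n%:Z + p)%R < n.*2.+1)%N by have := addnn n; lia.
  rewrite (bigD1 (Ordinal q0P)) //= ifT; last by apply/eqP; lia.
  rewrite big1 ?addr0// => q /negP qq; rewrite ifF//; apply/negP => /eqP qE; apply: qq.
  by apply/eqP/val_inj => /=; lia.
rewrite big1 => [|q _].
  by rewrite /binr bin_small ?mul0r// -addnn ltn_add2l.
rewrite ifF//; apply/negP => /eqP qE; have := ltn_ord q.
by have := addnn n; lia.
Qed.

End TrigSums.

(** * The limit of Polya's identity *)

Section ThetaPrelim.
Context {R : realType}.

Lemma cvg_exp2 {T : Type} {F : set_system T} {FF : Filter F} (f : T -> R) (l : R) :
  f x @[x --> F] --> l -> f x ^+ 2 @[x --> F] --> l ^+ 2.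
Proof. by move=> fl; rewrite expr2; under eq_cvg do rewrite expr2; exact: cvgM. Qed.

Lemma cvg_inv {T : Type} {F : set_system T} {FF : Filter F} (f : T -> R) (l : R) :
  l != 0 -> f x @[x --> F] --> l -> (f x)^-1 @[x --> F] --> l^-1.
Proof. by move=> l0 fl; exact: (cvgV l0 fl). Qed.

Lemma pi_neq0 : (pi : R) != 0.
Proof. by rewrite gt_eqF ?pi_gt0. Qed.

(** With [l = 2 * (n + 1)] roots of unity the exponent is asymptotic to [l ^ 2 / a], the scale on
    which the cosine powers and the binomial ratios both have Gaussian limits. *)
Definition polya_steps (a : R) (n : nat) : nat := (Num.truncn ((n.+1.*2)%:R ^+ 2 / a)).+1.

(** The factor depends on none of [x], [th], [c], so its limit can be found from one choice of
    them. *)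
Definition polya_const (a : R) (n : nat) : R :=
  (n.+1.*2)%:R * 'C((polya_steps a n).*2, polya_steps a n)%:R / 4 ^+ polya_steps a n.

End ThetaPrelim.

Section Theta.
Context {R : realType}.
Variables (a x : R).
Hypothesis a0 : 0 < a.

Let l (n : nat) : nat := n.+1.*2.
Let lR n : R := (l n)%:R.
Let N (n : nat) : nat := polya_steps a n.
Let r (n : nat) : int := Num.floor (x * lR n).

Let l_gt0 n : 0 < lR n. Proof. by rewrite ltr0n. Qed.
Let l_ge1 n : 1 <= lR n. Proof. by rewrite ler1n. Qed.

Let linv_cvg : (lR n)^-1 @[n --> \oo] --> (0 : R).
Proof.
apply: (@squeeze_cvgr _ _ _ _ (cst 0) (@harmonic R)); last 2 first.
- exact: cvg_cst.
- exact: cvg_harmonic.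
apply: nearW => n /=; rewrite invr_ge0 ltW ?l_gt0//= lef_pV2 ?posrE ?l_gt0//.
by rewrite ler_nat /l -addnn leq_addr.
Qed.

Let N_bounds n : lR n ^+ 2 / a <= (N n)%:R <= lR n ^+ 2 / a + 1.
Proof.
have h : 0 <= lR n ^+ 2 / a by rewrite divr_ge0 ?sqr_ge0 ?ltW.
have /andP[h1 h2] := truncn_itv h.
by rewrite (ltW h2) /N /polya_steps -natr1 lerD2r h1.
Qed.

Let Nl_cvg : (N n)%:R / lR n ^+ 2 @[n --> \oo] --> a^-1.
Proof.
apply: (@squeeze_cvgr _ _ _ _ (cst a^-1) (fun n => a^-1 + (lR n)^-1 * (lR n)^-1)); last 2 first.
- exact: cvg_cst.
- rewrite -[X in _ --> X]addr0 -(mulr0 0); apply: cvgD; first exact: cvg_cst.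
  exact: cvgM.
apply: nearW => n /=; have /andP[h1 h2] := N_bounds n.
have L : 0 < lR n ^+ 2 by rewrite exprn_gt0.
rewrite ler_pdivlMr// mulrC h1 /= ler_pdivrMr//.
by rewrite mulrDl [X in _ + X](_ : _ = 1) ?(mulrC a^-1)//; field; rewrite gt_eqF.
Qed.

Let r_bounds n : x - (lR n)^-1 <= (r n)%:~R / lR n <= x.
Proof.
have /andP[h1 h2] := floor_itv (x * lR n).
rewrite ler_pdivrMr// h1 andbT ler_pdivlMr// mulrBl mulVf ?gt_eqF//.
by rewrite lerBlDr; move: h2; rewrite rmorphD /= => /ltW.
Qed.

Let r_cvg : (r n)%:~R / lR n @[n --> \oo] --> x.
Proof.
apply: (@squeeze_cvgr _ _ _ _ (fun n => x - (lR n)^-1) (cst x)); last 2 first.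
- by rewrite -[X in _ --> X]subr0; apply: cvgB => //; exact: cvg_cst.
- exact: cvg_cst.
apply: nearW => n; exact: r_bounds.
Qed.

Let cos_cvg (s : R) : (cos (s / lR n / 2) ^+ 2) ^+ N n @[n --> \oo] --> expR (- (s ^+ 2 / (4 * a))).
Proof.
pose y n := s / lR n / 2.
have y0 : y n @[n --> \oo] --> (0 : R).
  rewrite (_ : y = fun n => s / 2 * (lR n)^-1); last by apply/funext => n; rewrite /y mulrAC.
  by rewrite -(mulr0 (s / 2)); apply: cvgM => //; exact: cvg_cst.
have y2 : y n ^+ 2 @[n --> \oo] --> (0 : R).
  by rewrite -[X in _ --> X](mulr0 (0 : R)) -[X in _ --> X]expr2; exact: cvg_exp2.
have Ny : (N n)%:R * y n ^+ 2 @[n --> \oo] --> s ^+ 2 / (4 * a).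
  rewrite (_ : (fun n => _) = (fun n => s ^+ 2 / 4 * ((N n)%:R / lR n ^+ 2))).
    rewrite (_ : s ^+ 2 / (4 * a) = s ^+ 2 / 4 * a^-1); last by field; rewrite gt_eqF.
    by apply: cvgM => //; exact: cvg_cst.
  by apply/funext => n; rewrite /y; field; rewrite gt_eqF.
have c1 : 1 - y n ^+ 2 @[n --> \oo] --> (1 : R).
  by rewrite -[X in _ --> X]subr0; apply: cvgB => //; exact: cvg_cst.
apply: (@squeeze_cvgr _ _ _ _ (fun n => expR (- ((N n)%:R * y n ^+ 2 / (1 - y n ^+ 2))))
  (fun n => expR (- ((N n)%:R * y n ^+ 2 * (1 - y n ^+ 2))))); last 2 first.
- apply: continuous_cvg; first exact: continuous_expR.
  apply: cvgN; rewrite -[X in _ --> X]mulr1 -[X in _ * X]invr1.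
  apply: cvgM => //. apply: cvg_inv; [exact: oner_neq0|exact: c1].
- apply: continuous_cvg; first exact: continuous_expR.
  by apply: cvgN; rewrite -[X in _ --> X]mulr1; apply: cvgM.
near=> n; have y1 : `|y n| < 1 by near: n; exact: (cvgr0_norm_lt y y0 1 ltr01).
have -> : - ((N n)%:R * y n ^+ 2 / (1 - y n ^+ 2)) = (N n)%:R * - (y n ^+ 2 / (1 - y n ^+ 2)) by ring.
have -> : - ((N n)%:R * y n ^+ 2 * (1 - y n ^+ 2)) = (N n)%:R * - (y n ^+ 2 * (1 - y n ^+ 2)) by ring.
rewrite !expRM_natl !lerXn2r ?nnegrE ?expR_ge0 ?sqr_ge0 ?cos2_expR_le ?(ltW y1)//.
exact: cos2_expR_ge.
Unshelve. all: by end_near. Qed.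

Let p n (j : int) : int := r n + (l n)%:Z * j.

Let p_cvg j : `|p n j|%N%:R / lR n @[n --> \oo] --> `|x + j%:~R|.
Proof.
rewrite (_ : (fun n => _) = (fun n => `|(r n)%:~R / lR n + j%:~R|)).
  by apply: cvg_norm; apply: cvgD => //; exact: cvg_cst.
apply/funext => n; rewrite -[in LHS](ger0_norm (ltW (l_gt0 n))) natr_absz intr_norm -normf_div /p.
by congr `|_|; rewrite rmorphD rmorphM /= mulrDl -/(lR n); congr (_ + _); field; rewrite gt_eqF.
Qed.

Let binr_cvg j : binr (N n) `|p n j|%N @[n --> \oo] --> expR (- (a * (j%:~R + x) ^+ 2)).
Proof.
pose q n : R := `|p n j|%N%:R; pose M n : R := (N n)%:R.
have M0 n : 0 < M n by rewrite ltr0n.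
have Vc : lR n ^+ 2 / M n @[n --> \oo] --> a.
  rewrite (_ : (fun n => _) = (fun n => (M n / lR n ^+ 2)^-1)); last by apply/funext => n; rewrite invf_div.
  by rewrite -[X in _ --> X]invrK; apply: cvg_inv => //; rewrite invr_eq0 gt_eqF.
have qq : q n ^+ 2 / M n @[n --> \oo] --> a * (j%:~R + x) ^+ 2.
  rewrite (_ : (fun n => _) = (fun n => lR n ^+ 2 / M n * (q n / lR n) ^+ 2)).
    rewrite -(real_normK (num_real (_ + _))) [_ + x]addrC.
    by apply: cvgM => //; apply: cvg_exp2; exact: p_cvg.
  by apply/funext => n; field; rewrite !gt_eqF.
have q0 : q n / M n @[n --> \oo] --> (0 : R).
  rewrite (_ : (fun n => _) = (fun n => lR n ^+ 2 / M n * (q n / lR n) * (lR n)^-1)).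
    rewrite -(mulr0 (a * `|x + j%:~R|)).
    by apply: cvgM => //; apply: cvgM => //; exact: p_cvg.
  by apply/funext => n; field; rewrite !gt_eqF.
apply: (@squeeze_cvgr _ _ _ _ (fun n => expR (- (q n ^+ 2 / M n / (1 - q n / M n))))
  (fun n => expR (- (q n ^+ 2 / M n / (1 + q n / M n))))); last 2 first.
- apply: continuous_cvg; first exact: continuous_expR.
  apply: cvgN; rewrite -[X in _ --> X]mulr1 -[X in _ * X]invr1 -[X in X^-1]subr0.
  apply: cvgM => //; apply: cvg_inv; first by rewrite subr0 oner_neq0.
  by apply: cvgB => //; exact: cvg_cst.
- apply: continuous_cvg; first exact: continuous_expR.
  apply: cvgN; rewrite -[X in _ --> X]mulr1 -[X in _ * X]invr1 -[X in X^-1]addr0.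
  apply: cvgM => //; apply: cvg_inv; first by rewrite addr0 oner_neq0.
  by apply: cvgD => //; exact: cvg_cst.
near=> n; have : `|q n / M n| < 1 by near: n; exact: (cvgr0_norm_lt (fun n => q n / M n) q0 1 ltr01).
rewrite ger0_norm ?divr_ge0// ltr_pdivrMr// mul1r => qM.
have pN : (`|p n j| < N n)%N by move: qM; rewrite ltr_nat.
have e1 : q n ^+ 2 / M n / (1 - q n / M n) = q n ^+ 2 / (M n - q n).
  by field; rewrite !gt_eqF ?subr_gt0.
have e2 : q n ^+ 2 / M n / (1 + q n / M n) = q n ^+ 2 / (M n + q n).
  by field; rewrite !gt_eqF// ltr_pwDl.
by rewrite e1 e2 binr_ge ?binr_le//= ltnW.
Unshelve. all: by end_near. Qed.

Let kap : R := cos 1 ^+ 4.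

(** The [l] consecutive frequencies are centred at 0, so that half the angle stays close to
    [[- pi / 2, pi / 2]], where [cos2_gauss] applies. *)
Let A_term (th c : R) n (nu : int) : R :=
  if (- n.+1%:Z <= nu < n.+1%:Z)%R then
    (cos ((th + 2 * pi * nu%:~R) / lR n / 2) ^+ 2) ^+ N n *
    cos (c - (r n)%:~R * ((th + 2 * pi * nu%:~R) / lR n)) else 0.

Let B_term (th c : R) n (j : int) : R := binr (N n) `|p n j|%N * cos (j%:~R * th + c).

Let A_lim th c (nu : int) : R :=
  expR (- ((th + 2 * pi * nu%:~R) ^+ 2 / (4 * a))) * cos (c - x * (th + 2 * pi * nu%:~R)).

Let B_lim th c (j : int) : R := expR (- (a * (j%:~R + x) ^+ 2)) * cos (j%:~R * th + c).

Let gauss2pi (k th : R) : 0 < k ->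
  absum (fun nu : int => expR (- (k * (th + 2 * pi * nu%:~R) ^+ 2))).
Proof.
move=> k0; have k' : 0 < k * (2 * pi) ^+ 2.
  by rewrite mulr_gt0// exprn_gt0// mulr_gt0// pi_gt0.
apply: eq_absum (absum_gauss (th / (2 * pi)) k') => nu; congr expR.
by move: (@pi_neq0 R); move: (@pi R) => P P0; field.
Qed.

Let A_cvg th c : rsum (A_term th c n) @[n --> \oo] --> rsum (A_lim th c).
Proof.
have gap : 0 < 4 - pi :> R.
  by have := pihalf_lt2 R; rewrite subr_gt0 ltr_pdivrMr// => /lt_le_trans; apply; lra.
(* Half the angle is at most [pi / 2 + |th| / (2 * l)] in absolute value, hence at most 2 once
   [|th| / l <= 4 - pi]; shifting the sequence by [K] ensures this for every index. *)
pose K := Num.truncn (`|th| / (4 - pi)).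
have HK n : `|th| / lR (n + K) <= 4 - pi.
  rewrite ler_pdivrMr// mulrC -ler_pdivrMr//.
  have /ltW/le_trans := truncnS_gt (`|th| / (4 - pi)); apply.
  by rewrite ler_nat -/K /l -addnn; lia.
rewrite -(@cvg_shiftn K _ (fun n => rsum (A_term th c n))).
apply: (@rsum_cvg _ _ (fun nu : int => expR (- (kap / (4 * a) * (th + 2 * pi * nu%:~R) ^+ 2)))).
- by apply: gauss2pi; rewrite divr_gt0 ?mulr_gt0 ?exprn_gt0 ?cos1_gt0.
- move=> n nu; rewrite /A_term; case: ifPn => [/andP[n1 n2]|_]; last by rewrite normr0 expR_ge0.
  set s := th + _; set m := (n + K)%N in n1 n2 *.
  rewrite normrM; apply: le_trans (ler_piMr (normr_ge0 _) (cos_max _)) _.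
  rewrite ger0_norm; last exact/exprn_ge0/sqr_ge0.
  have snu : `|s / lR m / 2| <= 2.
    have L2 : 0 < lR m * 2 by rewrite mulr_gt0.
    rewrite -mulrA -invfM normrM [X in _ * X]ger0_norm ?invr_ge0 ?(ltW L2)//.
    rewrite ler_pdivrMr//; apply: le_trans (ler_normD _ _) _.
    have := HK n; rewrite -/m ler_pdivrMr// => h.
    have nuL : 2 * pi * `|nu%:~R| <= pi * lR m.
      rewrite mulrAC mulrC ler_pM2l ?pi_gt0// -intr_norm -natr_absz -natrM ler_nat /l; lia.
    have p2 : `|2 * pi : R| = 2 * pi by rewrite ger0_norm// mulr_ge0 ?pi_ge0.
    rewrite normrM p2; move: (@pi R) nuL h => P; lra.
  have h2 : (cos (s / lR m / 2) ^+ 2) ^+ N m <= expR (- (kap * (s / lR m / 2) ^+ 2)) ^+ N m.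
    by apply: lerXn2r; rewrite ?nnegrE ?sqr_ge0 ?expR_ge0//; exact: cos2_gauss.
  apply: (le_trans h2).
  rewrite -expRM_natl ler_expR mulrN lerN2.
  have /andP[h _] := N_bounds m.
  have := ler_wpM2r (_ : 0 <= kap * (s / lR m / 2) ^+ 2) h.
  rewrite mulr_ge0 ?sqr_ge0 ?exprn_ge0 ?(ltW (@cos1_gt0 R))// => /(_ isT); apply: le_trans.
  by rewrite le_eqVlt; apply/orP; left; apply/eqP; field; rewrite !gt_eqF.
- move=> nu; rewrite (@cvg_shiftn K _ (fun n => A_term th c n nu)).
  set s := th + 2 * pi * nu%:~R.
  have phase : cos (c - (r n)%:~R * (s / lR n)) @[n --> \oo] --> cos (c - x * s).
    apply: continuous_cvg; first exact: continuous_cos.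
    apply: cvgB; first exact: cvg_cst.
    rewrite (_ : (fun n => _) = (fun n => (r n)%:~R / lR n * s)).
      by apply: cvgM => //; exact: cvg_cst.
    by apply/funext => n; rewrite mulrCA mulrA mulrC -mulrA mulrC -mulrA; ring.
  rewrite /A_lim -/s; have cc := cvgM (@cos_cvg s) phase; apply: cvg_trans; last exact: cc.
  apply: near_eq_cvg.
  exists `|nu|%N => // n /= nun; rewrite /A_term ifT//; apply/andP; split; lia.
Qed.

Let B_cvg th c : rsum (B_term th c n) @[n --> \oo] --> rsum (B_lim th c).
Proof.
(* [N <= K0 * l ^ 2] because [l >= 1], and [|rho| <= X] because rounding moves [x] by at most
   [1 / l <= 1]. The dominating Gaussian keeps half of the exponent; the constant factor pays for
   replacing [rho] by 0. *)
pose K0 := a^-1 + 1.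
have K00 : 0 < K0 by rewrite ltr_wpDl// invr_ge0 ltW.
pose k := (4 * K0)^-1; have k0 : 0 < k by rewrite invr_gt0 mulr_gt0.
pose X := `|x| + 1.
apply: (@rsum_cvg _ _ (fun j : int => expR (X ^+ 2 / (2 * K0)) * expR (- (k * (j%:~R + 0) ^+ 2)))).
- by apply: absumZ; apply: absum_gauss.
- move=> n j; rewrite /B_term normrM.
  apply: (@le_trans _ _ (binr (N n) `|p n j|%N)).
    by rewrite ger0_norm ?binr_ge0// ler_piMr ?cos_max// binr_ge0.
  apply: le_trans (binr_gauss _ (ltn0Sn _)) _; rewrite -expRD ler_expR.
  have NK : (N n)%:R <= K0 * lR n ^+ 2.
    have /andP[_ h] := N_bounds n; apply: le_trans h _; rewrite /K0 mulrDl mul1r (mulrC a^-1) lerD2l.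
    by rewrite -[leLHS]/(1 : R) -(expr1n R 2) lerXn2r ?nnegrE ?l_ge1 ?ltW.
  pose rho := (r n)%:~R / lR n.
  have pE : (`|p n j|%N%:R : R) ^+ 2 = lR n ^+ 2 * (j%:~R + rho) ^+ 2.
    rewrite natr_absz intr_norm real_normK ?num_real// /p rmorphD rmorphM /= -/(lR n) /rho.
    by field; rewrite gt_eqF.
  have rhoX : rho ^+ 2 <= X ^+ 2.
    rewrite -(real_normK (num_real rho)) lerXn2r ?nnegrE ?addr_ge0//.
    have /andP[r1 r2] := r_bounds n; rewrite -/rho in r1 r2.
    have li : (lR n)^-1 <= 1 by rewrite invf_le1.
    rewrite ler_norml /X; have := ler_norm x; have := ler_norm (- x); rewrite normrN; lra.
  have step : (j%:~R + rho) ^+ 2 / (2 * K0) <= `|p n j|%N%:R ^+ 2 / (2 * (N n)%:R).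
    rewrite pE ler_pdivrMr ?mulr_gt0// mulrAC ler_pdivlMr ?mulr_gt0 ?ltr0n//.
    by have := ler_wpM2l (sqr_ge0 (j%:~R + rho)) NK; lra.
  rewrite addr0 lerNl; apply: le_trans step; rewrite opprD opprK /k.
  rewrite -subr_ge0 (_ : _ - _ = ((j%:~R + 2 * rho) ^+ 2 + 2 * (X ^+ 2 - rho ^+ 2)) / (4 * K0)).
    apply: divr_ge0; last by rewrite mulr_ge0// ltW.
    by apply: addr_ge0; [exact: sqr_ge0|rewrite mulr_ge0// subr_ge0].
  by field; rewrite gt_eqF.
- move=> j; rewrite /B_term /B_lim; apply: cvgM; first exact: binr_cvg.
  exact: cvg_cst.
Qed.

Let G n : R := polya_const a n.

Let A_GB th c n : rsum (A_term th c n) = G n * rsum (B_term th c n).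
Proof.
have ln : (0 < l n)%N by rewrite /l -addnn.
have := @polya_identity R (l n) (N n) (r n) (- n.+1%:Z) th c ln; rewrite /= -/(lR n) => E.
pose g (s : 'I_(l n)) : R := let u := (th + 2 * pi * (s%:Z + - n.+1%:Z)%:~R) / lR n in
  (cos (u / 2) ^+ 2) ^+ N n * cos (c - (r n)%:~R * u).
have [_ e1] := @rsum_deltas R int _ (index_enum 'I_(l n)) (fun s => s%:Z + - n.+1%:Z) g.
transitivity (\sum_(s < l n) g s).
  rewrite -e1; apply: eq_rsum => nu; rewrite /A_term; case: ifPn => [/andP[n1 n2]|nn].
    have sP : (absz (nu + n.+1%:Z)%R < l n)%N by rewrite /l -addnn; lia.
    rewrite (bigD1 (Ordinal sP)) //= ifT; last by apply/eqP; lia.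
    rewrite big1 ?addr0.
      by rewrite /g /=; congr ((cos ((_ + _ * _%:~R) / _ / _) ^+ 2) ^+ _ * cos (_ - _ * ((_ + _ * _%:~R) / _))); lia.
    move=> s /negP ss; rewrite ifF//; apply/negP => /eqP sE; apply: ss.
    by apply/eqP/val_inj => /=; lia.
  rewrite big1// => s _; rewrite ifF//; apply/negP => /eqP sE; move: nn; rewrite sE.
  have sl : (s < n.+1 + n.+1)%N by rewrite addnn.
  by move/negP; apply; apply/andP; split; lia.
have N4 : 4 ^+ N n != 0 :> R by rewrite expf_neq0.
have Eg : 4 ^+ N n * \sum_(s < l n) g s = lR n * 'C((N n).*2, N n)%:R * rsum (B_term th c n).
  rewrite -E mulr_sumr; apply: eq_bigr => s _.
  by rewrite /g /= [in RHS]exprMn [in LHS](mulrA (4 ^+ N n)).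
apply: (mulfI N4); rewrite Eg /G /polya_const -/(N n) -/(lR n).
by move: N4 (rsum _); move: (4 ^+ N n) => Q Q0 Z; field.
Qed.

Lemma polya_limit th c : exists A B : nat -> R, [/\ A n @[n --> \oo] -->
    rsum (fun k : int => expR (- ((th + 2 * pi * k%:~R) ^+ 2 / (4 * a))) * cos (c - x * (th + 2 * pi * k%:~R))),
  B n @[n --> \oo] --> rsum (fun m : int => expR (- (a * (m%:~R + x) ^+ 2)) * cos (m%:~R * th + c)) &
  forall n, A n = polya_const a n * B n].
Proof.
exists (fun n => rsum (A_term th c n)), (fun n => rsum (B_term th c n)).
by split; [exact: A_cvg|exact: B_cvg|exact: A_GB].
Qed.

End Theta.

Section Theta1.
Context {R : realType}.

Lemma absum_gauss2pi (k th : R) : 0 < k ->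
  absum (fun nu : int => expR (- ((th + 2 * pi * nu%:~R) ^+ 2 * k))).
Proof.
move=> k0; have k' : 0 < k * (2 * pi) ^+ 2.
  by rewrite mulr_gt0// exprn_gt0// mulr_gt0// pi_gt0.
apply: eq_absum (absum_gauss (th / (2 * pi)) k') => nu; congr expR.
by move: (@pi_neq0 R); move: (@pi R) => P P0; field.
Qed.

Lemma rsum_gt0 (T : choiceType) (f : T -> R) (t : T) :
  absum f -> (forall z, 0 <= f z) -> 0 < f t -> 0 < rsum f.
Proof.
move=> sf f0 ft; apply: (lt_le_trans ft).
have [|s1 e1] := @rsum_finite R T [fset t]%fset (fun z => if z == t then f z else 0).
  by move=> z; rewrite inE => /negPf ->.
rewrite big_seq_fset1 eqxx in e1; rewrite -e1; apply: ler_rsum => // z.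
by case: ifP.
Qed.

Theorem theta_poisson (a : R) : 0 < a -> exists2 C : R, 0 < C & forall x th c : R,
  rsum (fun m : int => expR (- (a * (m%:~R + x) ^+ 2)) * cos (m%:~R * th + c)) =
  C * rsum (fun k : int => expR (- ((th + 2 * pi * k%:~R) ^+ 2 / (4 * a))) *
                           cos (c - x * (th + 2 * pi * k%:~R))).
Proof.
(* At [x = th = c = 0] both limits are sums of positive terms, so their quotient is the limit of
   [polya_const] and gives [C] for all parameters. *)
move=> a0; have [A [B [cA cB AB]]] := polya_limit 0 a0 0 0.
set rA := rsum _ in cA; set rB := rsum _ in cB.
have rA0 : 0 < rA.
  have E : (fun k : int => expR (- ((0 + 2 * pi * k%:~R) ^+ 2 / (4 * a))) * cos (0 - 0 * (0 + 2 * pi * k%:~R))) =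
    fun k : int => expR (- ((0 + 2 * pi * k%:~R) ^+ 2 * (4 * a)^-1)).
    by apply/funext => k; rewrite [X in cos X](_ : _ = 0) ?cos0 ?mulr1 ?mul0r ?subrr.
  rewrite /rA E; apply: (@rsum_gt0 _ _ 0); [|by move=> ?; exact: expR_ge0|exact: expR_gt0].
  by apply: absum_gauss2pi; rewrite invr_gt0 mulr_gt0.
have rB0 : 0 < rB.
  have E : (fun m : int => expR (- (a * (m%:~R + 0) ^+ 2)) * cos (m%:~R * 0 + 0)) =
    fun m : int => expR (- (a * (m%:~R + 0) ^+ 2)).
    by apply/funext => k; rewrite [X in cos X](_ : _ = 0) ?cos0 ?mulr1 ?mulr0 ?addr0.
  rewrite /rB E; apply: (@rsum_gt0 _ _ 0); [exact: absum_gauss|by move=> ?; exact: expR_ge0|exact: expR_gt0].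
have cG : polya_const a n @[n --> \oo] --> rA / rB.
  have c1 : A n / B n @[n --> \oo] --> rA / rB.
    by apply: cvgM => //; apply: cvg_inv => //; rewrite gt_eqF.
  apply: cvg_trans; last exact: c1.
  apply: near_eq_cvg.
  near=> n; have Bn : 0 < B n by near: n; exact: (cvgr_gt _ cB _ rB0).
  by rewrite AB mulfK// gt_eqF.
exists (rB / rA); first by rewrite divr_gt0.
move=> x th c; have [A' [B' [cA' cB' AB']]] := polya_limit x a0 th c.
set rA' := rsum _ in cA' *; set rB' := rsum _ in cB' *.
have : A' n @[n --> \oo] --> rA / rB * rB'.
  by under eq_cvg do rewrite AB'; exact: cvgM.
move/(cvg_unique (@Rhausdorff R) cA') => ->.
by field; rewrite !gt_eqF.
Unshelve. all: by end_near. Qed.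

End Theta1.

(** * Poisson summation for positive definite forms *)

Section QuadraticForms.
Context {R : realType}.

Definition dotv n (u v : 'rV[R]_n) : R := (u *m v^T) 0 0.
Definition qform n (A : 'M[R]_n) (u : 'rV[R]_n) : R := (u *m A *m u^T) 0 0.
Definition posdef n (A : 'M[R]_n) : Prop :=
  A^T = A /\ forall u : 'rV[R]_n, u != 0 -> 0 < qform A u.

Lemma dotvC n (u v : 'rV[R]_n) : dotv u v = dotv v u.
Proof. by rewrite /dotv -[u *m v^T]trmxK trmx_mul trmxK mxE. Qed.

Lemma dotvE n (u v : 'rV[R]_n) : dotv u v = \sum_i u 0 i * v 0 i.
Proof. by rewrite /dotv mxE; apply: eq_bigr => i _; rewrite mxE. Qed.

Lemma dotvDr n (u v w : 'rV[R]_n) : dotv u (v + w) = dotv u v + dotv u w.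
Proof. by rewrite /dotv linearD /= mulmxDr mxE. Qed.

Lemma dotvZr n (c : R) (u v : 'rV[R]_n) : dotv u (c *: v) = c * dotv u v.
Proof. by rewrite /dotv linearZ /= -scalemxAr mxE. Qed.

Lemma dotvNr n (u v : 'rV[R]_n) : dotv u (- v) = - dotv u v.
Proof. by rewrite /dotv linearN /= mulmxN mxE. Qed.

Lemma dotv_row n (s t : R) (u v : 'rV[R]_n) :
  dotv (row_mx s%:M u) (row_mx t%:M v) = s * t + dotv u v.
Proof.
by rewrite /dotv tr_row_mx mul_row_col mxE tr_scalar_mx -scalar_mxM mxE eqxx mulr1n.
Qed.

Lemma posdef_unit n (A : 'M[R]_n) : posdef A -> A \in unitmx.
Proof.
move=> [_ Ap]; rewrite -row_free_unit -kermx_eq0; apply/rowV0P => u /sub_kermxP uA.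
apply/eqP; apply: contraT => /Ap; rewrite /qform uA mul0mx mxE ltxx //.
Qed.

Lemma qform_inv n (A : 'M[R]_n) (u v : 'rV[R]_n) : A \in unitmx ->
  v *m A = u -> qform (invmx A) u = dotv v u.
Proof. by move=> Au <-; rewrite /qform mulmxK. Qed.

Section Schur.
Variables (n : nat) (A : 'M[R]_(1 + n)).
Hypothesis Apos : posdef A.

Definition piv : R := ulsubmx A 0 0.
Definition off : 'rV[R]_n := ursubmx A.
Definition schur : 'M[R]_n := drsubmx A - piv^-1 *: (off^T *m off).

Lemma block_schur : A = block_mx piv%:M off off^T (drsubmx A).
Proof.
have [At _] := Apos; rewrite -[LHS]submxK /piv -mx11_scalar; congr block_mx.
by rewrite /off trmx_ursub At.
Qed.

Lemma piv_gt0 : 0 < piv.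
Proof.
have [At Ap] := Apos; have nz : row_mx (1%:M : 'M[R]_1) (0 : 'rV[R]_n) != 0.
  apply/eqP => /(congr1 (fun M : 'rV_(1 + n) => lsubmx M 0 0)).
  by rewrite row_mxKl !mxE eqxx => /eqP; rewrite oner_eq0.
have := Ap _ nz; rewrite /qform block_schur mul_row_block tr_row_mx mul_row_col.
by rewrite !mul0mx !addr0 !mul1mx trmx0 mulmx0 addr0 trmx1 mulmx1 mxE eqxx mulr1n.
Qed.

Let piv_neq0 : piv != 0. Proof. by rewrite gt_eqF// piv_gt0. Qed.

(** Completing the square in the first coordinate, whose sum becomes a one-dimensional Gaussian sum
    with a centre depending on [v]. *)
Lemma qform_schur (s : R) (v : 'rV[R]_n) :
  qform A (row_mx s%:M v) = piv * (s + dotv v off / piv) ^+ 2 + qform schur v.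
Proof.
have p0 := piv_neq0.
have e1 : v *m off^T = (dotv v off)%:M by rewrite /dotv -mx11_scalar.
have e2 : off *m v^T = (dotv v off)%:M by rewrite dotvC /dotv -mx11_scalar.
rewrite /qform {1}block_schur mul_row_block tr_row_mx mul_row_col.
rewrite mulmxDl mulmxDl tr_scalar_mx !mul_mx_scalar !mul_scalar_mx -scalemxAl e1 e2.
rewrite /schur mulmxBr mulmxBl -!scalemxAr -!scalemxAl mulmxA e1 mul_scalar_mx -scalemxAl e2.
move: (v *m drsubmx A *m v^T) (dotv v off) => Q d.
by rewrite !mxE eqxx !mulr1n; field.
Qed.

Lemma posdef_schur : posdef schur.
Proof.
have [At Ap] := Apos; split.
  rewrite /schur linearB /= linearZ /= trmx_mul trmxK; congr (_ - _).
  by rewrite trmx_drsub At.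
move=> v v0; have := Ap (row_mx (- (dotv v off / piv))%:M v); rewrite qform_schur.
rewrite addNr expr0n mulr0 add0r; apply; apply: contra v0 => /eqP E.
by rewrite -(row_mxKr (- (dotv v off / piv))%:M v) E linear0.
Qed.

(** In the inverse form the shift goes the other way, from the first coordinate to the rest. A
    preimage [v] of the shifted vector under [schur] extends to an explicit preimage under [A]. *)
Lemma qform_schur_inv (t : R) (w : 'rV[R]_n) :
  qform (invmx A) (row_mx t%:M w) =
  t ^+ 2 / piv + qform (invmx schur) (w - (t / piv) *: off).
Proof.
have p0 := piv_neq0; have Su := posdef_unit posdef_schur.
set w' := w - _; pose v := w' *m invmx schur; pose d := dotv v off.
have vS : v *m schur = w' by rewrite /v mulmxKV.
have vD : v *m drsubmx A = w' + (d / piv) *: off.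
  rewrite -vS /schur mulmxBr -scalemxAr mulmxA [v *m off^T]mx11_scalar -/(dotv v off) -/d.
  by rewrite mul_scalar_mx scalerA mulrC subrK.
rewrite (@qform_inv _ _ _ (row_mx ((t - d) / piv)%:M v)) ?posdef_unit//; last first.
  rewrite {1}block_schur mul_row_block -scalar_mxM divfK// vD [v *m off^T]mx11_scalar -/(dotv v off) -/d.
  rewrite -raddfD /= subrK mul_scalar_mx addrCA -scalerDl -mulrDl subrK; congr row_mx.
  by rewrite /w' subrK.
rewrite dotv_row (qform_inv Su vS) /w' dotvDr dotvNr dotvZr -/d.
by field.
Qed.

End Schur.
End QuadraticForms.

Section GaussPoisson.
Context {R : realType}.

Definition intv n (m : 'rV[int]_n) : 'rV[R]_n := map_mx intr m.

Lemma absum_prod (T1 T2 : choiceType) (f : T1 -> R) (g : T2 -> R) :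
  absum f -> absum g -> absum (fun z : T1 * T2 => f z.1 * g z.2).
Proof.
move=> sf sg; apply: absum_pair => [x|] /=; first exact: absumZ.
apply: (@eq_absum _ _ (fun x => rsum (fun y => `|g y|) * `|f x|)).
  move=> x; rewrite mulrC -rsumZ; last exact: absum_abs.
  by apply: eq_rsum => y; rewrite normrM.
by apply/absumZ/absum_abs.
Qed.

Lemma intv_row n (s : int) (v : 'rV[int]_n) :
  intv (row_mx s%:M v : 'rV_(1 + n)) = row_mx (s%:~R)%:M (intv v).
Proof. by rewrite /intv map_row_mx map_scalar_mx. Qed.

Lemma row_bij n : bijective (fun z : int * 'rV[int]_n => row_mx z.1%:M z.2 : 'rV[int]_(1 + n)).
Proof.
exists (fun u : 'rV[int]_(1 + n) => (lsubmx u 0 0, rsubmx u)).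
  by case=> s v /=; rewrite row_mxKl row_mxKr mxE eqxx mulr1n.
by move=> u /=; rewrite -mx11_scalar hsubmxK.
Qed.

Lemma row_bij' n : bijective (fun z : 'rV[int]_n * int => row_mx z.2%:M z.1 : 'rV[int]_(1 + n)).
Proof.
exists (fun u : 'rV[int]_(1 + n) => (rsubmx u, lsubmx u 0 0)).
  by case=> s v /=; rewrite row_mxKl row_mxKr mxE eqxx mulr1n.
by move=> u /=; rewrite -mx11_scalar hsubmxK.
Qed.

Definition dual_weight n (A : 'M[R]_n) (th : 'rV[R]_n) (k : 'rV[int]_n) : R :=
  expR (- (qform (invmx A) (th + (2 * pi) *: intv k) / 4)).

(* Induction on the dimension: the one-variable formula for the first coordinate leaves the Gaussian
   weight of the Schur complement in the remaining ones. *)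
Theorem gauss_poisson n (A : 'M[R]_n) : posdef A ->
  exists C K : R, [/\ 0 < C, absum (fun m => expR (- qform A (intv m))) &
  forall th : 'rV[R]_n,
    [/\ absum (dual_weight A th), rsum (dual_weight A th) <= K &
    rsum (fun m => expR (- qform A (intv m)) * cos (dotv (intv m) th)) =
    C * rsum (dual_weight A th)]].
Proof.
elim: n A => [|n IH]; last rewrite -[n.+1]/(1 + n)%N; move=> A Apos.
  have one (f : 'rV[int]_0 -> R) : absum f /\ rsum f = f 0.
    have [|s1 ->] := @rsum_finite R _ [fset (0 : 'rV[int]_0)]%fset f.
      by move=> u; rewrite inE [u]thinmx0 eqxx.
    by rewrite big_seq_fset1.
  exists 1, 1; split=> //; first by have [] := one (fun m => expR (- qform A (intv m))).
  move=> th; have dw : dual_weight A th 0 = 1.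
    by rewrite /dual_weight /qform [invmx A]thinmx0 mulmx0 mul0mx mxE mul0r oppr0 expR0.
  split; [by have [] := one (dual_weight A th)|by rewrite (one _).2 dw|].
  rewrite !(one _).2 dw /qform /dotv [A]thinmx0 mulmx0 mul0mx [th]thinmx0 trmx0 mulmx0 mxE.
  by rewrite oppr0 expR0 cos0.
pose a := piv A; pose b := off A; pose S := schur A.
have a0 : 0 < a by exact: piv_gt0.
have Spos : posdef S by exact: posdef_schur.
have [C [K [C0 sS HS]]] := IH S Spos.
have [C1 C10 theta] := theta_poisson a0.
have [K1 K10 HK1] := gauss_bound a0.
pose x (v : 'rV[int]_n) := dotv (intv v) b / a.
have wE (s : int) (v : 'rV[int]_n) :
    expR (- qform A (intv (row_mx s%:M v : 'rV_(1 + n)))) =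
    expR (- qform S (intv v)) * expR (- (a * (s%:~R + x v) ^+ 2)).
  by rewrite intv_row (qform_schur Apos) -expRD opprD addrC.
have sw : absum (fun m : 'rV[int]_(1 + n) => expR (- qform A (intv m))).
  apply/(absum_reindex _ (row_bij' n)); apply: absum_pair => /= [v|].
    by apply: eq_absum (absumZ _ (absum_gauss (x v) a0)) => s; rewrite wE.
  apply: absum_le (absumZ K1 sS) => v.
  rewrite !ger0_norm ?mulr_ge0 ?expR_ge0 ?rsum_ge0//.
  rewrite (@eq_rsum _ _ _ (fun s : int => expR (- qform S (intv v)) * expR (- (a * (s%:~R + x v) ^+ 2)))).
    by rewrite rsumZ; [rewrite mulrC ler_wpM2r ?expR_ge0|exact: absum_gauss].
  by move=> s; rewrite ger0_norm ?expR_ge0// wE.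
have k0 : 0 < (4 * a)^-1 by rewrite invr_gt0 mulr_gt0.
pose G (t : R) (k : int) := expR (- ((t + 2 * pi * k%:~R) ^+ 2 / (4 * a))).
have sG t : absum (G t) by exact: absum_gauss2pi.
have [K2 K20 HK2] : exists2 K2, 0 <= K2 & forall t, rsum (G t) <= K2.
  have c0 : 0 < (4 * a)^-1 * (2 * pi) ^+ 2 by rewrite mulr_gt0// exprn_gt0// mulr_gt0// pi_gt0.
  have [K2 K20 HK2] := gauss_bound c0; exists K2 => // t.
  rewrite (@eq_rsum _ _ _ (fun k : int => expR (- ((4 * a)^-1 * (2 * pi) ^+ 2 * (k%:~R + t / (2 * pi)) ^+ 2)))) ?HK2//.
  move=> k; rewrite /G; congr expR; move: (@pi_neq0 R); move: (@pi R) => P P0.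
  by field; rewrite P0 gt_eqF.
(* The bound on the dual sums has to be uniform in [th]: the induction hypothesis is applied at the
   points [w' k], which vary with the summation index. *)
exists (C1 * C), (K * K2); split=> // [|th]; first exact: mulr_gt0.
pose t := lsubmx (th : 'rV_(1 + n)) 0 0; pose w := rsubmx (th : 'rV_(1 + n)).
have thE : th = row_mx t%:M w by rewrite -mx11_scalar hsubmxK.
pose w' (k : int) := w - ((t + 2 * pi * k%:~R) / a) *: b.
have dE (k : int) (v : 'rV[int]_n) :
    dual_weight A th (row_mx k%:M v : 'rV_(1 + n)) = G t k * dual_weight S (w' k) v.
  rewrite /dual_weight intv_row scale_row_mx thE add_row_mx scale_scalar_mx -raddfD /=.
  rewrite (qform_schur_inv Apos) -expRD; congr expR.
  rewrite (_ : _ - _ = w' k + (2 * pi) *: intv v); last by rewrite /w' addrAC.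
  by rewrite -/a; field; rewrite gt_eqF.
have K0 : 0 <= K.
  by have [_ + _] := HS 0; apply: le_trans; apply: rsum_ge0 => k; exact: expR_ge0.
have rS k : 0 <= rsum (dual_weight S (w' k)) by apply: rsum_ge0 => v; exact: expR_ge0.
have sGS : absum (fun k => G t k * rsum (dual_weight S (w' k))).
  apply: absum_le (absumZ K (sG t)) => k.
  rewrite !ger0_norm ?mulr_ge0 ?expR_ge0// mulrC ler_wpM2r ?expR_ge0//.
  by have [] := HS (w' k).
have sD : absum (dual_weight A th).
  apply/(absum_reindex _ (row_bij n)); apply: absum_pair => /= [k|].
    have [s1 _ _] := HS (w' k).
    by apply: eq_absum (absumZ _ s1) => v; rewrite dE.
  apply: eq_absum sGS => k; have [s1 _ _] := HS (w' k).
  rewrite -rsumZ//; apply: eq_rsum => v.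
  by rewrite ger0_norm ?expR_ge0// dE.
have rD : rsum (dual_weight A th) = rsum (fun k => G t k * rsum (dual_weight S (w' k))).
  rewrite (rsum_reindex _ (row_bij n)) rsum_pair; last by apply/(absum_reindex _ (row_bij n)).
  apply: eq_rsum => k; have [s1 _ _] := HS (w' k); rewrite -rsumZ//.
  by apply: eq_rsum => v; exact: dE.
split=> //.
  rewrite rD; apply: (@le_trans _ _ (rsum (fun k => K * G t k))).
    apply: ler_rsum => // [|k]; first exact: absumZ.
    by rewrite mulrC ler_wpM2r ?expR_ge0//; have [] := HS (w' k).
  by rewrite rsumZ// ler_wpM2l.
have sF : absum (fun m : 'rV[int]_(1 + n) => expR (- qform A (intv m)) * cos (dotv (intv m) th)).
  apply: absum_le sw => m; rewrite normrM ler_piMr ?cos_max//.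
rewrite (rsum_reindex _ (row_bij' n)) rsum_pair; last exact: ((absum_reindex _ (row_bij' n)).1 sF).
pose g (v : 'rV[int]_n) (k : int) := expR (- qform S (intv v)) * (C1 * (G t k * cos (dotv (intv v) (w' k)))).
transitivity (rsum (fun v => rsum (fun k => g v k))).
  apply: eq_rsum => v /=.
  transitivity (rsum (fun s : int => expR (- qform S (intv v)) *
      (expR (- (a * (s%:~R + x v) ^+ 2)) * cos (s%:~R * t + dotv (intv v) w)))).
    by apply: eq_rsum => s; rewrite wE intv_row thE dotv_row mulrA.
  rewrite rsumZ; last first.
    by apply: absum_le (absum_gauss (x v) a0) => s; rewrite normrM ler_piMr ?cos_max.
  rewrite theta /g rsumZ; last first.
    apply: absumZ; apply: absum_le (sG t) => k; by rewrite normrM ler_piMr ?cos_max.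
  congr (_ * _); rewrite -rsumZ; last first.
    by apply: absum_le (sG t) => k; rewrite normrM ler_piMr ?cos_max.
  apply: eq_rsum => k; congr (_ * (_ * cos _)).
  by rewrite /w' dotvDr dotvNr dotvZr /x; field; rewrite gt_eqF.
(* The phase of the one-variable formula has turned the coupling into the shift [w' k]; for fixed
   [k] the sum over [v] is now the left-hand side of the induction hypothesis at [w' k]. *)
rewrite rsum_exchange; last first.
  apply: absum_le (absum_prod sS (absumZ C1 (sG t))) => -[v k] /=.
  rewrite /g !normrM ler_wpM2l// ler_wpM2l// ler_piMr ?cos_max//.
rewrite rD -rsumZ//; apply: eq_rsum => k; rewrite /g.
have [_ _ E] := HS (w' k).
rewrite -mulrA (mulrCA C) -E -rsumZ; last first.
  by apply: absum_le sS => v; rewrite normrM ler_piMr ?cos_max.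
rewrite -rsumZ; last first.
  by apply: absumZ; apply: absum_le sS => v; rewrite normrM ler_piMr ?cos_max.
by apply: eq_rsum => v; ring.
Qed.

End GaussPoisson.

(** * Dual walks and flows on the torus *)

(* [lia] treats convertible but syntactically different terms as distinct atoms; generalizing them first merges them. *)
Ltac gen2 f := repeat match goal with |- context [f ?a ?b] =>
  let z := fresh "z" in move: (f a b) => z end.

Ltac gen f := repeat match goal with |- context [f ?a] =>
  let z := fresh "z" in move: (f a) => z end.

Section TorusWalks.
Variable N : nat.
Local Notation V := ('Z_N * 'Z_N)%type.
Local Notation dir := (bool * bool)%type.

Definition e1 : V := (1, 0).
Definition e2 : V := (0, 1).
Definition dE : dir := (false, false).
Definition dW : dir := (false, true).
Definition dN : dir := (true, false).
Definition dS : dir := (true, true).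

Definition step (d : dir) : V :=
  match d with (false, false) => e1 | (false, true) => - e1
             | (true, false) => e2 | (true, true) => - e2 end.

(* The dual vertex p is the plaquette with corners p, p+e1, p+e2, p+e1+e2.
   The dual edge leaving p that crosses a primal edge in the direction d crosses it
   from p + off d to p + off d + step d and ends in p + rot d. *)
Definition off_ (d : dir) : V :=
  match d with (false, false) => e2 | (false, true) => e1
             | (true, false) => 0 | (true, true) => e1 + e2 end.
Definition rot (d : dir) : V :=
  match d with (false, false) => e2 | (false, true) => - e2
             | (true, false) => - e1 | (true, true) => e1 end.

Definition flow := V * dir -> nat.
Implicit Types (F G : flow) (f : V -> int) (p : V) (w : seq dir).

Lemma sum_dir (T : nmodType) (g : dir -> T) :
  \sum_d g d = g dE + g dW + g dN + g dS.
Proof.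
rewrite (eq_bigr (fun d => g (d.1, d.2))); last by case.
rewrite -(pair_bigA _ (fun a b => g (a, b))) /= !big_bool /=.
by rewrite addrC [g (false, true) + _]addrC [g (true, true) + _]addrC !addrA.
Qed.

Fixpoint wcnt p w : flow := fun z =>
  if w is d :: w' then (((p, d) == z) + wcnt (p + rot d)%R w' z)%N else 0%N.
Fixpoint wend p w : V := if w is d :: w' then wend (p + rot d) w' else p.

Definition outflow F (x : V) : nat := (\sum_d F (x, d))%N.
Definition inflow F (x : V) : nat := (\sum_d F (x - rot d, d)%R)%N.
Definition mass F : nat := (\sum_z F z)%N.

(** Conservation with one unit entering at [b] and leaving at [a], written without subtraction of
    natural numbers. For [a = b] it is plain balance. *)
Definition flow_from_to F b a :=
  forall x : V, (outflow F x + (x == a) = inflow F x + (x == b))%N.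

Lemma outflow_edge c d (x : V) : outflow (fun z => ((c, d) == z) : nat) x = (x == c).
Proof.
rewrite /outflow (bigD1 d) //= big1 ?addn0; last first.
  by move=> d' /negPf dd; rewrite xpair_eqE eq_sym (eq_sym d) dd andbF.
by rewrite xpair_eqE eqxx andbT eq_sym.
Qed.

Lemma inflow_edge c d (x : V) : inflow (fun z => ((c, d) == z) : nat) x = (x == c + rot d).
Proof.
rewrite /inflow (bigD1 d) //= big1 ?addn0; last first.
  by move=> d' /negPf dd; rewrite xpair_eqE eq_sym (eq_sym d) dd andbF.
by rewrite xpair_eqE eqxx andbT eq_sym subr_eq.
Qed.

(** Induction on the mass, removing one edge at a time: an edge out of [b] extends the open walk,
    and in the balanced case any edge of the flow starts a closed walk. *)
Lemma flow_decomposition F b a : flow_from_to F b a ->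
  exists (w0 : seq dir) (L : seq (V * seq dir)),
  [/\ wend b w0 = a,
      all (fun q => (wend q.1 q.2 == q.1) && (q.2 != [::])) L &
      forall z, F z = (wcnt b w0 z + \sum_(q <- L) wcnt q.1 q.2 z)%N].
Proof.
move En : (mass F) => n; elim: n F b a En => [|n IH] F b a En Fba.
  have F0 z : F z = 0%N by move/eqP: En; rewrite /mass sum_nat_eq0 => /forallP/(_ z)/eqP.
  exists [::], [::]; split => //=; last by move=> z; rewrite big_nil F0.
  have := Fba b; rewrite eqxx /outflow /inflow !big1 //; first by case: eqP.
have step_ok (c : V) (d : dir) : (0 < F (c, d))%N ->
    exists2 F', mass F' = n & (forall z, F z = ((c, d) == z) + F' z)%N /\
      (forall x : V, outflow F x = outflow F' x + (x == c))%N /\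
      (forall x : V, inflow F x = inflow F' x + (x == (c + rot d)%R))%N.
  move=> Fpos; pose F' z := (F z - ((c, d) == z))%N.
  have FE z : F z = (((c, d) == z) + F' z)%N.
    by rewrite /F'; case: eqP => [<-|_]; lia.
  exists F'.
    move: En; rewrite /mass (eq_bigr _ (fun z _ => FE z)) big_split /=.
    rewrite (bigD1 (c, d)) //= eqxx big1 ?addn0; last by move=> z /negPf; rewrite eq_sym => ->.
    by rewrite add1n => -[].
  split=> //; split=> x.
    by rewrite addnC -(outflow_edge c d x) -big_split; apply: eq_bigr => d' _; exact: FE.
  by rewrite addnC -(inflow_edge c d x) -big_split; apply: eq_bigr => d' _; exact: FE.
have [Eba|Nba] := eqVneq b a.
  have [[c d] Fcd] : exists z, (0 < F z)%N.
    apply/existsP; apply: contraTT isT => /existsPn H.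
    by move: En; rewrite /mass big1// => z _; apply/eqP; rewrite -leqn0 leqNgt; exact: H.
  have [F' mF' [FE [oF iF]]] := step_ok c d Fcd.
  (* What remains runs from the end of the removed edge back to [c]; with this edge in front, the
     open walk closes up. *)
  have [|w0 [L [w0e aL FL]]] := IH F' (c + rot d) c mF'.
    by move=> x; have := Fba x; rewrite oF iF Eba; lia.
  exists [::], ((c, d :: w0) :: L); split => //=; first by rewrite w0e eqxx aL.
  by move=> z; rewrite FE FL big_cons /=; lia.
have [d Fbd] : exists d, (0 < F (b, d))%N.
  apply/existsP; apply: contraTT isT => /existsPn H.
  have := Fba b; rewrite eqxx (negPf Nba) /outflow big1; first by lia.
  by move=> d _; apply/eqP; rewrite -leqn0 leqNgt; exact: H.
have [F' mF' [FE [oF iF]]] := step_ok b d Fbd.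
have [|w0 [L [w0e aL FL]]] := IH F' (b + rot d) a mF'.
  by move=> x; have := Fba x; rewrite oF iF; lia.
by exists (d :: w0), L; split => //= z; rewrite FE FL /= addnA.
Qed.

Lemma wcnt_flow p w : flow_from_to (wcnt p w) p (wend p w).
Proof.
elim: w p => [|d w IH] p x /=; first by rewrite /outflow /inflow !big1.
have o : outflow (wcnt p (d :: w)) x = ((x == p) + outflow (wcnt (p + rot d)%R w) x)%N.
  by rewrite -(outflow_edge p d x) -big_split.
have i : inflow (wcnt p (d :: w)) x = ((x == (p + rot d)%R) + inflow (wcnt (p + rot d)%R w) x)%N.
  by rewrite -(inflow_edge p d x) -big_split.
by rewrite /= in o i; rewrite o i; have := IH (p + rot d) x; lia.
Qed.

Lemma mass_wcnt p w : mass (wcnt p w) = size w.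
Proof.
elim: w p => [|d w IH] p; first by rewrite /mass big1.
rewrite /mass /= big_split /= -/(mass (wcnt (p + rot d) w)) IH (bigD1 (p, d)) //= eqxx.
by rewrite big1 ?addn0// => z /negPf; rewrite eq_sym => ->.
Qed.

(** One edge and its position in the walk determine the starting point, which saves the choice of a
    starting point when short contours are counted. *)
Lemma wcnt_pos p w z : (0 < wcnt p w z)%N ->
  exists r, [/\ (r < size w)%N, nth dE w r = z.2 & p = z.1 - \sum_(d <- take r w) rot d].
Proof.
elim: w p => [//|d w IH] p /=; case: eqP => [<- _|_].
  by exists 0%N; split => //=; rewrite big_nil subr0.
rewrite add0n => /IH[r [rw rd pE]]; exists r.+1; split => //=.
by rewrite big_cons opprD addrCA -pE; rewrite addrC addrK.
Qed.

Definition pos_part (z : int) : nat := if z is Posz n then n else 0%N.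

(** The level lines of [f]: the dual edge crossing a primal edge in the direction of descent has the
    size of the drop as multiplicity. *)
Definition flow_of f : flow := fun z =>
  pos_part (f (z.1 + off_ z.2) - f (z.1 + off_ z.2 + step z.2)).

(** Only the net flow across a primal edge is prescribed, so [F] may contain opposite dual edges
    that cancel; [flow_of f] has the least mass among these flows. *)
Definition potential F f := forall x : V,
  f x - f (x + e1) = (F (x - e2, dE))%:Z - (F (x, dW))%:Z /\
  f x - f (x + e2) = (F (x, dN))%:Z - (F (x - e1, dS))%:Z.

Definition variation f : nat :=
  (\sum_x (absz (f x - f (x + e1))%R + absz (f x - f (x + e2))%R))%N.

Lemma pos_partB (a b : int) : a - b = (pos_part (a - b))%:Z - (pos_part (b - a))%:Z.
Proof. by rewrite -(opprB a b); case: (a - b) => -[|n] //=; lia. Qed.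

Lemma pos_part_abs (a b : int) : absz (a - b) = (pos_part (a - b) + pos_part (b - a))%N.
Proof. by rewrite -(opprB a b); case: (a - b) => -[|n] //=; lia. Qed.

Lemma corner (x : V) : x - e1 + (e1 + e2) = x + e2.
Proof. by rewrite addrA subrK. Qed.

Lemma flow_of_potential f : potential (flow_of f) f.
Proof.
move=> x; rewrite /flow_of /= corner subrK addrK addr0.
by split; [exact: pos_partB|rewrite addrK; exact: pos_partB].
Qed.

Lemma mass_dirs F : mass F =
  (\sum_(x : V) (F (x - e2, dE)%R + F (x, dW) + F (x, dN) + F (x - e1, dS)%R))%N.
Proof.
rewrite /mass (eq_bigr (fun z => F (z.1, z.2))); last by case.
rewrite -(pair_bigA _ (fun p d => F (p, d))) /=.
rewrite (eq_bigr _ (fun p _ => @sum_dir nat (fun d => F (p, d)))) !big_split /=.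
congr (_ + _ + _ + _)%N; first by rewrite (reindex_inj (addIr (- e2))).
by rewrite (reindex_inj (addIr (- e1))).
Qed.

Lemma mass_flow_of f : mass (flow_of f) = variation f.
Proof.
rewrite mass_dirs; apply: eq_bigr => x _.
rewrite /flow_of /= corner subrK addrK addr0 addrK !pos_part_abs; gen pos_part; lia.
Qed.

Lemma variation_le_mass F f : potential F f -> (variation f <= mass F)%N.
Proof. by move=> P; rewrite mass_dirs; apply: leq_sum => x _; have [] := P x; gen f; gen F; lia. Qed.

Lemma potential_pos F f p d : potential F f ->
  f (p + off_ d + step d) < f (p + off_ d) -> (0 < F (p, d))%N.
Proof.
move=> P; case: d => -[] [] /=.
- by have [_] := P (p + e1); rewrite addrA !addrK /dS; gen f; gen F; lia.
- by have [_] := P p; rewrite addr0 /dN; gen f; gen F; lia.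
- by have [+ _] := P p; rewrite addrK /dW; gen f; gen F; lia.
- by have [+ _] := P (p + e2); rewrite addrK /dE; gen f; gen F; lia.
Qed.

(** Balance at a dual vertex says that the drops of [f] around its plaquette add up to zero. *)
Lemma potential_balanced F f : potential F f -> flow_from_to F 0 0.
Proof.
move=> P x; rewrite /outflow /inflow !sum_dir /= !opprK.
have [h1 v1] := P x; have [h2 _] := P (x + e2); have [_ v2] := P (x + e1).
move: h2 v2; rewrite !addrK -!addrA [e2 + e1]addrC.
by move: h1 v1; rewrite /dE /dW /dN /dS; gen f; gen F; lia.
Qed.

Definition closed_flow F := flow_from_to F 0 0.

Lemma closed_walk_flow p w : wend p w = p -> closed_flow (wcnt p w).
Proof. by move=> wp x; have := wcnt_flow p w x; rewrite wp; lia. Qed.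

Hypothesis N1 : (1 < N)%N.

Lemma ltZN (x : 'Z_N) : (x < N)%N.
Proof. by rewrite -[X in (_ < X)%N](Zp_cast N1). Qed.

Lemma val_ZpS (x : 'Z_N) : (x.+1 < N)%N -> nat_of_ord (x + 1) = x.+1.
Proof.
move=> xN; have xM : (x.+1 < (Zp_trunc N).+2)%N by rewrite [X in (_ < X)%N](Zp_cast N1).
by rewrite /= (@modn_small 1)// addn1 modn_small.
Qed.

Lemma val_ZpS_last (x : 'Z_N) : (N <= x.+1)%N -> x + 1 = 0.
Proof.
move=> Nx; have xE : x.+1 = N by apply/eqP; rewrite eqn_leq Nx ltZN.
have xM : x.+1 = (Zp_trunc N).+2 by rewrite [RHS](Zp_cast N1).
by apply: val_inj; rewrite /= (@modn_small 1)// addn1 xM modnn.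
Qed.

Lemma Zp_induction (Q : 'Z_N -> Prop) : Q 0 ->
  (forall x : 'Z_N, (x.+1 < N)%N -> Q x -> Q (x + 1)) -> forall x : 'Z_N, Q x.
Proof.
move=> Q0 QS x; move En : (val x) => n; elim: n x En => [|n IH] x xn.
  by rewrite (_ : x = 0)//; apply: val_inj.
have nN : (n.+1 < N)%N by rewrite -xn ltZN.
have nlt : (n < (Zp_trunc N).+2)%N by rewrite Zp_cast// ltnW.
have xE : x = Ordinal nlt + 1 by apply: val_inj; rewrite xn -[RHS]/(nat_of_ord (Ordinal nlt + 1)) val_ZpS.
by rewrite xE; apply: QS => //; exact: IH.
Qed.

Lemma Zp_constant (T : Type) (g : 'Z_N -> T) : (forall a, g (a + 1) = g a) -> forall a b, g a = g b.
Proof.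
move=> gS; suff H (a : 'Z_N) : g a = g 0 by move=> a b; rewrite !H.
by elim/Zp_induction: a => // a _ <-; rewrite gS.
Qed.

Lemma sum_shift (g : 'Z_N -> int) : \sum_s g (s + 1) = \sum_s g s.
Proof. by rewrite [RHS](reindex_inj (addIr 1)). Qed.

Definition prefix (g : 'Z_N -> int) (x : 'Z_N) : int := \sum_(s : 'Z_N | (s < x)%N) g s.

(** The vanishing total makes the discrete integral fit together where the cycle closes, at
    [x + 1 = 0]. *)
Lemma prefixS (g : 'Z_N -> int) (x : 'Z_N) : \sum_s g s = 0 -> prefix g (x + 1) - prefix g x = g x.
Proof.
move=> g0; have [xN|xN] := ltnP x.+1 N; rewrite /prefix.
  rewrite (eq_bigl (fun s : 'Z_N => (s < x.+1)%N)); last by move=> s; rewrite val_ZpS.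
  rewrite (bigD1 x) /=; last exact: ltnSn.
  rewrite (eq_bigl (fun s : 'Z_N => (s < x)%N)) ?addrK// => s.
  by rewrite ltnS -val_eqE /= andbC -ltn_neqAle.
rewrite val_ZpS_last// big_pred0 //.
move: g0; rewrite (bigD1 x) //= (eq_bigl (fun s : 'Z_N => (s < x)%N)).
  by move=> /eqP; rewrite addr_eq0 => /eqP ->; rewrite sub0r.
move=> s; rewrite -val_eqE /= ltn_neqAle; have := ltZN s; case: eqP => //= _; lia.
Qed.

Lemma prefix_telescope (g : 'Z_N -> int) (x : 'Z_N) : prefix (fun s => g (s + 1) - g s) x = g x - g 0.
Proof.
elim/Zp_induction: x => [|x xN IH].
  by rewrite subrr /prefix big_pred0.
have := @prefixS (fun s => g (s + 1) - g s) x.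
rewrite IH => E; suff : prefix (fun s => g (s + 1) - g s) (x + 1) - (g x - g 0) = g (x + 1) - g x by lia.
by apply: E; rewrite sumrB sum_shift subrr.
Qed.

Lemma exists_small (h : 'Z_N -> nat) : (\sum_y h y < N)%N -> exists y, h y = 0%N.
Proof.
move=> hN; suff /existsP[y /eqP hy] : [exists y, h y == 0%N] by exists y.
apply: contraTT isT => /existsPn H; move: hN; rewrite ltnNge => /negP; case.
rewrite -[X in (X <= _)%N](Zp_cast N1) -[X in (X <= _)%N]card_ord -sum1_card.
by apply: leq_sum => y _; rewrite lt0n; exact: H.
Qed.

(** The net flows [h] and [v] form a closed one-form ([hv]), so the sum of [h] over a row is the
    same for all rows, and likewise for [v] and columns. Fewer than [N] edges leave a row with
    [h = 0] and a column with [v = 0]; hence the periods vanish and the form can be integrated. *)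
Lemma short_exact F : closed_flow F -> (mass F < N)%N -> exists f, potential F f.
Proof.
move=> cF mF.
pose h (x : V) : int := (F (x - e2, dE))%:Z - (F (x, dW))%:Z.
pose v (x : V) : int := (F (x, dN))%:Z - (F (x - e1, dS))%:Z.
have hv (x : V) : h x + v (x + e1) = v x + h (x + e2).
  by have := cF x; rewrite /outflow /inflow !sum_dir /= !opprK /h /v !addrK; gen F; lia.
have hvm : (\sum_x (absz (h x) + absz (v x)) <= mass F)%N.
  by rewrite mass_dirs; apply: leq_sum => x _; rewrite /h /v; lia.
have V1 (x1 x2 : 'Z_N) : (x1, x2) + e1 = (x1 + 1, x2) by rewrite /e1 [LHS]/GRing.add /= /add_pair /= addr0.
have V2 (x1 x2 : 'Z_N) : (x1, x2) + e2 = (x1, x2 + 1) by rewrite /e2 [LHS]/GRing.add /= /add_pair /= addr0.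
have hrow (x2 : 'Z_N) : \sum_x1 h (x1, x2) = 0.
  have [y hy] : exists y, (\sum_x1 absz (h (x1, y)))%N = 0%N.
    apply: exists_small; apply: leq_ltn_trans mF; apply: leq_trans hvm.
    rewrite exchange_big (pair_bigA _ (fun i j => absz (h (i, j)))) /=.
    by apply: leq_sum => -[i j] _ /=; exact: leq_addr.
  rewrite (@Zp_constant _ (fun x2 => \sum_x1 h (x1, x2)) _ x2 y).
    apply: big1 => x1 _; move/eqP: hy; rewrite sum_nat_eq0 => /forallP/(_ x1).
    by rewrite /= absz_eq0 => /eqP.
  move=> z; apply/eqP; rewrite -subr_eq0 -sumrB.
  rewrite (eq_bigr (fun x1 => v (x1 + 1, z) - v (x1, z))).
    by rewrite sumrB (sum_shift (fun x1 => v (x1, z))) subrr.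
  by move=> x1 _; have := hv (x1, z); rewrite V1 V2; gen v; gen h; lia.
have vcol (x1 : 'Z_N) : \sum_x2 v (x1, x2) = 0.
  have [y hy] : exists y, (\sum_x2 absz (v (y, x2)))%N = 0%N.
    apply: exists_small; apply: leq_ltn_trans mF; apply: leq_trans hvm.
    rewrite (pair_bigA _ (fun i j => absz (v (i, j)))) /=.
    by apply: leq_sum => -[i j] _ /=; exact: leq_addl.
  rewrite (@Zp_constant _ (fun x1 => \sum_x2 v (x1, x2)) _ x1 y).
    apply: big1 => x2 _; move/eqP: hy; rewrite sum_nat_eq0 => /forallP/(_ x2).
    by rewrite /= absz_eq0 => /eqP.
  move=> z; apply/eqP; rewrite -subr_eq0 -sumrB.
  rewrite (eq_bigr (fun x2 => h (z, x2 + 1) - h (z, x2))).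
    by rewrite sumrB (sum_shift (fun x2 => h (z, x2))) subrr.
  by move=> x2 _; have := hv (z, x2); rewrite V1 V2; gen v; gen h; lia.
(* Integration along column 0 and then along the row of [x], with a minus sign because [h] and [v]
   are drops. *)
pose f (x : V) : int := - (prefix (fun s => v (0, s)) x.2 + prefix (fun s => h (s, x.2)) x.1).
exists f; case=> x1 x2; rewrite V1 V2.
suff [E1 E2] : f (x1, x2) - f (x1 + 1, x2) = h (x1, x2) /\ f (x1, x2) - f (x1, x2 + 1) = v (x1, x2) by [].
rewrite /f /=; split.
  by have := prefixS x1 (hrow x2); gen2 prefix; gen h; lia.
have := prefixS x2 (vcol 0); have := prefix_telescope (fun s => v (s, x2)) x1.
have -> : prefix (fun s => v (s + 1, x2) - v (s, x2)) x1 =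
  prefix (fun s => h (s, x2 + 1)) x1 - prefix (fun s => h (s, x2)) x1.
  rewrite /prefix -sumrB; apply: eq_bigr => s _.
  by have := hv (s, x2); rewrite V1 V2; gen v; gen h; lia.
by gen2 prefix; gen v; lia.
Qed.

End TorusWalks.

(** * Contours separating two vertices, and their number *)

Section Cuts.
Local Open Scope set_scope.
Local Open Scope ring_scope.
Variable N : nat.
Hypothesis N4 : (3 < N)%N.
Local Notation V := ('Z_N * 'Z_N)%type.
Local Notation dir := (bool * bool)%type.
Local Notation flow := (flow N).
Local Notation e1 := (@e1 N).
Local Notation e2 := (@e2 N).
Local Notation step := (@step N).
Local Notation off_ := (@off_ N).
Local Notation rot := (@rot N).

Let N1 : (1 < N)%N. Proof. by rewrite (leq_trans _ N4). Qed.

Definition ind (B : {set V}) : V -> int := fun x => Posz (x \in B).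
Definition bdry (B : {set V}) : nat := variation (ind B).

Definition cut (i j : V) (m : V -> int) (B : {set V}) : Prop :=
  [/\ i \in B, j \notin B & forall x d, x \in B -> x + step d \notin B -> m (x + step d) < m x].

Definition walks_flow (L : seq (V * seq dir)) : flow := fun z => (\sum_(q <- L) wcnt q.1 q.2 z)%N.

Definition short_contour (F : flow) := exists p w,
  [/\ wend p w = p, (size w < N)%N & F =1 wcnt p w].
Definition long_contour (F : flow) := exists L,
  all (fun q : V * seq dir => (N <= size q.2)%N) L /\ F =1 walks_flow L.

Lemma torus_constant (T : Type) (g : V -> T) :
  (forall x, g (x + e1) = g x) -> (forall x, g (x + e2) = g x) -> forall x y, g x = g y.
Proof.
move=> g1 g2 [x1 x2] [y1 y2].
rewrite (@Zp_constant N N1 _ (fun a => g (a, x2)) _ x1 y1); last first.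
  by move=> a; rewrite -(g1 (a, x2)); congr g; rewrite /e1 [RHS]/GRing.add /= /add_pair /= addr0.
rewrite (@Zp_constant N N1 _ (fun a => g (y1, a)) _ x2 y2)//.
by move=> a; rewrite -(g2 (y1, a)); congr g; rewrite /e2 [RHS]/GRing.add /= /add_pair /= addr0.
Qed.

Lemma mass_le (F G : flow) : (forall z, (G z <= F z)%N) -> (mass G <= mass F)%N.
Proof. by move=> GF; apply: leq_sum => z _. Qed.

Lemma mass_eq (F G : flow) : (forall z, (G z <= F z)%N) -> mass F = mass G -> F =1 G.
Proof.
move=> GF mE z.
have : (\sum_z (F z - G z) = 0)%N.
  have : (\sum_z (F z - G z) + \sum_z G z = \sum_z F z)%N.
    by rewrite -big_split /=; apply: eq_bigr => y _; rewrite subnK.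
  by rewrite -/(mass F) -/(mass G) mE; lia.
move/eqP; rewrite sum_nat_eq0 => /forallP/(_ z) /=; have := GF z; rewrite subn_eq0; gen F; gen G; lia.
Qed.

(** The superlevel set [B'] is again a cut: each of its boundary edges carries flow of [G], hence of
    [B], and is thus a descent of [m]. Then [bdry B <= bdry B' <= variation f <= mass G <= bdry B],
    and equal masses force equal flows. *)
Lemma minimal_subflow i j m B (G : flow) f : cut i j m B ->
  (forall B', cut i j m B' -> (bdry B <= bdry B')%N) ->
  (forall z, (G z <= flow_of (ind B) z)%N) -> potential G f -> f j < f i ->
  flow_of (ind B) =1 G.
Proof.
move=> [iB jB cB] Bmin GF Gf fij; pose B' := [set x | f j < f x].
have cB' : cut i j m B'.
  split; rewrite ?inE ?ltxx// => x d; rewrite !inE -leNgt => xB' yB'.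
  have : (0 < G ((x - off_ d)%R, d))%N.
    by apply: potential_pos Gf _; rewrite subrK; apply: le_lt_trans xB'.
  move=> /leq_trans/(_ (GF _)); rewrite /flow_of /= subrK /ind => bb.
  by apply: cB; move: bb; case: (x \in B); case: (x + step d \in B).
apply: mass_eq => //; apply/anti_leq/andP; split; last exact: mass_le.
rewrite mass_flow_of; apply: leq_trans (Bmin _ cB') _.
apply: leq_trans (variation_le_mass Gf); apply: leq_sum => x _.
by apply: leq_add; rewrite /ind !inE; gen f => *; do 2! case: ltP; lia.
Qed.

Lemma potentialB (F G H : flow) f h : (forall z, F z = G z + H z)%N ->
  potential F f -> potential H h -> potential G (fun x => f x - h x).
Proof.
move=> FGH Ff Hh x; have [a1 a2] := Ff x; have [b1 b2] := Hh x.
by move: a1 a2 b1 b2; rewrite !FGH; gen f; gen h; gen G; gen H => *; split; lia.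
Qed.

Lemma potential_sum (L : seq (V * seq dir)) (g : V * seq dir -> V -> int) :
  (forall q, q \in L -> potential (wcnt q.1 q.2) (g q)) ->
  potential (walks_flow L) (fun x => \sum_(q <- L) g q x).
Proof.
rewrite /walks_flow; elim: L => [_ x|q L IH H x]; first by rewrite !big_nil.
rewrite !big_cons; have [|a1 a2] := IH _ x.
  by move=> q' q'L; apply: H; rewrite inE q'L orbT.
have [b1 b2] := H q (mem_head _ _) x.
rewrite !PoszD !opprD; split.
  by rewrite addrACA [RHS]addrACA a1 b1.
by rewrite addrACA [RHS]addrACA a2 b2.
Qed.

(* Take a cut of minimal boundary and decompose its contour into closed walks. A closed walk shorter than
   [N] is contractible, so its flow has a potential. Either the potential of one short walk separates [i]
   from [j], or that of the long walks together does; a level set of it is again a cut, so by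
   minimality this part is the whole contour. *)
Lemma exists_contour_cut i j m : m j < m i -> exists B,
  cut i j m B /\ (short_contour (flow_of (ind B)) \/ long_contour (flow_of (ind B))).
Proof.
move=> mij; pose B0 := [set x | m i <= m x].
have c0 : `[< cut i j m B0 >].
  apply/asboolP; split; rewrite ?inE ?lexx -?ltNge// => x d; rewrite !inE -ltNge => h1 h2.
  exact: lt_le_trans h2 h1.
pose B := [arg min_(B < B0 | `[< cut i j m B >]) bdry B].
have [cB Bmin] : cut i j m B /\ forall B', cut i j m B' -> (bdry B <= bdry B')%N.
  rewrite /B; case: arg_minnP => // B1 /asboolP c1 min1; split => // B' c'.
  by apply: min1; apply/asboolP.
exists B; split => //; have [iB jB _] := cB.
have Fpot := flow_of_potential (ind B).
have [w0 [L [w0e aL FL]]] := flow_decomposition (potential_balanced Fpot).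
pose L' := (0 : V, w0) :: L.
have closedL q : q \in L' -> wend q.1 q.2 = q.1.
  by rewrite inE => /predU1P[->//|/(allP aL)/andP[/eqP]].
have FL' z : flow_of (ind B) z = walks_flow L' z by rewrite FL /walks_flow big_cons.
pose S := [seq q <- L' | (size q.2 < N)%N]; pose Lg := [seq q <- L' | (N <= size q.2)%N].
have FSL z : flow_of (ind B) z = (walks_flow Lg z + walks_flow S z)%N.
  rewrite FL' /walks_flow !big_filter addnC (bigID (fun q => (size q.2 < N)%N)) /=.
  by congr (_ + _)%N; apply: eq_bigl => q; rewrite -leqNgt.
have exg (q : V * seq dir) : exists f : V -> int, q \in S -> potential (wcnt q.1 q.2) f.
  have [qS|qS] := boolP (q \in S); last by exists (fun=> 0).
  move: qS; rewrite mem_filter => /andP[sq qL].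
  have [||f fP] := @short_exact N N1 (wcnt q.1 q.2); last by exists f.
    by apply: closed_walk_flow; exact: closedL.
  by rewrite mass_wcnt.
have [g gP] := boolp.choice exg.
have gS := potential_sum gP.
have fL := potentialB FSL Fpot gS.
have [/hasP[q qS gq]|/hasPn nS] := boolP (has (fun q => g q j < g q i) S).
  left; exists q.1, q.2; have := qS; rewrite mem_filter => /andP[sq qL]; split=> //.
    exact: closedL.
  apply: (minimal_subflow cB Bmin _ (gP _ qS) gq) => z.
  by rewrite FL' /walks_flow (big_rem q qL) /= leq_addr.
right; exists Lg; split; first exact: filter_all.
apply: (minimal_subflow cB Bmin _ fL) => [z|]; first by rewrite FSL leq_addr.
have : \sum_(q <- S) g q i <= \sum_(q <- S) g q j.
  by rewrite big_seq [leRHS]big_seq; apply: ler_sum => q /nS; rewrite -leNgt.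
rewrite /ind iB (negPf jB).
by do 2! move: (\sum_(_ <- S) _) => ?; lia.
Qed.

Lemma absz_sum (I : finType) (P : pred I) (g : I -> int) :
  (absz (\sum_(i | P i) g i)%R <= \sum_(i | P i) absz (g i))%N.
Proof. by elim/big_ind2 : _ => // a b c d; lia. Qed.

Lemma cyclic_variation (g : 'Z_N -> int) a b : g a != g b ->
  (2 <= \sum_s absz (g s - g (s + 1))%R)%N.
Proof.
move=> gab; have [s gs] : exists s, g s - g (s + 1) != 0.
  apply/existsP; apply: contraTT gab => /existsPn H; rewrite negbK.
  apply/eqP/(Zp_constant N1) => s; have := H s; rewrite negbK subr_eq0 => /eqP ->//.
have tot : \sum_s (g s - g (s + 1)) = 0 by rewrite sumrB sum_shift subrr.
move: tot; rewrite (bigD1 s) //= => tot; rewrite (bigD1 s) //=.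
have := absz_sum (fun i => i != s) (fun i => g i - g (i + 1)).
move: tot gs; move: (g s - g (s + 1)) (\sum_(_ | _) _) (\sum_(_ | _) _)%N => x y z; lia.
Qed.

Lemma nat_crossing (T : eqType) (g : nat -> T) t : g 0%N != g t ->
  exists2 s, (s < t)%N & g s != g s.+1.
Proof.
elim: t => [|t IH]; first by rewrite eqxx.
have [<-|h _] := eqVneq (g t) (g t.+1); last by exists t.
by move=> /IH[s st gs]; exists s => //; exact: ltnW.
Qed.

(** There are a column and a row along which [ind B] does not vary; it is constant on the cross they
    form, and [i] or [j] has the other value. The row and the column of that vertex vary at least
    twice each. At most [bdry B] columns vary, so among the first [bdry B + 1] points of its row one
    lies in a column with the value of the cross. *)
Lemma short_cut_crossing (B : {set V}) i j : i \in B -> j \notin B -> (bdry B < N)%N ->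
  (4 <= bdry B)%N /\ exists (a : bool) (t : nat), (t < bdry B)%N /\
  let x := (if a then i else j) + e1 *+ t in ind B x != ind B (x + e1).
Proof.
move=> iB jB lN; set b := ind B.
pose h (x : V) : nat := absz (b x - b (x + e1))%R; pose v (x : V) : nat := absz (b x - b (x + e2))%R.
have bE : bdry B = (\sum_x1 \sum_x2 h (x1, x2) + \sum_x1 \sum_x2 v (x1, x2))%N.
  by rewrite !pair_bigA -big_split; apply: eq_bigr => -[].
have V1 (x1 x2 : 'Z_N) : (x1, x2) + e1 = (x1 + 1, x2) by rewrite /e1 [LHS]/GRing.add /= /add_pair /= addr0.
have V2 (x1 x2 : 'Z_N) : (x1, x2) + e2 = (x1, x2 + 1) by rewrite /e2 [LHS]/GRing.add /= /add_pair /= addr0.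
have colc x1 : (\sum_x2 v (x1, x2) = 0)%N -> forall y y', b (x1, y) = b (x1, y').
  move=> /eqP; rewrite sum_nat_eq0 => /forallP H; apply: (Zp_constant N1 (g := fun y => b (x1, y))) => y.
  by have := H y; rewrite /v V2 /= absz_eq0 subr_eq0 => /eqP.
have rowc x2 : (\sum_x1 h (x1, x2) = 0)%N -> forall y y', b (y, x2) = b (y', x2).
  move=> /eqP; rewrite sum_nat_eq0 => /forallP H; apply: (Zp_constant N1 (g := fun y => b (y, x2))) => y.
  by have := H y; rewrite /h V1 /= absz_eq0 subr_eq0 => /eqP.
have [x0 x0c] : exists x0, (\sum_x2 v (x0, x2))%N = 0%N.
  by apply: (exists_small N1); apply: leq_ltn_trans lN; rewrite bE leq_addl.
have [y0 y0c] : exists y0, (\sum_x1 h (x1, y0))%N = 0%N.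
  apply: (exists_small N1); apply: leq_ltn_trans lN; rewrite bE exchange_big; exact: leq_addr.
have [a aP] : exists a : bool, b (if a then i else j) != b (x0, y0).
  have : b i != b j by rewrite /b /ind iB (negPf jB).
  have [e ne|ne _] := eqVneq (b i) (b (x0, y0)); last by exists true.
  by exists false; rewrite -e eq_sym.
case Ea : (if a then i else j) aP => [A1 A2] aP.
split.
  have r2 : (2 <= \sum_x1 h (x1, A2))%N.
    have := @cyclic_variation (fun x1 => b (x1, A2)) A1 x0.
    rewrite (colc x0 x0c A2 y0) => /(_ aP); congr (_ <= _)%N.
    by apply: eq_bigr => x1 _; rewrite /h V1.
  have c2 : (2 <= \sum_x2 v (A1, x2))%N.
    have := @cyclic_variation (fun x2 => b (A1, x2)) A2 y0.
    rewrite (rowc y0 y0c A1 x0) => /(_ aP); congr (_ <= _)%N.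
    by apply: eq_bigr => x1 _; rewrite /v V2.
  rewrite bE exchange_big /= (bigD1 A2) //= [X in (_ <= _ + X)%N](bigD1 A1) //=.
  exact: (leq_add (leq_trans r2 (leq_addr _ _)) (leq_trans c2 (leq_addr _ _))).
pose S := [set x1 | (0 < \sum_x2 v (x1, x2))%N].
have cS : (#|S| <= bdry B)%N.
  rewrite bE; apply: leq_trans (leq_addl _ _).
  rewrite -sum1_card [X in (_ <= X)%N](bigID (mem S)) /=; apply: leq_trans (leq_addr _ _).
  by apply: leq_sum => x1; rewrite inE.
have [t tl tS] : exists2 t, (t <= bdry B)%N & A1 + 1 *+ t \notin S.
  pose k (t : 'I_(bdry B).+1) : 'Z_N := A1 + 1 *+ t.
  have kinj : injective k.
    move=> s t /addrI; rewrite !Zp_nat => /(congr1 val) /=.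
    have bN (u : 'I_(bdry B).+1) : (u < (Zp_trunc N).+2)%N.
      by rewrite [X in (_ < X)%N](Zp_cast N1); apply: leq_trans (ltn_ord u) _.
    by rewrite !modn_small// => /val_inj.
  have [t tS] : exists t, k t \notin S.
    apply/existsP; apply: contraTT cS => /existsPn H; rewrite -ltnNge.
    have : (#|[set k t | t in 'I_(bdry B).+1]| <= #|S|)%N.
      apply/subset_leq_card/fintype.subsetP => x /imsetP[t _ ->].
      by have := H t; rewrite negbK.
    by rewrite card_imset// card_ord.
  by exists t => //; rewrite -ltnS.
have E1 (s : nat) : (A1, A2) + e1 *+ s = (A1 + 1 *+ s, A2).
  elim: s => [|s IH]; first by rewrite !mulr0n !addr0.
  by rewrite !mulrSr !addrA IH V1.
have [|s st gs] := @nat_crossing _ (fun s => b ((A1, A2) + e1 *+ s)) t.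
  rewrite mulr0n addr0 E1; move: tS; rewrite inE -eqn0Ngt => /eqP /colc tS.
  by rewrite (tS A2 y0) (rowc y0 y0c _ x0).
exists a, s; split; first exact: leq_trans st tl.
by rewrite /= Ea -addrA -mulrSr.
Qed.

Lemma flow_of_ind_inj i (B B' : {set V}) : i \in B -> i \in B' ->
  flow_of (ind B) =1 flow_of (ind B') -> B = B'.
Proof.
move=> iB iB' FF; apply/setP => x.
have P := flow_of_potential (ind B); have P' := flow_of_potential (ind B').
have : ind B x - ind B' x = ind B i - ind B' i.
  apply: (@torus_constant _ (fun x => ind B x - ind B' x)) => y; have [a1 a2] := P y;
    have [b1 b2] := P' y; move: a1 a2 b1 b2; rewrite !FF.
    by move=> + _ + _; gen (ind B); gen (ind B') => *; lia.
  by move=> _ + _; gen (ind B); gen (ind B') => *; lia.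
by rewrite /ind iB iB'; case: (x \in B); case: (x \in B').
Qed.

Definition short_cuts i j l := [set B : {set V} | (bdry B == l) && `[< [/\ i \in B, j \notin B &
  short_contour (flow_of (ind B))] >]].
Definition long_cuts i j l := [set B : {set V} | (bdry B == l) && `[< [/\ i \in B, j \notin B &
  long_contour (flow_of (ind B))] >]].

Lemma pos_part_gt0 (a b : int) : b < a -> (0 < pos_part (a - b))%N.
Proof. by rewrite -subr_gt0; case: (a - b) => [[|n]|n]. Qed.

(* A short contour separating [i] from [j] crosses the horizontal line through [i] or the one through [j]
   within [l] steps; this crossing and its position in the walk determine the starting point, whence [2 * l ^ 2]. *)
Lemma card_short_cuts i j l : (#|short_cuts i j l| <= 2 * l ^ 2 * 4 ^ l)%N.
Proof.
pose code := (bool * 'I_l * 'I_l * l.-tuple dir)%type.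
(* The dual edge of the crossed horizontal edge at [x] leaves [x - e2] if it has direction [dE] and
   [x] if it has direction [dW]; the direction is read off from entry [r] of the walk. *)
pose start (c : code) : V := let: (a, t, r, w) := c in
  (if a then i else j) + e1 *+ t - (if nth dE w r == dE then e2 else 0) - \sum_(d <- take r w) rot d.
pose dec (c : code) : {set V} := odflt finset.set0 [pick B : {set V} | (i \in B) &&
  [forall z, flow_of (ind B) z == wcnt (start c) c.2 z]].
have cc : #|{: code}| = (2 * l ^ 2 * 4 ^ l)%N.
  by rewrite !card_prod card_bool !card_ord card_tuple card_prod card_bool; congr (_ * _)%N; rewrite -mulnA mulnn.
rewrite -cc; apply: leq_trans (leq_imset_card dec _).
apply/subset_leq_card/fintype.subsetP => B; rewrite inE => /andP[/eqP bl /asboolP[iB jB [p [w [pw wN FE]]]]].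
have wl : size w = l.
  by rewrite -bl /bdry -mass_flow_of -(mass_wcnt p w); apply: eq_bigr => z _.
have lN : (bdry B < N)%N by rewrite bl -wl.
have [_ [a [t [tl]]]] := short_cut_crossing iB jB lN.
set x := _ + _ *+ _ => /= xc.
have [d [d2 Fpos]] : exists d, (d = dE \/ d = dW) /\ (0 < flow_of (ind B) ((x - (if d == dE then e2 else 0))%R, d))%N.
  have [xy|yx|/eqP xy] := ltgtP (ind B x) (ind B (x + e1)); last by rewrite xy in xc.
    exists dW; split; first by right.
    by rewrite /= subr0 /flow_of /= addrK; exact: pos_part_gt0.
  exists dE; split; first by left.
  by rewrite /= /flow_of /= subrK; exact: pos_part_gt0.
move: Fpos; rewrite FE => /wcnt_pos[r [rw rd pE]].
rewrite wl in rw; rewrite bl in tl; have wl' : size w == l by rewrite wl.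
pose c : code := (a, Ordinal tl, Ordinal rw, Tuple wl').
apply/imsetP; exists c => //.
have sc : start c = p by rewrite pE /start /c /= rd.
rewrite -sc in FE.
rewrite /dec; case: pickP => [B' /andP[iB' /forallP FB']|/(_ B)].
  apply: (flow_of_ind_inj iB iB') => z; rewrite FE; symmetry; exact: (eqP (FB' z)).
rewrite iB /= => /negP; case; apply/forallP => z; apply/eqP; exact: FE.
Qed.

(** This is the recursion for families of long walks: [N ^ 2 * 4 ^ l] choices of a first walk of
    length [l], and [10 ^ (T - l)] for the others. With ratio [2 / 5] the sum is at most [5 / 3] of
    its first term, and [5 / 3 * N ^ 2 * (2 / 5) ^ N <= 1] for [N >= 4]. *)
Lemma geometric_count T : (N <= T)%N ->
  (\sum_(N <= l < T.+1) N ^ 2 * 4 ^ l * 10 ^ (T - l) <= 10 ^ T)%N.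
Proof.
move=> NT; have E : (6 * \sum_(N <= l < T.+1) 4 ^ l * 10 ^ (T - l) + 4 ^ T.+1 = 10 * (4 ^ N * 10 ^ (T - N)))%N.
  elim: T NT => [|T IH]; first by rewrite leqn0 => /eqP N0; move: N4; rewrite N0.
  rewrite leq_eqVlt => /predU1P[NT|NT].
    by rewrite -NT big_nat1 subnn !expn0 expnS; lia.
  have NT' : (N <= T)%N by [].
  rewrite big_nat_recr /=; last exact: ltnW.
  rewrite subnn expn0 muln1 [(4 ^ T.+2)%N]expnS subSn// [(10 ^ (T - N).+1)%N]expnS.
  rewrite (eq_big_nat _ _ (F2 := fun l => (10 * (4 ^ l * 10 ^ (T - l)))%N)) -?big_distrr /=.
    rewrite [(4 ^ N * (10 * _))%N]mulnCA; have := IH NT'.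
    by move: (\sum_(_ <= _ < _) _)%N (4 ^ T.+1)%N (4 ^ N * 10 ^ (T - N))%N => s u q; lia.
  by move=> l /andP[_ lT]; rewrite subSn// expnS; lia.
under eq_bigr do rewrite -mulnA.
rewrite -big_distrr /=.
have key : (5 * (N ^ 2 * 4 ^ N) <= 3 * 10 ^ N)%N.
  clear E NT; move: N4; rewrite -(subnKC N4); move: (N - 4)%N => n _; elim: n => [//|n IH].
  rewrite addnS !expnS in IH *; nia.
have : (10 ^ T = 10 ^ N * 10 ^ (T - N))%N by rewrite -expnD subnKC.
move: E key; move: (\sum_(_ <= _ < _) _)%N (4 ^ T.+1)%N (10 ^ (T - N))%N (10 ^ N)%N (4 ^ N)%N (N ^ 2)%N => s u q r y z E K ->.
suff : (3 * (z * s) <= 3 * (r * q))%N by lia.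
have : (3 * s <= 5 * (y * q))%N by lia.
move=> /(leq_mul (leqnn z)); have := leq_mul K (leqnn q); nia.
Qed.

(** Strong induction on the total length, splitting off the first walk. A list with repetitions is
    enough for the count. *)
Lemma long_flows_enum T : exists s : seq {ffun V * dir -> nat}, (size s <= 10 ^ T)%N /\
  forall L, all (fun q : V * seq dir => (N <= size q.2)%N) L ->
    (\sum_(q <- L) size q.2 = T)%N -> [ffun z => walks_flow L z] \in s.
Proof.
elim/ltn_ind: T => T IH.
have extb (T' : nat) : exists s : seq {ffun V * dir -> nat}, (T' < T)%N -> (size s <= 10 ^ T')%N /\
    forall L, all (fun q : V * seq dir => (N <= size q.2)%N) L ->
    (\sum_(q <- L) size q.2 = T')%N -> [ffun z => walks_flow L z] \in s.
  have [T'T|T'T] := boolP (T' < T)%N; last by exists [::].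
  by have [s sP] := IH T' T'T; exists s.
have [tb tbP] := boolp.choice extb.
have [T0|T0] := eqVneq T 0%N.
  exists [:: [ffun=> 0%N]]; split; first by rewrite T0.
  case=> [|q L] /=; first by move=> _ _; rewrite inE; apply/eqP/ffunP => z; rewrite !ffunE /walks_flow big_nil.
  by move=> /andP[qN _]; rewrite big_cons T0; lia.
pose add_walk l (c : V * l.-tuple dir) (G : {ffun V * dir -> nat}) : {ffun V * dir -> nat} :=
  [ffun z : V * dir => (wcnt c.1 (tval c.2) z + G z)%N].
pose ext l : seq {ffun V * dir -> nat} :=
  [seq add_walk l c G | c <- enum {: V * l.-tuple dir}, G <- tb (T - l)%N].
exists (flatten [seq ext l | l <- index_iota N T.+1]); split.
  rewrite size_flatten /shape -map_comp sumnE big_map.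
  have [NT|NT] := leqP N T; last by rewrite /index_iota (eqP (_ : T.+1 - N == 0)%N) ?big_nil// subn_eq0.
  apply: leq_trans (geometric_count NT); rewrite big_nat [X in (_ <= X)%N]big_nat.
  apply: leq_sum => l /andP[Nl lT] /=.
  have cZ : #|'Z_N| = N by rewrite card_ord (Zp_cast N1).
  rewrite size_allpairs -cardE card_prod card_tuple !card_prod card_bool !cZ mulnn.
  by rewrite leq_mul2l; apply/orP; right; have [|+ _] := tbP (T - l)%N; [lia|].
case=> [|q L] /=; first by move=> _; rewrite big_nil => /esym/eqP; rewrite (negPf T0).
move=> /andP[qN LN]; rewrite big_cons => sT.
apply/flattenP; exists (ext (size q.2)).
  by apply: map_f; rewrite mem_index_iota; lia.
have [|_ H] := tbP (T - size q.2)%N; first by lia.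
apply/allpairsP; exists ((q.1, in_tuple q.2), [ffun z => walks_flow L z]); split => /=.
- by rewrite mem_enum.
- by apply: H => //; lia.
- by apply/ffunP => z; rewrite !ffunE /walks_flow big_cons.
Qed.

Lemma mass_walks L : mass (walks_flow L) = (\sum_(q <- L) size q.2)%N.
Proof.
by rewrite /mass /walks_flow exchange_big /=; apply: eq_bigr => q _; exact: mass_wcnt.
Qed.

(* The [N ^ 2] starting points of each of the long walks are absorbed by their length, since it is at least [N]. *)
Lemma card_long_cuts i j l : (#|long_cuts i j l| <= 10 ^ l)%N.
Proof.
have [s [sl sP]] := long_flows_enum l; apply: leq_trans sl.
pose fl (B : {set V}) : {ffun V * dir -> nat} := [ffun z => flow_of (ind B) z].
rewrite cardE -(size_map fl); apply: uniq_leq_size.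
  rewrite map_inj_in_uniq ?enum_uniq// => B B'; rewrite !mem_enum !inE.
  move=> /andP[_ /asboolP[iB _ _]] /andP[_ /asboolP[iB' _ _]] /ffunP FF.
  by apply: (flow_of_ind_inj iB iB') => z; have := FF z; rewrite !ffunE.
move=> F /mapP[B]; rewrite mem_enum inE => /andP[/eqP bl /asboolP[iB jB [L [LN FL]]]] ->.
rewrite (_ : fl B = [ffun z => walks_flow L z]); last by apply/ffunP => z; rewrite !ffunE FL.
apply: sP => //; rewrite -mass_walks -bl /bdry -mass_flow_of.
by apply: eq_bigr => z _; rewrite FL.
Qed.

Definition contour_cuts i j := [set B : {set V} | `[< [/\ i \in B, j \notin B &
  short_contour (flow_of (ind B)) \/ long_contour (flow_of (ind B))] >]].

Lemma contour_cuts_ge4 i j B : B \in contour_cuts i j -> (4 <= bdry B)%N.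
Proof.
rewrite inE => /asboolP[iB jB [[p [w [pw wN FE]]]|[L [LN FL]]]].
  have lN : (bdry B < N)%N.
    by rewrite /bdry -mass_flow_of (_ : mass _ = size w)// -(mass_wcnt p w); apply: eq_bigr.
  by have [] := short_cut_crossing iB jB lN.
have bE : bdry B = (\sum_(q <- L) size q.2)%N.
  by rewrite -mass_walks /bdry -mass_flow_of; apply: eq_bigr => z _; rewrite FL.
(* Without any walk the flow vanishes, so [B] would be the whole torus, contrary to [j \notin B]. *)
case: L LN FL bE => [_ FL _|q L /andP[qN _] _ ->].
  have := @flow_of_ind_inj i B [set: V] iB (finset.in_setT _).
  move=> H; move: jB; rewrite H ?inE// => z; rewrite FL /walks_flow big_nil /flow_of /ind !inE.
  by rewrite subrr.
by rewrite big_cons; apply: leq_trans (leq_addr _ _); exact: leq_trans qN.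
Qed.

(** For [l >= 4] the short contours number at most [9 / 10 * 10 ^ l], because
    [20 * l ^ 2 * 4 ^ l <= 9 * 10 ^ l], and the long ones at most [10 ^ l]. The factor 10 keeps the
    bound integral. *)
Lemma card_contour_cuts i j l :
  (10 * #|[set B in contour_cuts i j | bdry B == l]| <= if l < 4 then 0 else 19 * 10 ^ l)%N.
Proof.
case: ltnP => l4.
  rewrite leqn0 muln_eq0 /= cards_eq0; apply/eqP/setP => B; rewrite !inE.
  apply/negP => /andP[Bc /eqP bl].
  by have := @contour_cuts_ge4 i j B; rewrite inE bl leqNgt l4 => /(_ Bc).
have : (#|[set B in contour_cuts i j | bdry B == l]| <= #|short_cuts i j l :|: long_cuts i j l|)%N.
  apply/subset_leq_card/fintype.subsetP => B; rewrite !inE => /andP[/asboolP[iB jB SL] ->] /=.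
  by case: SL => H; apply/orP; [left|right]; apply/asboolP.
move=> /leq_trans/(_ (leq_card_setU _ _)).
have := card_short_cuts i j l; have := card_long_cuts i j l.
suff : (10 * (2 * l ^ 2 * 4 ^ l) <= 9 * 10 ^ l)%N by lia.
rewrite -(subnKC l4); move: (l - 4)%N => n; elim: n => [//|n IH].
rewrite addnS !expnS in IH *; nia.
Qed.

Definition energy (m : V -> int) : int :=
  \sum_(x : V) ((m x - m (x + e1)) ^+ 2 + (m x - m (x + e2)) ^+ 2).

(** Across the boundary a drop [a >= 1] becomes [a - 1], which saves [2 * a - 1 >= 1]; the other
    differences do not change. *)
Lemma energy_cut i j m B : cut i j m B ->
  energy (fun x => m x - ind B x) + (bdry B)%:Z <= energy m.
Proof.
move=> [_ _ cB]; rewrite /energy /bdry /variation (big_morph Posz PoszD erefl) -big_split /=.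
have edge (x y : V) : (x \in B -> y \notin B -> m y < m x) -> (y \in B -> x \notin B -> m x < m y) ->
    (m x - ind B x - (m y - ind B y)) ^+ 2 + Posz (absz (ind B x - ind B y)%R) <= (m x - m y) ^+ 2.
  rewrite /ind; move: (m x) (m y) => a b.
  by case: (x \in B); case: (y \in B) => h1 h2 /=; rewrite ?subrr ?subr0 ?addr0;
    [lia| have := h1 isT isT; nia | have := h2 isT isT; nia | lia].
apply: ler_sum => x _; rewrite PoszD addrACA; apply: lerD; apply: edge.
- exact: (cB x dE).
- by have := cB (x + e1) dW; rewrite /= addrK.
- exact: (cB x dN).
- by have := cB (x + e2) dS; rewrite /= addrK.
Qed.

End Cuts.

(** * The Peierls estimate *)

Section SecondMomentSeries.
Context {R : realType}.

Lemma absum_int_nat (g : nat -> R) (K : R) : (forall n, 0 <= g n) ->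
  (forall k, \sum_(n < k) g n <= K) ->
  absum (fun j : int => g (absz j)) /\ rsum (fun j : int => g (absz j)) <= 2 * K.
Proof.
move=> g0 gK.
have nat_le (h : nat -> R) : (forall n, 0 <= h n) -> (forall k, \sum_(n < k) h n <= K) ->
    (\esum_(i in [set: nat]) (h i)%:E <= K%:E)%E.
  move=> h0 hK; rewrite -nneseries_esumT; last by move=> n; rewrite lee_fin.
  apply: lime_le; first by apply: is_cvg_nneseries => n _ _; rewrite lee_fin.
  by apply: nearW => n; rewrite sumEFin lee_fin big_mkord.
have E : (\esum_(j in [set: int]) (g (absz j))%:E <= (2 * K)%:E)%E.
  rewrite (esumID (range Posz)); last by move=> *; rewrite lee_fin.
  rewrite !setTI (_ : ~` range Posz = range Negz); last first.
    apply/seteqP; split => [[n|n] //= H|_ [n _ <-] [m _]//]; last by exists n.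
    by exfalso; apply: H; exists n.
  rewrite !esum_image; [|by move=> ? ? _ _ []..].
  rewrite mulr_natl mulr2n EFinD; apply: leeD; apply: nat_le => //= k.
  apply: le_trans (gK k.+1); rewrite big_ord_recl /= lerDr//.
have s : absum (fun j : int => g (absz j)).
  rewrite /absum; under eq_esum do rewrite ger0_norm//.
  by apply: le_lt_trans E _; rewrite ltry.
by split=> //; rewrite -lee_fin -absum_rsum.
Qed.

Lemma sum_sqr_geometric (p : R) k : 0 <= p < 1 ->
  \sum_(n < k) n%:R ^+ 2 * p ^+ n <= p * (1 + p) / (1 - p) ^+ 3.
Proof.
move=> /andP[p0 p1]; have p1' : 0 < 1 - p by rewrite subr_gt0.
(* The tail of the series from index [k] on, in closed form. *)
pose h (k : nat) := p ^+ k * (k%:R ^+ 2 * (1 - p) ^+ 2 + 2 * k%:R * p * (1 - p) + p * (1 + p)) / (1 - p) ^+ 3.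
have -> : \sum_(n < k) n%:R ^+ 2 * p ^+ n = p * (1 + p) / (1 - p) ^+ 3 - h k.
  elim: k => [|k IH].
    by rewrite big_ord0 /h expr0n /= mulr0 !mul0r !add0r expr0 mul1r subrr.
  rewrite big_ord_recr /= IH /h -(natr1 k) [p ^+ k.+1]exprS; field.
  by rewrite gt_eqF.
rewrite lerBlDr lerDl /h; apply: divr_ge0; last by rewrite exprn_ge0// ltW.
apply: mulr_ge0; first exact: exprn_ge0.
have := p1'; move: (k%:R : R) (ler0n R k) => x x0 q.
apply: addr_ge0; last by rewrite mulr_ge0// addr_ge0.
by apply: addr_ge0; rewrite ?mulr_ge0 ?sqr_ge0 ?(ltW q).
Qed.

(** The value 20 brings the ratio [10 * exp (- b)] of the contour series down to [1 / 2] for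
    [b >= 3]. Seven terms of the exponential series give [e >= 2.718], whose cube exceeds 20. *)
Lemma expR3_ge20 : 20 <= expR 3 :> R.
Proof.
have -> : expR 3 = expR 1 ^+ 3 :> R by rewrite -expRM_natl mulr1.
have e1 : 2 + 718 / 1000 <= expR 1 :> R.
  apply: (@le_trans _ _ (series (exp_coeff (1 : R)) 7)).
    rewrite /series /= !big_nat_recr //= big_geq// /exp_coeff /= !expr1n.
    have -> : (2`! = 2)%N by [].
    have -> : (3`! = 6)%N by [].
    have -> : (4`! = 24)%N by [].
    have -> : (5`! = 120)%N by [].
    have -> : (6`! = 720)%N by [].
    rewrite fact0 (_ : (1`! = 1)%N) //; lra.
  apply: nondecreasing_cvgn_le; last exact: is_cvg_series_exp_coeff.
  apply/nondecreasing_seqP => n; rewrite /series /= big_nat_recr//= lerDl.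
  by rewrite /exp_coeff /= expr1n divr_ge0.
move: (expR 1) e1 => E e1; have E0 : 0 <= E - (2 + 718 / 1000) by rewrite subr_ge0.
have h1 : 0 <= E * E - 737 / 100 by have := mulr_ge0 E0 E0; lra.
rewrite 2!exprS expr1; have := mulr_ge0 E0 h1; lra.
Qed.

Lemma contour_constant (y z : R) : 0 <= y -> 0 <= z ->
  38 / 10 * (100 * (100 * y)) - 38 / 10 * z <= 480 * (81 * y).
Proof. lra. Qed.

End SecondMomentSeries.

Section Peierls.
Context {R : realType} (N : nat).
Hypothesis N4 : (3 < N)%N.
Local Notation V := ('Z_N * 'Z_N)%type.
Variables (i j : V) (T : choiceType) (ext : T -> V -> int).
Variables (shift : {set V} -> T -> T) (neg : T -> T) (b : R).
Hypothesis b3 : 3 <= b.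
Hypothesis extj : forall u, ext u j = 0.
Hypothesis shift_bij : forall B, bijective (shift B).
Hypothesis ext_shift : forall (B : {set V}) (u : T) (x : V), j \notin B -> ext (shift B u) x = ext u x - ind B x.
Hypothesis neg_bij : bijective neg.
Hypothesis ext_neg : forall u x, ext (neg u) x = - ext u x.

Let w (u : T) : R := expR (- (b * (energy (ext u))%:~R)).
Hypothesis sw : absum w.

Let q : R := expR (- b).
Let phi : R := phi_beta b.

Let q_le : q <= 20^-1.
Proof.
rewrite /q expRN lef_pV2 ?posrE ?expR_gt0//; apply: le_trans expR3_ge20 _.
by rewrite ler_expR.
Qed.

Lemma phi_beta_lt1 : 0 < phi < 1.
Proof.
have q0 : 0 < q by exact: expR_gt0.
have q4 : q ^+ 4 <= (20^-1) ^+ 4 by rewrite lerXn2r ?nnegrE ?invr_ge0 ?(ltW q0).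
have q40 : 0 < q ^+ 4 by rewrite exprn_gt0.
by rewrite /phi /phi_beta -/q exprMn; apply/andP; split; lra.
Qed.

(** A geometric series of ratio at most [1 / 2] is at most twice its first term, here the one with
    [l = 4]. The partial sums are bounded with twice the next term subtracted, which makes the bound
    inductive. *)
Lemma contour_sum_le : \sum_(B in contour_cuts i j) q ^+ bdry B <= phi.
Proof.
have q0 : 0 < q by exact: expR_gt0.
pose L := (\max_(B in contour_cuts i j) bdry B).+1.
pose c l := #|[set B in contour_cuts i j | bdry B == l]%SET|.
have -> : \sum_(B in contour_cuts i j) q ^+ bdry B = \sum_(l < L) (c l)%:R * q ^+ l.
  transitivity (\sum_(B in contour_cuts i j) \sum_(l < L | bdry B == l) q ^+ l).
    apply: eq_bigr => B BC.
    have BL : (bdry B < L)%N by rewrite ltnS; exact: leq_bigmax_cond.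
    by rewrite (big_pred1 (Ordinal BL))//= => l; rewrite -val_eqE /= eq_sym.
  rewrite (exchange_big_dep xpredT) //=; apply: eq_bigr => l _.
  rewrite sumr_const mulr_natl /c; congr (_ *+ _).
  by apply: eq_card => B; rewrite unfold_in /= [RHS]inE.
have cl l : (c l)%:R * q ^+ l <= (if (l < 4)%N then 0 else 19 / 10 * (10 * q) ^+ l).
  have := card_contour_cuts N4 i j l; rewrite -/(c l); case: ifP => l4.
    by rewrite leqn0 muln_eq0 /= => /eqP ->; rewrite mul0r.
  rewrite -(ler_nat R) !natrM natrX => h.
  rewrite exprMn mulrA ler_wpM2r ?exprn_ge0 ?(ltW q0)//; lra.
apply: (@le_trans _ _ (\sum_(l < L) (if (l < 4)%N then 0 else 19 / 10 * (10 * q) ^+ l))).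
  by apply: ler_sum => l _; exact: cl.
have part k : \sum_(l < k) (if (l < 4)%N then 0 else 19 / 10 * (10 * q) ^+ l) <=
    if (k < 4)%N then 0 else 38 / 10 * (10 * q) ^+ 4 - 38 / 10 * (10 * q) ^+ k.
  elim: k => [|k IH]; first by rewrite big_ord0.
  rewrite big_ord_recr /=; have x0 : 0 <= (10 * q) ^+ k by rewrite exprn_ge0// mulr_ge0// ltW.
  have xS : (10 * q) ^+ k.+1 <= (10 * q) ^+ k / 2.
    rewrite exprS mulrC ler_wpM2l//.
    by have := q_le; lra.
  move: IH; case: (ltngtP k 3) => k3.
  - have -> : (k < 4)%N = true by lia.
    have -> : (k.+1 < 4)%N = true by lia.
    by rewrite addr0.
  - have -> : (k < 4)%N = false by lia.
    have -> : (k.+1 < 4)%N = false by lia.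
    lra.
  - have -> : (k < 4)%N = true by lia.
    have -> : (k.+1 < 4)%N = false by lia.
    by rewrite addr0 (_ : (10 * q) ^+ k.+1 = (10 * q) ^+ 4) ?subrr// k3.
apply: le_trans (part L) _.
have q40 : 0 <= q ^+ 4 by rewrite exprn_ge0// ltW.
have phiE : phi = 480 * (81 * q ^+ 4).
  have h3 : 3 ^+ 4 = 81 :> R by rewrite -natrX.
  by rewrite /phi /phi_beta -/q exprMn h3.
case: ifP => _.
  by rewrite phiE; apply: mulr_ge0; [exact: ler0n|apply: mulr_ge0; [exact: ler0n|]].
have -> : (10 * q) ^+ 4 = 100 * (100 * q ^+ 4).
  have h2 : 10 ^+ 2 = 100 :> R by rewrite -natrX.
  by rewrite exprMn -[X in 10 ^+ X]/(2 + 2)%N exprD h2 -mulrA.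
rewrite phiE; apply: contour_constant => //.
by rewrite exprn_ge0// mulr_ge0// ltW.
Qed.

Let S (n : int) : R := rsum (fun u => if ext u i == n then w u else 0).

Let sS n : absum (fun u => if ext u i == n then w u else 0).
Proof. by apply: absum_le sw => u; case: ifP => // _; rewrite normr0. Qed.

(** Union bound: each [u] with value [n + 1] at [i] is dominated by the term of one cut, the other
    terms being nonnegative, and the bijection [shift B] turns the sum of a term into
    [q ^ bdry B * S n]. *)
Lemma contour_step (n : nat) : S n.+1%:Z <= phi * S n%:Z.
Proof.
pose g (B : {set V}) u := q ^+ bdry B * (if ext (shift B u) i == n%:Z then w (shift B u) else 0).
have sg B : absum (g B).
  by apply: absumZ; exact: ((absum_reindex _ (shift_bij B)).1 (sS n%:Z)).
have g0 B u : 0 <= g B u.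
  by rewrite /g mulr_ge0 ?exprn_ge0 ?expR_ge0//; case: ifP => // _; exact: expR_ge0.
have [sG eG] := @rsum_bigsum R T _ (enum (contour_cuts i j)) g sg.
apply: (@le_trans _ _ (rsum (fun u => \sum_(B <- enum (contour_cuts i j)) g B u))).
  apply: ler_rsum => // u; case: eqP => [un|_]; last by apply: sumr_ge0 => B _; exact: g0.
  have [|B [cB CB]] := @exists_contour_cut N N4 i j (ext u); first by rewrite extj un.
  have [iB jB _] := cB.
  have BC : B \in contour_cuts i j by rewrite inE; apply/asboolP.
  rewrite big_enum /= (bigD1 B) //= -[leLHS]addr0; apply: lerD; last first.
    by apply: sumr_ge0 => B' _; exact: g0.
  rewrite /g ext_shift// un /ind iB ifT; last by apply/eqP; lia.
  rewrite /q -expRM_natl /w -expRD ler_expR.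
  have := energy_cut N4 cB; rewrite -(ler_int R) rmorphD /=.
  have -> : energy (fun x => ext u x - ind B x) = energy (ext (shift B u)).
    by congr energy; apply/funext => x; rewrite ext_shift.
  move=> /(ler_wpM2l (_ : 0 <= b)); rewrite (le_trans _ b3)// => /(_ isT).
  by rewrite mulrDr [((bdry B)%:Z)%:~R](_ : _ = (bdry B)%:R :> R)//; lra.
rewrite eG big_enum /=.
apply: (@le_trans _ _ (\sum_(B in contour_cuts i j) q ^+ bdry B * S n%:Z)).
  apply: ler_sum => B _; rewrite /g rsumZ; last first.
    exact: ((absum_reindex _ (shift_bij B)).1 (sS n%:Z)).
  by rewrite -(rsum_reindex (fun u => if ext u i == n%:Z then w u else 0) (shift_bij B)).
rewrite -mulr_suml ler_wpM2r ?contour_sum_le//.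
by apply: rsum_ge0 => u; case: ifP => // _; exact: expR_ge0.
Qed.

Lemma energyN (m : V -> int) : energy (fun x => - m x) = energy m.
Proof. by apply: eq_bigr => x _; congr (_ + _); ring. Qed.

Let S_neg n : S (- n) = S n.
Proof.
rewrite /S (rsum_reindex _ neg_bij); apply: eq_rsum => u.
rewrite ext_neg eqr_opp; case: ifP => // _; rewrite /w; congr (expR (- (_ * _%:~R))).
by rewrite -[RHS]energyN; congr energy; apply/funext => x; rewrite ext_neg.
Qed.

Let S_le (n : int) : S n <= phi ^+ absz n * S 0.
Proof.
have /andP[p0 _] := phi_beta_lt1.
have H (k : nat) : S k%:Z <= phi ^+ k * S 0.
  elim: k => [|k IH]; first by rewrite mul1r.
  by apply: le_trans (contour_step k) _; rewrite exprS -mulrA ler_wpM2l// ltW.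
case: n => n; first exact: H.
by rewrite NegzE S_neg abszN; exact: H.
Qed.

(** Summation over the values of the field at [i]. By reflection negative values decay alike, so the
    moment is at most [S 0] times the sum of [n ^ 2 * phi ^ |n|] over all integers, which is at most
    [M_beta b]. *)
Theorem peierls_second_moment :
  absum (fun u => w u * (ext u i)%:~R ^+ 2) /\
  rsum (fun u => w u * (ext u i)%:~R ^+ 2) <= M_beta b * rsum w.
Proof.
have /andP[p0 p1] := phi_beta_lt1.
have w0 u : 0 <= w u by exact: expR_ge0.
have S0 n : 0 <= S n by apply: rsum_ge0 => u; case: ifP.
pose f (n : int) (u : T) : R := n%:~R ^+ 2 * (if ext u i == n then w u else 0).
have f0 n u : 0 <= f n u by rewrite mulr_ge0 ?sqr_ge0//; case: ifP.
have rf n : rsum (f n) = n%:~R ^+ 2 * S n by rewrite /f rsumZ.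
pose G (k : nat) : R := k%:R ^+ 2 * phi ^+ k.
have [sG GK] := @absum_int_nat R G (phi * (1 + phi) / (1 - phi) ^+ 3)
  (fun n => mulr_ge0 (sqr_ge0 _) (exprn_ge0 _ (ltW p0)))
  (fun k => @sum_sqr_geometric R phi k (introT andP (conj (ltW p0) p1))).
have nS (n : int) : n%:~R ^+ 2 * S n <= S 0 * G (absz n).
  rewrite /G (_ : (absz n)%:R ^+ 2 = n%:~R ^+ 2 :> R); last first.
    by rewrite natr_absz intr_norm real_normK ?num_real.
  by rewrite mulrCA ler_wpM2l ?sqr_ge0// mulrC S_le.
have sf : absum (fun z : int * T => f z.1 z.2).
  apply: absum_pair => [n|] /=; first exact: absumZ.
  apply: absum_le (absumZ (S 0) sG) => n.
  rewrite ger0_norm; last by apply: rsum_ge0 => u; exact: normr_ge0.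
  rewrite ger0_norm; last first.
    by apply: mulr_ge0; [exact: S0|rewrite /G mulr_ge0 ?sqr_ge0// exprn_ge0// ltW].
  rewrite (@eq_rsum _ _ _ (f n)); last by move=> u; rewrite ger0_norm.
  by rewrite rf nS.
have pt u : rsum (fun n => f n u) = w u * (ext u i)%:~R ^+ 2.
  have [|_ ->] := @rsum_finite R int [fset (ext u i)]%fset (fun n => f n u).
    by move=> k; rewrite inE /f eq_sym => /negPf ->; rewrite mulr0.
  by rewrite big_seq_fset1 /f eqxx mulrC.
split.
  apply: eq_absum (absum_pairr (absum_swap sf)) => u /=; exact: pt.
rewrite -(eq_rsum pt) -(rsum_exchange sf).
apply: (@le_trans _ _ (rsum (fun n => S 0 * G (absz n)))).
  apply: ler_rsum.
  - by apply: eq_absum (absum_pairr sf) => k /=.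
  - exact: absumZ.
  - by move=> k; rewrite rf nS.
rewrite rsumZ// /M_beta -/phi mulrC.
have SW : S 0 <= rsum w by apply: ler_rsum => // u; case: ifP.
have M0 : 0 <= 2 * (phi * (1 + phi) / (1 - phi) ^+ 3).
  apply: mulr_ge0 => //; apply: divr_ge0; last by rewrite exprn_ge0// subr_ge0 ltW.
  by apply: mulr_ge0; [exact: ltW|apply: addr_ge0; [exact: ler01|exact: ltW]].
apply: le_trans (ler_wpM2r (S0 0) GK) _.
have -> : 2 * phi * (1 + phi) / (1 - phi) ^+ 3 = 2 * (phi * (1 + phi) / (1 - phi) ^+ 3).
  by rewrite !mulrA.
by rewrite ler_wpM2l.
Qed.

End Peierls.

(** * The Green's function *)

Section Green.
Context {R : realType} (N : nat).
Hypothesis N4 : (3 < N)%N.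
Local Notation V := ('Z_N * 'Z_N)%type.
Local Notation e1 := (@e1 N).
Local Notation e2 := (@e2 N).

Definition walkP (x y : V) : R := @srwP R N x y.

Lemma srw_pE (x y : V) : walkP x y =
  4^-1 * ((x + e1 == y)%:R + (x - e1 == y)%:R + (x + e2 == y)%:R + (x - e2 == y)%:R).
Proof.
rewrite /walkP /srwP /srw_dirs; congr (_ * _).
have -> : ((-1, 0) : V) = - e1 by rewrite -[RHS]/((- 1, - 0) : V) oppr0.
have -> : ((0, -1) : V) = - e2 by rewrite -[RHS]/((- 0, - 1) : V) oppr0.
by rewrite /= addn0 !natrD !addrA.
Qed.

Lemma walkP_sym (x y : V) : walkP x y = walkP y x.
Proof.
rewrite !srw_pE; congr (_ * _).
rewrite [y - e1 == x]subr_eq (eq_sym y (x + e1)) [y - e2 == x]subr_eq (eq_sym y (x + e2)).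
rewrite [x - e1 == y]subr_eq (eq_sym x (y + e1)) [x - e2 == y]subr_eq (eq_sym x (y + e2)).
by ring.
Qed.

Lemma walkP_shift (c x y : V) : walkP (x + c) (y + c) = walkP x y.
Proof.
rewrite !srw_pE; congr (_ * _).
by rewrite !(addrAC x c) !(inj_eq (addIr c)).
Qed.

Lemma sum_walkP (x : V) (f : V -> R) :
  \sum_y walkP x y * f y = 4^-1 * (f (x + e1) + f (x - e1) + f (x + e2) + f (x - e2)).
Proof.
have one (a : V) : \sum_y (a == y)%:R * f y = f a.
  rewrite (bigD1 a) //= eqxx mul1r big1 ?addr0// => y /negPf.
  by rewrite eq_sym => ->; rewrite mul0r.
under eq_bigr do rewrite srw_pE -mulrA 3!mulrDl.
by rewrite -mulr_sumr !big_split /= !one.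
Qed.

Lemma walkP_ge0 (x y : V) : 0 <= walkP x y.
Proof. by rewrite /walkP /srwP mulr_ge0. Qed.

Definition walkT t (x y : V) : R := @srw_pt R N t x y.

Lemma walkTS t (x y : V) : walkT t.+1 x y = \sum_z walkT t x z * walkP z y.
Proof. by []. Qed.

Lemma walkT_shift t (c x y : V) : walkT t (x + c) (y + c) = walkT t x y.
Proof.
elim: t y => [|t IH] y; first by rewrite /walkT /= (inj_eq (addIr c)).
rewrite !walkTS (reindex_inj (addIr c)) /=; apply: eq_bigr => z _.
by rewrite IH walkP_shift.
Qed.

Lemma green_shift (c x y : V) : green R (x + c) (y + c) = green R x y.
Proof.
pose Gf (f : nat -> R) := lim ((fun lam : R => limn (fun m : nat => \sum_(t < m)
  ((f t - (#|Lam N|%:R)^-1) * expR (- (lam * t%:R))))) @ 0^'+).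
rewrite -[LHS]/(Gf (fun t => walkT t (x + c) (y + c))) -[RHS]/(Gf (fun t => walkT t x y)).
by congr Gf; apply/funext => t; exact: walkT_shift.
Qed.

Lemma green_diag (x y : V) : green R x x = green R y y.
Proof. by rewrite -(green_shift (y - x) x x) addrC subrK. Qed.

Local Notation n := #|{: V}|.
Let ev : 'I_n -> V := enum_val.

Lemma sum_ev (F : V -> R) : \sum_x F x = \sum_(a < n) F (ev a).
Proof. by rewrite (reindex ev)//; apply: onW_bij; exact: enum_val_bij. Qed.

Definition Pm : 'M[R]_n := \matrix_(a, b) walkP (ev a) (ev b).
Definition Mt t : 'M[R]_n := \matrix_(a, b) walkT t (ev a) (ev b).
Definition Jm : 'M[R]_n := const_mx (n%:R^-1).

Lemma n_gt0 : (0 < n)%N.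
Proof. by apply/card_gt0P; exists (0 : V). Qed.

Let n_neq0 : (n%:R : R) != 0.
Proof. by rewrite pnatr_eq0 -lt0n n_gt0. Qed.

Lemma Mt0 : Mt 0 = 1%:M.
Proof.
apply/matrixP => a b; rewrite !mxE /walkT /=.
by rewrite (inj_eq enum_val_inj).
Qed.

Lemma MtS t : Mt t.+1 = Mt t *m Pm.
Proof.
apply/matrixP => a b; rewrite !mxE walkTS sum_ev.
by apply: eq_bigr => c _; rewrite !mxE.
Qed.

Lemma Pm_sym : Pm^T = Pm.
Proof. by apply/matrixP => a b; rewrite !mxE walkP_sym. Qed.

Lemma Jm_sym : Jm^T = Jm.
Proof. by rewrite /Jm trmx_const. Qed.

Lemma PmJ : Pm *m Jm = Jm.
Proof.
apply/matrixP => a b; rewrite !mxE.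
under eq_bigr do rewrite !mxE.
by rewrite -(sum_ev (fun y => walkP (ev a) y * n%:R^-1)) sum_walkP; field.
Qed.

Lemma JPm : Jm *m Pm = Jm.
Proof. by rewrite -{1}Jm_sym -Pm_sym -trmx_mul PmJ Jm_sym. Qed.

Lemma JJm : Jm *m Jm = Jm.
Proof.
apply/matrixP => a b; rewrite !mxE; under eq_bigr do rewrite !mxE.
by rewrite sumr_const card_ord -mulr_natl; field.
Qed.

Lemma MtJ t : Mt t *m Jm = Jm.
Proof. by elim: t => [|t IH]; rewrite ?Mt0 ?mul1mx// MtS -mulmxA PmJ. Qed.

Lemma walkT_ge0 t (x y : V) : 0 <= walkT t x y.
Proof.
elim: t y => [|t IH] y; first by rewrite /walkT /=; case: (_ == _).
by rewrite walkTS sumr_ge0// => z _; rewrite mulr_ge0 ?walkP_ge0.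
Qed.

Lemma walkT_le1 t (x y : V) : walkT t x y <= 1.
Proof.
have : \sum_z walkT t x z = 1.
  have := congr1 (fun M : 'M[R]_n => M (enum_rank x) (enum_rank x)) (MtJ t); rewrite !mxE.
  under eq_bigr do rewrite !mxE /ev enum_rankK.
  rewrite -(sum_ev (fun z => walkT t x z * n%:R^-1)) -mulr_suml => E.
  by apply: (mulIf (invr_neq0 n_neq0)); rewrite E mul1r.
move=> <-; rewrite (bigD1 y) //= lerDl sumr_ge0// => z _; exact: walkT_ge0.
Qed.

(** Adding the projection [Jm] onto constants makes the matrix invertible at [q = 1], where [1 - Pm]
    is singular. It leaves the geometric sums intact because [Mt t - Jm] annihilates [Jm]. *)
Definition Bm (q : R) : 'M[R]_n := 1%:M - q *: Pm + Jm.

Definition Sm (q : R) m : 'M[R]_n := \sum_(t < m) q ^+ t *: (Mt t - Jm).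

Lemma SmB q m : Sm q m *m Bm q = 1%:M - Jm - q ^+ m *: (Mt m - Jm).
Proof.
elim: m => [|m IH].
  by rewrite /Sm big_ord0 mul0mx expr0 scale1r Mt0 subrr.
rewrite /Sm big_ord_recr /= -/(Sm q m) mulmxDl IH -scalemxAl.
have -> : (Mt m - Jm) *m Bm q = (Mt m - Jm) - q *: (Mt m.+1 - Jm).
  rewrite /Bm mulmxDr mulmxBr mulmx1 -scalemxAr !mulmxBl MtJ JJm subrr addr0.
  by rewrite MtS JPm.
by rewrite (scalerBr _ (Mt m - Jm)) scalerA -exprSr addrA subrK.
Qed.

Definition lap (f : V -> R) (x : V) : R :=
  4 * f x - (f (x + e1) + f (x - e1) + f (x + e2) + f (x - e2)).

Definition dirichlet (f g : V -> R) : R :=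
  \sum_(x : V) ((f x - f (x + e1)) * (g x - g (x + e1)) + (f x - f (x + e2)) * (g x - g (x + e2))).

Lemma dirichlet_lap (f g : V -> R) : \sum_x f x * lap g x = dirichlet f g.
Proof.
have shift (h : V -> R) (c : V) : \sum_(x : V) h (x + c) = \sum_(x : V) h x by rewrite [RHS](reindex_inj (addIr c)).
rewrite /dirichlet.
rewrite (eq_bigr (fun x => (f x * (g x - g (x + e1)) + f x * (g x - g (x + e2))) +
  (f x * (g x - g (x - e1)) + f x * (g x - g (x - e2))))); last by move=> x _; rewrite /lap; ring.
rewrite big_split /= [X in _ + X]big_split /=.
rewrite -(shift (fun x => f x * (g x - g (x - e1))) e1) -(shift (fun x => f x * (g x - g (x - e2))) e2).
rewrite -!big_split /=; apply: eq_bigr => x _; rewrite !addrK; ring.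
Qed.

Lemma dirichlet_ge0 (f : V -> R) : 0 <= dirichlet f f.
Proof. by apply: sumr_ge0 => x _; rewrite addr_ge0// -expr2 sqr_ge0. Qed.

Lemma dirichlet_eq0 (f : V -> R) : dirichlet f f = 0 -> forall x y, f x = f y.
Proof.
move=> /eqP; rewrite /dirichlet psumr_eq0; last first.
  by move=> x _; rewrite addr_ge0// -expr2 sqr_ge0.
move=> /allP H.
have H' x : (f x - f (x + e1) == 0) && (f x - f (x + e2) == 0).
  have := H x (mem_index_enum x); rewrite /= paddr_eq0 -?expr2 ?sqr_ge0//.
  by rewrite !sqrf_eq0.
apply: (torus_constant N4) => x; have /andP[] := H' x; rewrite !subr_eq0.
  by move=> /eqP ->.
by move=> _ /eqP ->.
Qed.

(** A kernel vector has mean zero and is therefore harmonic; its Dirichlet form vanishes, so it is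
    constant, hence zero. *)
Lemma Bm1_unit : Bm 1 \in unitmx.
Proof.
rewrite -row_free_unit -kermx_eq0; apply/rowV0P => v /sub_kermxP vB.
have vJ : v *m Jm = 0.
  have : v *m Bm 1 *m Jm = 0 by rewrite vB mul0mx.
  rewrite -mulmxA (_ : Bm 1 *m Jm = Jm)// /Bm scale1r mulmxDl mulmxBl mul1mx PmJ JJm subrr add0r //.
have vP : v *m Pm = v.
  move: vB; rewrite /Bm scale1r mulmxDr mulmxBr mulmx1 vJ addr0 => /eqP.
  by rewrite subr_eq0 => /eqP <-.
pose f (x : V) := v 0 (enum_rank x).
have fl x : lap f x = 0.
  have := congr1 (fun M : 'rV[R]_n => M 0 (enum_rank x)) vP; rewrite mxE.
  under eq_bigr do rewrite mxE /ev enum_rankK walkP_sym.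
  rewrite (eq_bigr (fun a => walkP x (ev a) * f (ev a))); last first.
    by move=> a _; rewrite mulrC /f /ev enum_valK.
  rewrite -(sum_ev (fun y => walkP x y * f y)) sum_walkP -/(f x) => E.
  by rewrite /lap -E; field.
have fc : forall x y, f x = f y.
  by apply: dirichlet_eq0; rewrite -dirichlet_lap big1// => x _; rewrite fl mulr0.
apply/rowP => a; rewrite mxE.
have := congr1 (fun M : 'rV[R]_n => M 0 a) vJ; rewrite !mxE.
under eq_bigr do rewrite mxE.
rewrite -mulr_suml (eq_bigr (fun=> v 0 a)); last first.
  by move=> b _; have := fc (ev b) (ev a); rewrite /f /ev !enum_valK.
rewrite sumr_const card_ord => /eqP; rewrite mulf_eq0 invr_eq0 (negPf n_neq0) orbF -mulr_natl mulf_eq0.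
by rewrite (negPf n_neq0) => /eqP.
Qed.

(* The resolvent at [q = exp (- lam)] is a rational function of [q] by Cramer's rule, and it has no
   pole at [q = 1]; hence the limit defining [green] exists and is the value at [q = 1]. *)
Definition Bp : 'M[{poly R}]_n := map_mx polyC (1%:M + Jm) - 'X *: map_mx polyC Pm.

Lemma Bp_eval q : map_mx (horner_eval q) Bp = Bm q.
Proof.
apply/matrixP => a b; rewrite !mxE /horner_eval !hornerE /=; ring.
Qed.

Definition Wp : 'M[{poly R}]_n := map_mx polyC (1%:M - Jm) *m \adj Bp.

Lemma det_Bp q : (\det Bp).[q] = \det (Bm q).
Proof. by rewrite -Bp_eval det_map_mx. Qed.

Lemma Wp_eval q : map_mx (horner_eval q) Wp = (1%:M - Jm) *m \adj (Bm q).
Proof.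
rewrite /Wp map_mxM map_mx_adj Bp_eval; congr (_ *m _).
by apply/matrixP => a b; rewrite !mxE; exact: hornerC.
Qed.

Definition Gm : 'M[R]_n := (1%:M - Jm) *m invmx (Bm 1).

Lemma Sm_cvg q a b : 0 < q < 1 -> \det (Bm q) != 0 ->
  Sm q m a b @[m --> \oo] --> (Wp a b).[q] / (\det Bp).[q].
Proof.
move=> /andP[q0 q1] dq.
have Bu : Bm q \in unitmx by rewrite unitmxE unitfE.
have SE m : Sm q m = (1%:M - Jm) *m invmx (Bm q) - q ^+ m *: ((Mt m - Jm) *m invmx (Bm q)).
  by rewrite -[LHS](mulmxK Bu) SmB mulmxBl -scalemxAl.
have WE : ((1%:M - Jm) *m invmx (Bm q)) a b = (Wp a b).[q] / (\det Bp).[q].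
  have := congr1 (fun M : 'M[R]_n => M a b) (Wp_eval q); rewrite mxE /horner_eval => ->.
  by rewrite det_Bp /invmx Bu -scalemxAr mxE mulrC.
pose K : R := \sum_c 2 * `|invmx (Bm q) c b|.
have bound m : `|((Mt m - Jm) *m invmx (Bm q)) a b| <= K.
  rewrite mxE; apply: le_trans (ler_norm_sum _ _ _) _; apply: ler_sum => c _.
  rewrite normrM ler_wpM2r// !mxE; apply: le_trans (ler_normB _ _) _.
  have w0 := walkT_ge0 m (ev a) (ev c); have w1 := walkT_le1 m (ev a) (ev c).
  rewrite ger0_norm// ger0_norm ?invr_ge0//.
  have : (n%:R : R)^-1 <= 1 by rewrite invf_le1 ?ler1n ?ltr0n n_gt0.
  lra.
have qm : q ^+ m * K @[m --> \oo] --> (0 : R).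
  rewrite -(mul0r K); apply: cvgM; last exact: cvg_cst.
  by apply: cvg_expr; rewrite ger0_norm// ltW.
have err : q ^+ m * ((Mt m - Jm) *m invmx (Bm q)) a b @[m --> \oo] --> (0 : R).
  apply: (@squeeze_cvgr _ _ _ _ (fun m => - (q ^+ m * K)) (fun m => q ^+ m * K)) => //; last first.
    by rewrite -oppr0; apply: cvgN.
  apply: nearW => m; rewrite -ler_norml normrM ger0_norm ?exprn_ge0 ?(ltW q0)//.
  by rewrite ler_wpM2l ?exprn_ge0 ?(ltW q0).
rewrite -WE -[X in _ --> X]subr0.
rewrite (_ : (fun m => Sm q m a b) = (fun m => ((1%:M - Jm) *m invmx (Bm q)) a b -
   q ^+ m * ((Mt m - Jm) *m invmx (Bm q)) a b)).
  by apply: cvgB => //; exact: cvg_cst.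
by apply/funext => m; rewrite {1}SE !mxE.
Qed.

Lemma greenE a b : green R (ev a) (ev b) = Gm a b.
Proof.
have d1 : \det (Bm 1) != 0 by have := Bm1_unit; rewrite unitmxE unitfE.
have GE : Gm a b = (Wp a b).[1] / (\det Bp).[1].
  have := congr1 (fun M : 'M[R]_n => M a b) (Wp_eval 1); rewrite mxE /horner_eval => ->.
  by rewrite det_Bp /Gm /invmx Bm1_unit -scalemxAr mxE mulrC.
rewrite GE; apply: cvg_lim => //.
have ec : expR (- la) @[la --> 0^'+] --> (1 : R).
  apply: cvg_at_right_filter; rewrite -(@expR0 R) -[X in expR X]oppr0.
  apply: continuous_cvg; first exact: continuous_expR.
  by apply: cvgN; exact: cvg_id.
have pc (p : {poly R}) : p.[expR (- la)] @[la --> 0^'+] --> p.[1].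
  by apply: continuous_cvg => //; exact: continuous_horner.
have main : (Wp a b).[expR (- la)] / (\det Bp).[expR (- la)] @[la --> 0^'+] --> (Wp a b).[1] / (\det Bp).[1].
  by apply: cvgM => //; apply: cvg_inv => //; rewrite det_Bp.
apply: cvg_trans; last exact: main.
apply: near_eq_cvg; near=> la.
have la0 : 0 < la by near: la; exact: nbhs_right_gt.
have dq : (\det Bp).[expR (- la)] != 0.
  near: la; apply: (cvgr_neq0 _ (pc _)); by rewrite det_Bp.
symmetry; apply: cvg_lim => //.
have q01 : 0 < expR (- la) < 1 by rewrite expR_gt0 expR_lt1 oppr_lt0.
rewrite det_Bp in dq.
have := @Sm_cvg _ a b q01 dq; rewrite (_ : (fun m => Sm _ m a b) = (fun m => \sum_(t < m)
   ((srw_pt R t (ev a) (ev b) - (#|Lam N|%:R)^-1) * expR (- (la * t%:R)))))//.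
apply/funext => m; rewrite /Sm summxE; apply: eq_bigr => t _.
by rewrite !mxE [LHS]mulrC -expRM_natr mulNr.
Unshelve. all: by end_near. Qed.

Lemma Gm_sym : Gm^T = Gm.
Proof.
have Bs : (Bm 1)^T = Bm 1.
  by rewrite /Bm linearD linearB /= linearZ /= trmx1 Pm_sym Jm_sym.
have JB : Jm *m Bm 1 = Bm 1 *m Jm.
  by rewrite /Bm scale1r mulmxDr mulmxBr mulmxDl mulmxBl mulmx1 mul1mx JPm PmJ.
have JI : Jm *m invmx (Bm 1) = invmx (Bm 1) *m Jm.
  rewrite -[LHS](mulKmx Bm1_unit) (mulmxA (Bm 1) Jm) -JB -(mulmxA Jm).
  by rewrite mulmxV ?Bm1_unit// mulmx1.
by rewrite /Gm trmx_mul trmx_inv Bs linearB /= trmx1 Jm_sym mulmxBl mulmxBr mul1mx mulmx1 JI.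
Qed.

Lemma Gm_lap : (1%:M - Pm) *m Gm = 1%:M - Jm.
Proof.
rewrite -[LHS]trmxK trmx_mul Gm_sym linearB /= trmx1 Pm_sym.
have GJ : Gm *m Jm = 0.
  rewrite /Gm -mulmxA (_ : invmx (Bm 1) *m Jm = Jm).
    by rewrite mulmxBl mul1mx JJm subrr.
  rewrite -[RHS](mulKmx Bm1_unit); congr (_ *m _).
  by rewrite /Bm scale1r mulmxDl mulmxBl mul1mx PmJ JJm subrr add0r.
have -> : 1%:M - Pm = Bm 1 - Jm by rewrite /Bm scale1r addrK.
rewrite mulmxBr GJ subr0 /Gm -mulmxA mulVmx ?Bm1_unit// mulmx1.
by rewrite linearB /= trmx1 Jm_sym.
Qed.

Lemma greenEV (x y : V) : green R x y = Gm (enum_rank x) (enum_rank y).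
Proof. by rewrite -greenE /ev !enum_rankK. Qed.

Lemma green_sym (x y : V) : green R x y = green R y x.
Proof. by rewrite !greenEV -{1}Gm_sym mxE. Qed.

(** The factor 4 is that of [lap = 4 * (1 - P)], and neutrality of [k] kills the projection in
    [Gm_lap]. *)
Lemma green_poisson (k : V -> R) : \sum_y k y = 0 ->
  forall x, lap (fun z => \sum_y green R z y * k y) x = 4 * k x.
Proof.
move=> k0 x; set g := fun z => _.
pose kc : 'cV[R]_n := \col_a k (ev a).
have gE z : g z = (Gm *m kc) (enum_rank z) 0.
  rewrite /g mxE sum_ev; apply: eq_bigr => a _.
  by rewrite greenEV [kc a 0]mxE /ev enum_valK.
have E : (1%:M - Pm) *m (Gm *m kc) = kc.
  rewrite mulmxA Gm_lap mulmxBl mul1mx (_ : Jm *m kc = 0) ?subr0//.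
  apply/matrixP => a c; rewrite !mxE; under eq_bigr do rewrite !mxE.
  by rewrite -mulr_sumr -(sum_ev k) k0 mulr0.
have := congr1 (fun M : 'cV[R]_n => M (enum_rank x) 0) E.
rewrite mulmxBl mul1mx mxE -gE [in X in _ + X]mxE [in X in _ + X]mxE.
rewrite (eq_bigr (fun a => walkP x (ev a) * g (ev a))); last first.
  by move=> a _; rewrite gE mxE /ev enum_rankK enum_valK.
rewrite -(sum_ev (fun y => walkP x y * g y)) sum_walkP mxE /ev enum_rankK => <-.
by rewrite /lap; field.
Qed.

End Green.

(** * Duality between charges and heights *)

Section TorusDuality.
Context {R : realType} (N : nat).
Hypothesis N4 : (3 < N)%N.
Local Notation V := ('Z_N * 'Z_N)%type.
Local Notation e1 := (@e1 N).
Local Notation e2 := (@e2 N).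
Variables (i j : V) (b : R).
Hypothesis ij : i != j.
Hypothesis b0 : 0 < b.

Definition off_root := [pred x : V | x != j].
Local Notation K := #|off_root|.

Let hi : i \in off_root. Proof. exact: ij. Qed.

Definition site (x : V) : 'I_K := enum_rank_in hi x.
Definition sitev (p : 'I_K) : V := enum_val p.

Lemma siteK p : site (sitev p) = p.
Proof. exact: enum_valK_in. Qed.

Lemma sitevK x : x != j -> sitev (site x) = x.
Proof. by move=> xj; apply: enum_rankK_in. Qed.

Lemma sitev_neq p : sitev p != j.
Proof. exact: (enum_valP p). Qed.

Definition ext0 (T : nmodType) (u : 'rV[T]_K) (x : V) : T :=
  if x == j then 0 else u 0 (site x).

Lemma ext0_root (T : nmodType) (u : 'rV[T]_K) : ext0 u j = 0.
Proof. by rewrite /ext0 eqxx. Qed.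

Lemma ext0_site (T : nmodType) (u : 'rV[T]_K) p : ext0 u (sitev p) = u 0 p.
Proof. by rewrite /ext0 (negPf (sitev_neq p)) siteK. Qed.

Lemma sum_site (T : nmodType) (F : V -> T) : \sum_x F x = F j + \sum_p F (sitev p).
Proof.
rewrite (bigD1 j) //=; congr (_ + _).
by rewrite -(big_enum_val (fun x => F x)); apply: eq_bigl.
Qed.

Lemma ext0_delta (v : 'rV[R]_K) x : ext0 v x = \sum_p v 0 p * ext0 (delta_mx 0 p : 'rV[R]_K) x.
Proof.
rewrite /ext0; case: eqP => _; first by rewrite big1// => p _; rewrite mulr0.
rewrite (bigD1 (site x)) //= mxE !eqxx mulr1 big1 ?addr0// => p /negPf px.
by rewrite mxE eq_sym px andbF mulr0.
Qed.

(** [b] times the Laplacian without the row and column of [j]. Grounding removes the constants from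
    its kernel, so that Poisson summation applies. *)
Definition grounded : 'M[R]_K := \matrix_(p, q) (b * lap (ext0 (delta_mx 0 p : 'rV[R]_K)) (sitev q)).

Lemma mul_grounded (v : 'rV[R]_K) q : (v *m grounded) 0 q = b * lap (ext0 v) (sitev q).
Proof.
rewrite mxE /lap !(ext0_delta v) !mulr_sumr -!big_split -sumrB mulr_sumr /=.
by apply: eq_bigr => p _; rewrite mxE /lap; ring.
Qed.

Lemma dirichletC (f g : V -> R) : dirichlet f g = dirichlet g f.
Proof. by apply: eq_bigr => x _; rewrite mulrC [X in _ + X]mulrC. Qed.

Lemma grounded_sym : grounded^T = grounded.
Proof.
have H p q : lap (ext0 (delta_mx 0 p : 'rV[R]_K)) (sitev q) =
    dirichlet (ext0 (delta_mx 0 q : 'rV[R]_K)) (ext0 (delta_mx 0 p : 'rV[R]_K)).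
  rewrite -dirichlet_lap sum_site ext0_root mul0r add0r (bigD1 q) //= big1 ?addr0.
    by rewrite ext0_site mxE !eqxx mul1r.
  by move=> r /negPf rq; rewrite ext0_site mxE rq andbF mul0r.
by apply/matrixP => p q; rewrite !mxE !H dirichletC.
Qed.

Lemma qform_grounded (v : 'rV[R]_K) : qform grounded v = b * dirichlet (ext0 v) (ext0 v).
Proof.
rewrite /qform -/(dotv (v *m grounded) v) dotvE -dirichlet_lap sum_site ext0_root mul0r add0r mulr_sumr.
by apply: eq_bigr => p _; rewrite mul_grounded ext0_site; ring.
Qed.

Lemma grounded_posdef : posdef grounded.
Proof.
split=> [|v v0]; first exact: grounded_sym.
rewrite qform_grounded mulr_gt0// lt_neqAle dirichlet_ge0 andbT eq_sym.
apply: contra v0 => /eqP /(dirichlet_eq0 N4) H.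
by apply/eqP/rowP => p; rewrite mxE -ext0_site (H _ j) ext0_root.
Qed.

Lemma qform_energy (u : 'rV[int]_K) :
  qform grounded (intv u) = b * (energy (ext0 u))%:~R.
Proof.
have E x : ext0 (intv u : 'rV[R]_K) x = (ext0 u x)%:~R.
  by rewrite /ext0; case: eqP => // _; rewrite mxE.
rewrite qform_grounded /energy rmorph_sum /=; congr (_ * _); apply: eq_bigr => x _.
by rewrite !E rmorphD !rmorphXn /= !rmorphB /= !expr2.
Qed.

(** The charge at [j] compensates the others: neutral charges have the same coordinates as heights
    grounded at [j], and are dual to them. *)
Definition neutral (T : zmodType) (u : 'rV[T]_K) (x : V) : T :=
  if x == j then - \sum_p u 0 p else u 0 (site x).

Lemma neutral_site (T : zmodType) (u : 'rV[T]_K) p : neutral u (sitev p) = u 0 p.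
Proof. by rewrite /neutral (negPf (sitev_neq p)) siteK. Qed.

Lemma sum_neutral (T : zmodType) (u : 'rV[T]_K) : \sum_x neutral u x = 0.
Proof.
rewrite sum_site (eq_bigr _ (fun p _ => neutral_site u p)).
by rewrite /neutral eqxx addNr.
Qed.

Definition gpot (k : V -> R) (x : V) : R := \sum_y green R x y * k y.
Definition gform (f k : V -> R) : R := \sum_x f x * gpot k x.

Lemma gpotD f k x : gpot (fun y => f y + k y) x = gpot f x + gpot k x.
Proof. by rewrite /gpot -big_split /=; apply: eq_bigr => y _; rewrite mulrDr. Qed.

Lemma gformC f k : gform f k = gform k f.
Proof.
rewrite /gform /gpot; under eq_bigr do rewrite mulr_sumr.
rewrite exchange_big /=; apply: eq_bigr => x _; rewrite mulr_sumr; apply: eq_bigr => y _.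
by rewrite (green_sym N4 y x) mulrCA mulrA mulrC mulrA mulrC mulrCA.
Qed.

Lemma gformD f k : gform (fun y => f y + k y) (fun y => f y + k y) =
  gform f f + 2 * gform k f + gform k k.
Proof.
transitivity (gform f f + gform f k + (gform k f + gform k k)).
  rewrite /gform -!big_split /=; apply: eq_bigr => x _; rewrite gpotD; ring.
by rewrite (gformC f k); ring.
Qed.

Lemma lap_affine (g : V -> R) (c d : R) x : lap (fun y => (g y - d) / c) x = lap g x / c.
Proof. rewrite /lap; ring. Qed.

(** The preimage under [grounded] is the Green potential of the charge, shifted to vanish at [j] and
    divided by [4 * b]; the shift drops out when paired with a neutral charge. *)
Lemma qform_dual (th : 'rV[R]_K) :
  qform (invmx grounded) th = gform (neutral th) (neutral th) / (4 * b).
Proof.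
pose k := neutral th; pose g := gpot k.
pose v : 'rV[R]_K := \row_p ((g (sitev p) - g j) / (4 * b)).
have vE : ext0 v = (fun y => (g y - g j) / (4 * b)).
  apply/funext => x; rewrite /ext0; have [->|xj] := eqVneq x j; first by rewrite subrr mul0r.
  by rewrite mxE sitevK.
have vA : v *m grounded = th.
  apply/rowP => q; rewrite mul_grounded vE lap_affine.
  rewrite /g (green_poisson N4 (sum_neutral th)) neutral_site; field.
  by rewrite gt_eqF.
rewrite (qform_inv (posdef_unit grounded_posdef) vA) dotvE /gform -/k.
transitivity ((\sum_x k x * (g x - g j)) / (4 * b)).
  rewrite sum_site subrr mulr0 add0r mulr_suml; apply: eq_bigr => p _.
  by rewrite /v mxE /k neutral_site; ring.
congr (_ / _); under eq_bigr do rewrite mulrBr.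
by rewrite sumrB -mulr_suml sum_neutral mul0r subr0.
Qed.

Definition charge (k : 'rV[int]_K) : V -> R := neutral ((2 * pi) *: intv k).

Lemma neutralD (T : zmodType) (u v : 'rV[T]_K) x : neutral (u + v) x = neutral u x + neutral v x.
Proof.
rewrite /neutral; case: eqP => _; last by rewrite mxE.
by rewrite -opprD -big_split /=; congr (- _); apply: eq_bigr => p _; rewrite mxE.
Qed.

Let ji : (j == i) = false. Proof. by rewrite eq_sym (negPf ij). Qed.

(** As a phase it tests the height at [i]; made neutral it is the charge [al] at [i] and [- al] at
    [j], whose interaction with the gas is the voltage. *)
Definition dipole (al : R) : 'rV[R]_K := al *: delta_mx 0 (site i).

Lemma neutral_dipole al x : neutral (dipole al) x = al * ((x == i)%:R - (x == j)%:R).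
Proof.
rewrite /neutral; have [->|xj] := eqVneq x j.
  rewrite (bigD1 (site i)) //= big1 ?addr0.
    by rewrite !mxE !eqxx ji /=; ring.
  by move=> p /negPf pi; rewrite !mxE pi andbF mulr0.
rewrite !mxE eqxx subr0 /=; congr (_ * _%:R); congr nat_of_bool.
apply/eqP/eqP => [/(congr1 sitev)|->//]; by rewrite !sitevK.
Qed.

Lemma gform_dipole al k : gform (neutral (dipole al)) k = al * (gpot k i - gpot k j).
Proof.
rewrite /gform (bigD1 i) //= (bigD1 j) /= ?(eq_sym j)// big1 => [|x /andP[xi xj]].
  by rewrite !neutral_dipole !eqxx (negPf ij) ji /=; ring.
by rewrite neutral_dipole (negPf xi) (negPf xj) subrr mulr0 mul0r.
Qed.

Lemma gpot_dipole al x : gpot (neutral (dipole al)) x = al * (green R x i - green R x j).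
Proof.
rewrite /gpot (bigD1 i) //= (bigD1 j) /= ?(eq_sym j)// big1 => [|y /andP[yi yj]].
  by rewrite !neutral_dipole !eqxx (negPf ij) ji /=; ring.
by rewrite neutral_dipole (negPf yi) (negPf yj) subrr !mulr0.
Qed.

Definition gap : R := green R i i - green R i j.

Lemma gform_dipole2 al : gform (neutral (dipole al)) (neutral (dipole al)) = 2 * al ^+ 2 * gap.
Proof.
rewrite gform_dipole !gpot_dipole /gap (green_sym N4 j i) (green_diag j i); ring.
Qed.

Lemma gap_gt0 : 0 < gap.
Proof.
have : 0 < qform (invmx grounded) (dipole 1).
  have Au := posdef_unit grounded_posdef.
  rewrite (@qform_inv _ _ _ _ (dipole 1 *m invmx grounded) Au) ?mulmxKV//.
  have v0 : dipole 1 *m invmx grounded != 0.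
    apply/eqP => /(congr1 (fun M => M *m grounded)); rewrite mulmxKV// mul0mx.
    move=> /(congr1 (fun M : 'rV[R]_K => M 0 (site i))); rewrite !mxE !eqxx mul1r => /eqP.
    by rewrite oner_eq0.
  have [_ /(_ _ v0)] := grounded_posdef.
  by rewrite /qform -/(dotv _ (dipole 1 *m invmx grounded)) mulmxKV// dotvC.
rewrite qform_dual gform_dipole2 expr1n mulr1 => h.
have b4 : 0 < 4 * b by rewrite mulr_gt0.
by move: h; rewrite pmulr_lgt0 ?invr_gt0// pmulr_rgt0.
Qed.

Lemma charge_bij :
  set_bij [set: 'rV[int]_K] (OmegaStar R N) (fun k => [ffun x : Lam N => charge k x]).
Proof.
have p0 : (2 * pi : R) != 0 by rewrite mulf_neq0 ?pnatr_eq0// pi_neq0.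
split.
- move=> k _; split; last first.
    by under eq_bigr do rewrite ffunE; exact: sum_neutral.
  move=> l; rewrite ffunE /charge /neutral; case: eqP => _.
    exists (- \sum_p k 0 p); rewrite rmorphN rmorph_sum /= mulrN mulr_sumr; congr (- _).
    by apply: eq_bigr => p _; rewrite !mxE.
  by exists (k 0 (site l)); rewrite !mxE.
- move=> k k' _ _ /ffunP kk; apply/rowP => p.
  have := kk (sitev p); rewrite !ffunE /charge !neutral_site !mxE => /(mulfI p0).
  by move=> /eqP; rewrite eqr_int => /eqP.
- move=> f [fZ f0]; have [z zP] := boolp.choice fZ.
  exists (\row_p z (sitev p)) => //; apply/ffunP => x; rewrite ffunE /charge.
  rewrite /neutral; have [->|xj] := eqVneq x j; last by rewrite !mxE sitevK.
  have : \sum_(x : V) f x = 0 by exact: f0.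
  rewrite sum_site => /eqP; rewrite addr_eq0 => /eqP ->; congr (- _).
  by apply: eq_bigr => p _; rewrite !mxE zP.
Qed.

Lemma voltageE (k : 'rV[int]_K) :
  voltage R i j [ffun x : Lam N => charge k x] = gpot (charge k) i - gpot (charge k) j.
Proof.
rewrite /voltage /gpot -sumrB; apply: eq_bigr => l _; by rewrite ffunE mulrBl.
Qed.

Lemma quadGE (k : 'rV[int]_K) :
  quadG [ffun x : Lam N => charge k x] = gform (charge k) (charge k).
Proof.
apply: eq_bigr => x _; rewrite /gpot mulr_sumr; apply: eq_bigr => y _.
by rewrite !ffunE mulrA.
Qed.

(** For [b = (4 * bs)^-1] the divisor [16 * b] equals [4 / bs]: the first term is the Coulomb
    weight, the second tilts it by the voltage, and the third does not depend on [k]. *)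
Lemma dual_weightE al (k : 'rV[int]_K) :
  dual_weight grounded (dipole al) k =
  expR (- (gform (charge k) (charge k) + 2 * al * (gpot (charge k) i - gpot (charge k) j)
           + 2 * al ^+ 2 * gap) / (16 * b)).
Proof.
rewrite /dual_weight qform_dual; congr expR.
have -> : neutral (dipole al + (2 * pi) *: intv k) = (fun x => charge k x + neutral (dipole al) x).
  by apply/funext => x; rewrite neutralD addrC.
rewrite gformD gform_dipole gform_dipole2; field.
by rewrite gt_eqF.
Qed.

Lemma dotv_dipole al (u : 'rV[int]_K) : dotv (intv u) (dipole al) = al * (ext0 u i)%:~R.
Proof.
rewrite dotvE (bigD1 (site i)) //= big1 ?addr0.
  by rewrite !mxE !eqxx mulr1 mulrC /ext0 (negPf ij).
by move=> p /negPf pi; rewrite !mxE pi andbF !mulr0.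
Qed.

End TorusDuality.

(** * The Coulomb gas *)

Section Asymptotics.
Context {R : realType}.
Implicit Types (b bs x : R).

Lemma phi_beta_le_half b : 3 <= b -> phi_beta b <= 2^-1.
Proof.
move=> b3; have q0 := expR_gt0 (- b).
have q20 : expR (- b) <= 20^-1.
  rewrite expRN lef_pV2 ?posrE ?expR_gt0//; apply: le_trans expR3_ge20 _.
  by rewrite ler_expR.
have q4 : expR (- b) ^+ 4 <= (20^-1) ^+ 4 by rewrite lerXn2r ?nnegrE ?invr_ge0 ?(ltW q0).
rewrite /phi_beta exprMn; lra.
Qed.

(** The constant is [2 * (3 / 2) * 8], from [phi <= 1 / 2]. *)
Lemma M_beta_bounds b : 3 <= b -> 0 <= M_beta b <= 24 * phi_beta b.
Proof.
move=> b3; have /andP[p0 p1] := phi_beta_lt1 b3; have := phi_beta_le_half b3.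
rewrite /M_beta; move: (phi_beta b) p0 p1 => p p0 p1 p2.
have h : 0 < (1 - p) ^+ 3 by rewrite exprn_gt0// subr_gt0.
have h8 : (2^-1) ^+ 3 <= (1 - p) ^+ 3 by rewrite lerXn2r ?nnegrE ?invr_ge0//; lra.
apply/andP; split; first by rewrite divr_ge0 ?(ltW h)// !mulr_ge0 ?addr_ge0// ltW.
rewrite ler_pdivrMr//; apply: (@le_trans _ _ (24 * p * (2^-1) ^+ 3)).
  have -> : 24 * p * 2^-1 ^+ 3 = p * 3 by field.
  have -> : 2 * p * (1 + p) = p * (2 * (1 + p)) by ring.
  by rewrite ler_wpM2l ?(ltW p0)//; lra.
by rewrite ler_wpM2l// mulr_ge0// ltW.
Qed.

Lemma expRNV_le x : 0 < x -> expR (- x^-1) <= 2 * x ^+ 2.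
Proof.
move=> x0; have := expR_ge1Dxn 1 (ltW (_ : 0 < x^-1)); rewrite invr_gt0 => /(_ x0) h.
rewrite expRN invf_ple ?posrE ?expR_gt0 ?mulr_gt0 ?exprn_gt0//.
apply: le_trans h; rewrite invfM exprVn.
by have : (2`!%:R)^-1 = 2^-1 :> R by []; move=> ->; lra.
Qed.

Lemma phi_beta_quadratic bs : 0 < bs -> phi_beta (4 * bs)^-1 <= 480 * (3 ^+ 4 * (2 * bs ^+ 2)).
Proof.
move=> s0; have c0 : 0 <= 480 :> R := ler0n _ _; have d0 : 0 <= 3 ^+ 4 :> R := exprn_ge0 4 (ler0n _ _).
rewrite /phi_beta exprMn (ler_wpM2l c0)// (ler_wpM2l d0)//.
rewrite -expRM_natl.
have -> : 4 * - (4 * bs)^-1 = - bs^-1 by field; rewrite gt_eqF.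
exact: expRNV_le.
Qed.

Lemma beta_ge3 bs : 0 < bs -> bs <= 12^-1 -> 3 <= (4 * bs)^-1.
Proof.
move=> s0 s12; rewrite -[leLHS]invrK lef_pV2 ?posrE ?invr_gt0 ?mulr_gt0//.
by rewrite -ler_pdivlMl// -invfM; apply: le_trans s12 _; rewrite -natrM.
Qed.

(** [phi] is a multiple of [exp (- 1 / bs) <= 2 * bs ^ 2]. A bounded error is enough, since the
    leading term is of order [1 / bs]. *)
Lemma M_beta_bounded : exists2 K : R, 0 < K &
  forall bs, 0 < bs -> bs <= 12^-1 -> 4 / bs ^+ 2 * M_beta (4 * bs)^-1 <= K.
Proof.
have c0 : 0 < 480 :> R by rewrite ltr0n.
have d0 : 0 < 3 ^+ 4 :> R by apply: exprn_gt0; rewrite ltr0n.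
exists (4 * (24 * (480 * (3 ^+ 4 * 2)))) => [|bs s0 s12].
  by do 2?[apply: mulr_gt0; first by rewrite ltr0n]; apply: mulr_gt0 c0 (mulr_gt0 d0 _); rewrite ltr0n.
have /andP[_ M24] := M_beta_bounds (beta_ge3 s0 s12).
have s2 : 0 < bs ^+ 2 by rewrite exprn_gt0.
rewrite -[leLHS]mulrA ler_wpM2l// ler_pdivrMl// [leRHS]mulrC; apply: le_trans M24 _.
rewrite -[leRHS]mulrA ler_wpM2l//; apply: le_trans (phi_beta_quadratic s0) _.
by rewrite !mulrA.
Qed.

End Asymptotics.

(** * Quadratic and quartic bounds of hyperbolic and circular cosine *)

Section Hyperbolic.
Context {R : realType}.
Implicit Types (x y z u : R).

Definition ch x : R := (expR x + expR (- x)) / 2.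
Definition sh x : R := (expR x - expR (- x)) / 2.

Lemma ch_gt0 x : 0 < ch x.
Proof. by rewrite divr_gt0// addr_gt0 ?expR_gt0. Qed.

Lemma chN x : ch (- x) = ch x.
Proof. by rewrite /ch opprK addrC. Qed.

Lemma ch_norm x : ch `|x| = ch x.
Proof. by case: (ger0P x) => // _; rewrite chN. Qed.

Lemma expRVr x : expR x * expR (- x) = 1.
Proof. by rewrite -expRD subrr expR0. Qed.

Lemma ch2Bsh2 x : ch x ^+ 2 = 1 + sh x ^+ 2.
Proof. by have := expRVr x; rewrite /ch /sh; move: (expR x) (expR (- x)) => p q; nra. Qed.

Lemma ch_half x : ch x = 1 + 2 * sh (x / 2) ^+ 2.
Proof.
have E : expR x = expR (x / 2) ^+ 2 by rewrite -expRM_natl; congr expR; field.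
have E' : expR (- x) = expR (- (x / 2)) ^+ 2 by rewrite -expRM_natl; congr expR; field.
by have := expRVr (x / 2); rewrite /ch /sh E E'; move: (expR (x / 2)) (expR (- (x / 2))) => p q; nra.
Qed.

Lemma sh_norm2 x : sh `|x| ^+ 2 = sh x ^+ 2.
Proof. by have := ch2Bsh2 `|x|; rewrite ch_norm ch2Bsh2 => /addrI. Qed.

Lemma ler_ch x y : 0 <= x -> x <= y -> ch x <= ch y.
Proof.
move=> x0 xy; have ex : 1 <= expR x by rewrite -expR0 ler_expR.
have exy : expR x <= expR y by rewrite ler_expR.
have := expRVr x; have := expRVr y; rewrite /ch.
have := expR_gt0 (- x); have := expR_gt0 (- y).
move: (expR x) (expR y) (expR (- x)) (expR (- y)) ex exy => p q r s p1 pq s0 r0 e1 e2.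
have rs : r - s = (q - p) * (r * s) by nra.
have rs1 : r * s <= 1 by nra.
suff : 0 <= (q - p) * (1 - r * s) by nra.
by rewrite mulr_ge0// subr_ge0.
Qed.

Lemma sh_bounds u : 0 <= u -> u <= sh u <= u * ch u.
Proof.
move=> u0; have D (x : R) : is_derive x 1 sh (ch x).
  rewrite /sh /ch; apply: is_derive_eq; rewrite /GRing.scale /=; ring.
have [|c] := @MVT_segment R sh ch 0 u u0 (fun x _ => D x).
  apply: derivable_within_continuous => x _; exact: ex_derive.
rewrite in_itv /= subr0 => /andP[c0 cu].
have -> : sh 0 = 0 by rewrite /sh oppr0 subrr mul0r.
rewrite subr0 => ->; apply/andP; split.
  by rewrite ler_peMl// ch_half lerDl mulr_ge0 ?sqr_ge0.
by rewrite mulrC ler_wpM2l// ler_ch.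
Qed.

Lemma sh2_bounds x : x ^+ 2 <= sh x ^+ 2 <= x ^+ 2 * (1 + sh x ^+ 2).
Proof.
rewrite -ch2Bsh2 -(sh_norm2 x) -(ch_norm x) -(real_normK (num_real x)).
have /andP[h1 h2] := sh_bounds (normr_ge0 x).
have s0 : 0 <= sh `|x| by exact: le_trans h1.
rewrite -exprMn !lerXn2r ?nnegrE ?h1 ?h2 ?mulr_ge0 ?(ltW (ch_gt0 _))//.
Qed.

Lemma ch_ge x : 1 + x ^+ 2 / 2 <= ch x.
Proof. by rewrite ch_half; have /andP[+ _] := sh2_bounds (x / 2); lra. Qed.

Lemma ch_ge1 x : 1 <= ch x.
Proof. by rewrite ch_half lerDl mulr_ge0 ?sqr_ge0. Qed.

Lemma ch_le4 z : ch z <= 1 + z ^+ 2 / 2 + z ^+ 4 / 8 * ch z.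
Proof.
rewrite ch_half; have /andP[_ h] := sh2_bounds (z / 2).
have T0 := sqr_ge0 (sh (z / 2)); have Z0 := sqr_ge0 z.
have -> : z ^+ 4 = z ^+ 2 * z ^+ 2 by rewrite -exprD.
have e : (z / 2) ^+ 2 = z ^+ 2 / 4 by field.
rewrite e in h; move: (sh (z / 2) ^+ 2) (z ^+ 2) T0 Z0 h => T Y T0 Y0 h.
have h2 := ler_wpM2l Y0 h; have := mulr_ge0 (mulr_ge0 Y0 Y0) T0; nra.
Qed.

Lemma ch3_le y : ch y ^+ 3 <= ch (3 * y).
Proof.
have e3 : expR (3 * y) = expR y ^+ 3 by rewrite -expRM_natl.
have e3' : expR (- (3 * y)) = expR (- y) ^+ 3 by rewrite -expRM_natl; congr expR; ring.
have E : ch (3 * y) = 4 * ch y ^+ 3 - 3 * ch y.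
  rewrite /ch e3 e3'; have := expRVr y; move: (expR y) (expR (- y)) => p q pq.
  have -> : 4 * ((p + q) / 2) ^+ 3 = (p ^+ 3 + q ^+ 3) / 2 + 3 * (p * q) * (p + q) / 2 by field.
  by rewrite pq; field.
have := ch_ge1 y; rewrite E; move: (ch y) => x x1.
have : 0 <= x * (x ^+ 2 - 1) by rewrite mulr_ge0 ?subr_ge0 ?exprn_ege1 ?(le_trans ler01).
by rewrite !exprS expr0; lra.
Qed.

(** The remainder has to be summable against the gas, as [ch (3 * y)] is by the duality identity:
    [y ^ 4 <= 4 * ch y ^ 2] bounds the quartic remainder by [al ^ 4 * ch y ^ 3], and
    [ch y ^ 3 <= ch (3 * y)]. *)
Lemma ch_scale_le al y : 0 <= al <= 1 ->
  ch (al * y) <= 1 + al ^+ 2 * (y ^+ 2 / 2) + al ^+ 4 * ch (3 * y).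
Proof.
move=> /andP[a0 a1]; apply: le_trans (ch_le4 _) _.
have -> : (al * y) ^+ 2 / 2 = al ^+ 2 * (y ^+ 2 / 2) by field.
have -> : (al * y) ^+ 4 / 8 * ch (al * y) = al ^+ 4 * (y ^+ 4 * (8^-1 * ch (al * y))) by field.
rewrite lerD2l ler_wpM2l ?exprn_ge0//.
have c1 : ch (al * y) <= ch y.
  rewrite -(ch_norm y) -(ch_norm (al * y)); apply: ler_ch => //.
  by rewrite normrM ger0_norm// ler_piMl.
have y4 : y ^+ 4 <= 4 * ch y ^+ 2.
  have y2 : y ^+ 2 <= 2 * ch y by have := ch_ge y; lra.
  have -> : y ^+ 4 = (y ^+ 2) ^+ 2 by rewrite -exprM.
  have -> : 4 * ch y ^+ 2 = (2 * ch y) ^+ 2 by ring.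
  by rewrite lerXn2r ?nnegrE ?sqr_ge0// (le_trans (sqr_ge0 y)).
apply: le_trans (ch3_le y).
have cy := ch_gt0 y; have c0 := ch_gt0 (al * y).
have y40 : 0 <= y ^+ 4 by rewrite exprn_even_ge0.
apply: (@le_trans _ _ (y ^+ 4 * (8^-1 * ch y))).
  by rewrite ler_wpM2l// ler_wpM2l// invr_ge0.
apply: (@le_trans _ _ (4 * ch y ^+ 2 * (8^-1 * ch y))).
  by rewrite ler_wpM2r// mulr_ge0// ?invr_ge0// ltW.
have := exprn_gt0 3 cy; rewrite exprSr; lra.
Qed.

(** It stands in for a derivative at 0: coefficients of [t = al ^ 2] are compared up to an error of
    order [t ^ 2]. *)
Lemma le0_of_le_small (x K : R) : (forall t, 0 < t <= 1 -> x <= t * K) -> x <= 0.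
Proof.
move=> H; rewrite leNgt; apply/negP => x0.
have K0 : 0 < K.
  by have := H 1; rewrite mul1r ltr01 lexx => /(_ isT); exact: lt_le_trans.
have K2 : 0 < 2 * K by rewrite mulr_gt0.
have t0 : 0 < Num.min 1 (x / (2 * K)) by rewrite lt_min ltr01 divr_gt0.
have := H (Num.min 1 (x / (2 * K))); rewrite t0 ge_min lexx => /(_ isT).
have : Num.min 1 (x / (2 * K)) <= x / (2 * K) by rewrite ge_min lexx orbT.
move=> /(ler_wpM2r (ltW K0)); rewrite (_ : x / (2 * K) * K = x / 2); first by lra.
by field; rewrite gt_eqF.
Qed.

Lemma cos_ge_quad y : 1 - y ^+ 2 / 2 <= cos y.
Proof.
have -> : cos y = 1 - 2 * sin (y / 2) ^+ 2.
  by rewrite {1}(_ : y = (y / 2) *+ 2) ?cos_mulr2n ?cos2sin2 ?mulr2n; [ring|field].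
by have := sin2_le (y / 2); lra.
Qed.

End Hyperbolic.

Section CoulombGas.
Context {R : realType} (N : nat).
Hypothesis N4 : (3 < N)%N.
Local Notation V := ('Z_N * 'Z_N)%type.
Variables (i j : V) (bs : R).
Hypothesis ij : i != j.
Hypothesis bs0 : 0 < bs.

Let b : R := (4 * bs)^-1.
Let b0 : 0 < b. Proof. by rewrite invr_gt0 mulr_gt0. Qed.

Local Notation K := #|off_root j|.
Let kap (k : 'rV[int]_K) : {ffun Lam N -> R} := [ffun x : Lam N => charge ij k x].
Let U k : R := voltage R i j (kap k).
Let W k : R := cg_weight bs (kap k).
Let A : 'M[R]_K := grounded b ij.
Let w (u : 'rV[int]_K) : R := expR (- (b * (energy (ext0 ij u))%:~R)).
Let d (u : 'rV[int]_K) : R := (ext0 ij u i)%:~R.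
Let g : R := gap i j.
Let c : R := bs / 2.

Lemma cg_E_rsum (F : {ffun Lam N -> R} -> R) :
  cg_E N bs F = rsum (fun k => F (kap k) * W k) / rsum W.
Proof.
have cb := charge_bij ij : set_bij _ (OmegaStar R N) _.
rewrite /cg_E /cg_Z (reindex_esum _ _ _ _ cb) [in RHS]/rsum.
rewrite -/(rsum W) (rsum_nonneg (fun k => expR_ge0 _)); congr (fine _ / _).
rewrite /signed_esum !(reindex_esum _ _ _ _ cb).
by congr (_ - _)%E; apply: eq_esum => k _; rewrite ?funeposE ?funenegE.
Qed.

Let W0 k : 0 <= W k. Proof. exact: expR_ge0. Qed.

Let dualE al k : dual_weight A (dipole ij al) k =
  expR (- (bs / 2 * al ^+ 2 * g)) * (W k * expR (- (c * al * U k))).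
Proof.
rewrite (dual_weightE N4 ij b0) /W /cg_weight (quadGE ij) -!expRD /U (voltageE ij).
by congr expR; rewrite /b /c /g; field; rewrite gt_eqF.
Qed.

Lemma gas_poisson : exists2 C : R, 0 < C & absum w /\ forall al : R,
  absum (fun k => W k * ch (c * al * U k)) /\
  rsum (fun k => W k * ch (c * al * U k)) =
    expR (bs / 2 * al ^+ 2 * g) / C * rsum (fun u => w u * cos (al * d u)).
Proof.
have [C [K0 [C0 sw H]]] := gauss_poisson (grounded_posdef N4 ij b0).
have wE u : expR (- qform A (intv u)) = w u by rewrite (qform_energy b ij).
exists C => //; split; first exact: eq_absum wE sw.
have one al : absum (fun k => W k * expR (- (c * al * U k))) /\
  rsum (fun k => W k * expR (- (c * al * U k))) =
    expR (bs / 2 * al ^+ 2 * g) / C * rsum (fun u => w u * cos (al * d u)).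
  have [s1 _ E] := H (dipole ij al).
  have X k : expR (bs / 2 * al ^+ 2 * g) * dual_weight A (dipole ij al) k = W k * expR (- (c * al * U k)).
    by rewrite dualE mulrA expRVr mul1r.
  split; first by apply: eq_absum (absumZ (expR (bs / 2 * al ^+ 2 * g)) s1) => k; exact: X.
  rewrite -(eq_rsum X) rsumZ// -[RHS]mulrA; congr (_ * _).
  suff -> : rsum (fun u => w u * cos (al * d u)) = C * rsum (dual_weight A (dipole ij al)).
    by rewrite mulrA mulVf ?mul1r// gt_eqF.
  by rewrite -E; apply: eq_rsum => u; rewrite wE (dotv_dipole ij).
(* Averaging over [al] and [- al] turns the exponential tilt into [ch]; the dual side is even in
   [al]. *)
move=> al; have [s1 e1] := one al; have [s2 e2] := one (- al).
have P k : 2^-1 * (W k * expR (- (c * al * U k)) + W k * expR (- (c * - al * U k))) = W k * ch (c * al * U k).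
  by rewrite /ch mulrN mulNr opprK; field.
split; first by apply: eq_absum P _; apply: absumZ; exact: absumD.
rewrite -(eq_rsum P) rsumZ; last exact: absumD.
rewrite rsumD// e1 e2 sqrrN.
rewrite (@eq_rsum _ _ (fun u => w u * cos (- al * d u)) (fun u => w u * cos (al * d u))); first by field; rewrite gt_eqF.
by move=> u; rewrite mulNr cosN.
Qed.

Let c0 : 0 < c. Proof. by rewrite divr_gt0. Qed.

Lemma gas_normal : absum w /\ exists C, [/\ 0 < C, absum W /\ absum (fun k => W k * U k ^+ 2), 0 < rsum W,
  rsum w = C * rsum W &
  forall al : R, absum (fun k => W k * ch (c * al * U k)) /\
  rsum (fun k => W k * ch (c * al * U k)) =
    expR (bs / 2 * al ^+ 2 * g) / C * rsum (fun u => w u * cos (al * d u))].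
Proof.
have [C C0 [sw H]] := gas_poisson; split => //; exists C.
(* [al = 0] gives [rsum w = C * rsum W]; [al = 1] gives summability of the second moment through
   [x ^ 2 / 2 <= ch x]. *)
have [s0 e0] := H 0; have [s1 _] := H 1.
have X k : W k * ch (c * 0 * U k) = W k.
  by rewrite mulr0 mul0r /ch oppr0 expR0; field.
have sW : absum W by exact: eq_absum X s0.
have W00 : 0 < rsum W by apply: (rsum_gt0 (t := 0)) => //; exact: expR_gt0.
split => //.
- split=> //; apply: absum_le (absumZ (2 / c ^+ 2) s1) => k.
  have h := ch_ge (c * 1 * U k); have r0 : 0 <= 2 / c ^+ 2 by rewrite divr_ge0 ?sqr_ge0.
  have w0 := ltW (ch_gt0 (c * 1 * U k)).
  have f0 : 0 <= W k * U k ^+ 2 by apply: mulr_ge0; rewrite ?W0 ?sqr_ge0.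
  have g0 := mulr_ge0 r0 (mulr_ge0 (W0 k) w0).
  rewrite (ger0_norm f0) (ger0_norm g0).
  rewrite [leRHS]mulrCA ler_wpM2l// mulrAC ler_pdivlMr ?exprn_gt0//.
  by move: h; rewrite mulr1 exprMn; lra.
- rewrite (eq_rsum X) expr0n mulr0 mul0r expR0 mul1r in e0.
  rewrite [in RHS]e0 mulrA mulfV ?gt_eqF// mul1r.
  by apply: eq_rsum => u; rewrite mul0r cos0 mulr1.
Qed.

Lemma gas_upper : rsum (fun k => W k * U k ^+ 2) <= 4 / bs * g * rsum W.
Proof.
have [sw [C [C0 [sW sU] W00 wW H]]] := gas_normal.
set E2 := rsum _; set Z := rsum W; have g0 : 0 < g by exact: (gap_gt0 N4 ij b0).
(* Here [al ^ 2 = t]. The gas side uses [ch x >= 1 + x ^ 2 / 2], the dual side [cos <= 1], and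
   [(1 - y) * exp y <= 1] removes the exponential. For [y >= 1] the right-hand side alone
   suffices. *)
have key t : 0 < t <= 1 -> c ^+ 2 / 2 * E2 - bs / 2 * g * Z <= t * (c ^+ 2 / 2 * E2 * (bs / 2 * g)).
  move=> /andP[t0 t1]; have al2 : Num.sqrt t ^+ 2 = t by rewrite sqr_sqrtr// ltW.
  have [s1 e1] := H (Num.sqrt t).
  have low : Z + c ^+ 2 * t / 2 * E2 <= rsum (fun k => W k * ch (c * Num.sqrt t * U k)).
    rewrite -rsumZ// -rsumD//; last exact: absumZ.
    apply: ler_rsum => //; first by apply: absumD => //; exact: absumZ.
    move=> k; have := ler_wpM2l (W0 k) (ch_ge (c * Num.sqrt t * U k)).
    by rewrite !exprMn al2; lra.
  have up : rsum (fun k => W k * ch (c * Num.sqrt t * U k)) <= expR (bs / 2 * t * g) * Z.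
    rewrite e1 al2 -mulrA ler_wpM2l ?expR_ge0// mulrC ler_pdivrMr// mulrC -wW.
    apply: ler_rsum => // [|u].
      by apply: absum_le sw => u; rewrite normrM ler_piMr ?cos_max.
    by rewrite ler_piMr ?expR_ge0// cos_le1.
  have := le_trans low up; set y := bs / 2 * t * g.
  have ey : (1 - y) * expR y <= 1.
    have h := expR_ge1Dx (- y); have := ler_wpM2r (expR_ge0 y) h.
    by rewrite mulrC -[X in _ <= X]mulrC expRVr mulrC.
  have y0 : 0 < y by rewrite /y !mulr_gt0// invr_gt0.
  have E20 : 0 <= E2 by apply: rsum_ge0 => k; rewrite mulr_ge0 ?sqr_ge0.
  have Y : (1 - y) * (Z + c ^+ 2 * t / 2 * E2) <= Z \/ 1 <= y.
    case: (leP 1 y) => y1; [by right|left].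
    have y1' : 0 <= 1 - y by rewrite subr_ge0 ltW.
    apply: (@le_trans _ _ ((1 - y) * (expR y * Z))).
      by rewrite ler_wpM2l// (le_trans low).
    by rewrite mulrA ler_piMl// ltW.
  move=> _; have tE : t * (c ^+ 2 / 2 * E2 * (bs / 2 * g)) = c ^+ 2 / 2 * E2 * y by rewrite /y; ring.
  rewrite tE; have cE : 0 <= c ^+ 2 / 2 * E2 by rewrite mulr_ge0// divr_ge0 ?sqr_ge0.
  case: Y => [h|y1]; last first.
    have := ler_wpM2l cE y1; rewrite mulr1.
    have : 0 <= bs / 2 * g * Z by rewrite !mulr_ge0 ?(ltW W00) ?(ltW g0) ?invr_ge0 ?(ltW bs0).
    lra.
  rewrite -(ler_pM2l t0); move: h.
  rewrite (_ : c ^+ 2 * t / 2 * E2 = t * (c ^+ 2 / 2 * E2)); last by ring.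
  have -> : t * (c ^+ 2 / 2 * E2 - bs / 2 * g * Z) = t * (c ^+ 2 / 2 * E2) - y * Z by rewrite /y; ring.
  lra.
have := le0_of_le_small key; rewrite subr_le0 /c => h.
have c8 : 0 < bs ^+ 2 / 8 by rewrite divr_gt0 ?exprn_gt0.
rewrite -(ler_pM2l c8).
have -> : bs ^+ 2 / 8 * (4 / bs * g * Z) = bs / 2 * g * Z by field; rewrite gt_eqF.
by apply: le_trans h; rewrite le_eqVlt; apply/orP; left; apply/eqP; field.
Qed.

Lemma gas_lower (M : R) : absum (fun u => w u * d u ^+ 2) ->
  rsum (fun u => w u * d u ^+ 2) <= M * rsum w ->
  (4 / bs * g - 4 / bs ^+ 2 * M) * rsum W <= rsum (fun k => W k * U k ^+ 2).
Proof.
move=> sd dM.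
have [sw [C [C0 [sW sU] W00 wW H]]] := gas_normal.
have [s3 _] := H 3.
set E2 := rsum (fun k => W k * U k ^+ 2); set Z := rsum W.
have g0 : 0 < g by exact: (gap_gt0 N4 ij b0).
set D2 := rsum (fun u => w u * d u ^+ 2) in dM.
pose K1 := rsum (fun k => W k * ch (c * 3 * U k)).
(* The reverse comparison: [ch] from above with quartic remainder [t ^ 2 * K1],
   [cos x >= 1 - x ^ 2 / 2] and [exp y >= 1 + y]. If [1 - t * M / 2 < 0], multiplication by it would
   reverse the inequality, but then the right-hand side exceeds [y * Z] anyway. *)
have key t : 0 < t <= 1 -> (bs / 2 * g - M / 2) * Z - c ^+ 2 / 2 * E2 <= t * (K1 + bs / 2 * g * (M / 2) * Z).
  move=> /andP[t0 t1]; have al2 : Num.sqrt t ^+ 2 = t by rewrite sqr_sqrtr// ltW.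
  have al4 : Num.sqrt t ^+ 4 = t ^+ 2 by rewrite -[in RHS]al2 -exprM.
  have al01 : 0 <= Num.sqrt t <= 1 by rewrite sqrtr_ge0 /= -sqrtr1 ler_wsqrtr.
  have [s1 e1] := H (Num.sqrt t).
  have up : rsum (fun k => W k * ch (c * Num.sqrt t * U k)) <= Z + c ^+ 2 * t / 2 * E2 + t ^+ 2 * K1.
    rewrite -rsumZ// -rsumZ// -rsumD//; last exact: absumZ.
    rewrite -rsumD; [|by apply: absumD => //; exact: absumZ|exact: absumZ].
    apply: ler_rsum => //; first by apply: absumD; [apply: absumD => //|]; exact: absumZ.
    move=> k; have := ler_wpM2l (W0 k) (ch_scale_le (c * U k) al01).
    rewrite al2 al4 (_ : Num.sqrt t * (c * U k) = c * Num.sqrt t * U k); last by ring.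
    rewrite (_ : 3 * (c * U k) = c * 3 * U k); last by ring.
    by move=> h; apply: le_trans h _; rewrite exprMn le_eqVlt; apply/orP; left; apply/eqP; field.
  have scos : absum (fun u => w u * cos (Num.sqrt t * d u)).
    by apply: absum_le sw => u; rewrite normrM ler_piMr ?cos_max.
  have low : (1 - t * M / 2) * (C * Z) <= rsum (fun u => w u * cos (Num.sqrt t * d u)).
    rewrite -wW; apply: (@le_trans _ _ (rsum w - t / 2 * D2)).
      have := ler_wpM2l (_ : 0 <= t / 2) dM; rewrite divr_ge0 ?(ltW t0)// => /(_ isT); lra.
    rewrite -rsumZ// -rsumB//; last exact: absumZ.
    apply: ler_rsum => //; first by apply: absumB => //; exact: absumZ.
    move=> u; have := ler_wpM2l (expR_ge0 _ : 0 <= w u) (cos_ge_quad (Num.sqrt t * d u)).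
    by rewrite exprMn al2; lra.
  have low2 : (1 + bs / 2 * t * g) * ((1 - t * M / 2) * Z) <= rsum (fun k => W k * ch (c * Num.sqrt t * U k)) \/ 1 - t * M / 2 < 0.
    case: (ltP (1 - t * M / 2) 0) => p; [by right|left].
    rewrite e1 al2; apply: (@le_trans _ _ (expR (bs / 2 * t * g) * ((1 - t * M / 2) * Z))).
      by rewrite ler_wpM2r ?expR_ge1Dx// mulr_ge0// ltW.
    rewrite -[leRHS]mulrA ler_wpM2l ?expR_ge0// ler_pdivlMl//.
    by rewrite mulrCA.
  have K10 : 0 <= K1 by apply: rsum_ge0 => k; rewrite mulr_ge0// ltW// ch_gt0.
  have E20 : 0 <= E2 by apply: rsum_ge0 => k; rewrite mulr_ge0 ?sqr_ge0.
  have cE : 0 <= c ^+ 2 / 2 * E2 by rewrite mulr_ge0// divr_ge0 ?sqr_ge0.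
  set y := bs / 2 * g; have y0 : 0 < y by rewrite /y !mulr_gt0// invr_gt0.
  have Z0 : 0 < Z by [].
  rewrite -(ler_pM2l t0).
  have eqy : bs / 2 * t * g = t * y by rewrite /y; ring.
  case: low2 => [h|p].
    have := le_trans h up; rewrite eqy.
    rewrite (_ : c ^+ 2 * t / 2 * E2 = t * (c ^+ 2 / 2 * E2)); last by ring.
    move: (c ^+ 2 / 2 * E2) => X hh.
    have e3 : t * (t * (K1 + y * (M / 2) * Z)) = t ^+ 2 * K1 + t * y * (t * M / 2) * Z by field.
    rewrite e3; lra.
  apply: ler_wpM2l; first exact: ltW.
  have h1 : t * (K1 + y * (M / 2) * Z) >= y * Z.
    have := ler_wpM2l (ltW (mulr_gt0 y0 Z0)) (ltW p).
    have := mulr_ge0 (ltW t0) K10; lra.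
  have M0 : 0 <= M.
    rewrite leNgt; apply/negP => Mn; move: p; apply/negP; rewrite -leNgt.
    have := ler_wpM2l (ltW t0) (ltW Mn); lra.
  by have := mulr_ge0 M0 (ltW Z0); lra.
have := le0_of_le_small key; rewrite subr_le0 /c => h.
have c8 : 0 < bs ^+ 2 / 8 by rewrite divr_gt0 ?exprn_gt0.
rewrite -(ler_pM2l c8).
have -> : bs ^+ 2 / 8 * ((4 / bs * g - 4 / bs ^+ 2 * M) * Z) = (bs / 2 * g - M / 2) * Z by field; rewrite gt_eqF.
by apply: le_trans h _; rewrite le_eqVlt; apply/orP; left; apply/eqP; field.
Qed.

Lemma gas_peierls : bs <= 12^-1 -> absum (fun u => w u * d u ^+ 2) /\
  rsum (fun u => w u * d u ^+ 2) <= M_beta b * rsum w.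
Proof.
move=> bs12; have [sw _] := gas_normal.
(* The cuts avoid [j], so restricting their indicators to the other sites loses nothing. *)
pose r (B : {set V}) : 'rV[int]_K := \row_p ind B (sitev p).
have P := @peierls_second_moment R N N4 i j 'rV[int]_K (fun u => ext0 ij u) (fun B u => u - r B) (fun u => - u) b.
apply: P => //.
- exact: beta_ge3.
- exact: ext0_root.
- by move=> B; exists (fun u => u + r B) => u; rewrite ?subrK ?addrK.
- move=> B u x jB; rewrite /ext0; have [->|xj] := eqVneq x j.
    by rewrite /ind (negPf jB) subr0.
  by rewrite !mxE sitevK.
- by move=> u x; rewrite /ext0; case: eqP => _; rewrite ?oppr0// mxE.
Qed.

(** The reflection [k -> - k] preserves the weight and reverses the voltage. *)
Lemma gas_mean : rsum (fun k => U k * W k) = 0.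
Proof.
have [sw [C [C0 [sW sU] W00 wW H]]] := gas_normal.
have s : absum (fun k => U k * W k).
  apply: absum_le (absumD sW sU) => k.
  have f0 : 0 <= W k * U k ^+ 2 by apply: mulr_ge0; rewrite ?W0 ?sqr_ge0.
  rewrite normrM (ger0_norm (W0 k)) (ger0_norm (addr_ge0 (W0 k) f0)).
  have h : `|U k| <= 1 + U k ^+ 2.
    rewrite -(real_normK (num_real (U k))).
    by have := sqr_ge0 (`|U k| - 1); have := normr_ge0 (U k); nra.
  by have := ler_wpM2l (W0 k) h; rewrite mulrDr mulr1 mulrC.
have chN' k x : charge ij (- k) x = - charge ij k x.
  rewrite /charge /neutral; case: eqP => _; last by rewrite !mxE rmorphN /= mulrN.
  by congr (- _); rewrite -sumrN; apply: eq_bigr => p _; rewrite !mxE rmorphN /= mulrN.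
have gN k x : gpot (charge ij (- k)) x = - gpot (charge ij k : V -> R) x.
  by rewrite /gpot -sumrN; apply: eq_bigr => y _; rewrite chN' mulrN.
have UN k : U (- k) = - U k by rewrite /U !voltageE !gN; ring.
have WN k : W (- k) = W k.
  rewrite /W /cg_weight !quadGE; congr (expR (- (_ * _))).
  by apply: eq_bigr => x _; rewrite gN chN' mulrNN.
have bij : bijective (fun k : 'rV[int]_K => - k) by exists (fun k => - k) => k; rewrite opprK.
have := rsum_reindex (fun k => U k * W k) bij.
rewrite (@eq_rsum _ _ (fun k => U (- k) * W (- k)) (fun k => - (U k * W k))).
  rewrite rsumN// => /eqP; rewrite -subr_eq0 opprK -mulr2n -mulr_natl mulf_eq0 pnatr_eq0 /=.
  by move=> /eqP.
by move=> k; rewrite UN WN mulNr.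
Qed.

Lemma coulomb_bounds :
  [/\ bs <= 12^-1 -> 4 / bs * g - 4 / bs ^+ 2 * M_beta b <= cg_E N bs (fun k => voltage R i j k ^+ 2),
      cg_Var N bs (voltage R i j) = cg_E N bs (fun k => voltage R i j k ^+ 2) &
      cg_E N bs (fun k => voltage R i j k ^+ 2) <= 4 / bs * g].
Proof.
have [_ [_ [_ _ W00 _ _]]] := gas_normal.
have E2 : rsum (fun k => U k ^+ 2 * W k) = rsum (fun k => W k * U k ^+ 2).
  by apply: eq_rsum => k; rewrite mulrC.
split.
- move=> bs12; rewrite cg_E_rsum E2 ler_pdivlMr//.
  by have [s1 s2] := gas_peierls bs12; exact: gas_lower.
- have m0 : cg_E N bs (voltage R i j) = 0 by rewrite cg_E_rsum gas_mean mul0r.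
  rewrite /cg_Var m0; congr (cg_E N bs _).
  by apply/funext => k; rewrite subr0.
- by rewrite cg_E_rsum E2 ler_pdivrMr//; exact: gas_upper.
Qed.

End CoulombGas.

Section Diagonal.
Context {R : realType} (N : nat) (i : Lam N).

Lemma voltage_diag k : voltage R i i k = 0.
Proof. by rewrite /voltage big1// => l _; rewrite subrr mul0r. Qed.

Lemma cg_E0 (bs : R) : cg_E N bs (fun=> 0) = 0.
Proof.
rewrite /cg_E /signed_esum !esum1 ?subee ?mul0r// => k _.
  by rewrite funenegE mul0r oppe0 maxxx.
by rewrite funeposE mul0r maxxx.
Qed.

End Diagonal.

Theorem mainTheorem9 (R : realType) (N : nat) (hN : (4 <= N)%N) (i j : Lam N) :
  (forall bs : R, 0 < bs -> bs <= 12^-1 ->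
     4 / bs * (green R i i - green R i j) - 4 / bs ^+ 2 * M_beta ((4 * bs)^-1)
       <= cg_Var N bs (voltage R i j)
     /\ cg_Var N bs (voltage R i j) = cg_E N bs (fun k => voltage R i j k ^+ 2)
     /\ cg_E N bs (fun k => voltage R i j k ^+ 2) <= 4 / bs * (green R i i - green R i j))
  /\ (fun bs : R => cg_E N bs (fun k => voltage R i j k ^+ 2))
       ~_(0^'+) (fun bs : R => 4 / bs * (green R i i - green R i j)).
Proof.
(* For [i = j] voltage and leading term vanish identically; the duality with the field grounded at
   [j] needs [i] off the root. *)
have [<-|ij] := eqVneq i j.
  have V0 : voltage R i i = fun=> 0 by apply/funext => k; exact: voltage_diag.
  have E0 bs : cg_E N bs (fun k => voltage R i i k ^+ 2) = 0.
    by rewrite V0 -[RHS](cg_E0 N bs); congr (cg_E N bs _); apply/funext => k; rewrite expr0n.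
  split=> [bs s0 s12|].
    have /andP[M0 _] := M_beta_bounds (beta_ge3 s0 s12).
    have -> : cg_Var N bs (voltage R i i) = 0.
      rewrite /cg_Var V0 cg_E0 -[RHS](cg_E0 N bs); congr (cg_E N bs _).
      by apply/funext => k; rewrite subrr expr0n.
    rewrite E0 subrr mulr0 sub0r oppr_le0; split=> //.
    by apply: mulr_ge0; rewrite // divr_ge0// sqr_ge0.
  have -> : (fun bs : R => cg_E N bs (fun k => voltage R i i k ^+ 2)) =
            (fun bs : R => 4 / bs * (green R i i - green R i i)).
    by apply/funext => bs; rewrite E0 subrr mulr0.
  exact: equiv_refl.
have B (bs : R) (s0 : 0 < bs) := coulomb_bounds hN ij s0.
split=> [bs s0 s12|].
  by have [lo -> up] := B bs s0; split; [exact: lo|].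
apply/eqaddoP => _/posnumP[eps].
have [K K0 HK] := @M_beta_bounded R.
(* The gap does not involve [b], so positivity is taken from the grounded form with [b = 1]. *)
have g0 : 0 < green R i i - green R i j by exact: (gap_gt0 hN ij ltr01).
near=> bs.
have s0 : 0 < bs by near: bs; exact: nbhs_right_gt.
have s12 : bs <= 12^-1 by near: bs; apply: nbhs_right_le; rewrite invr_gt0.
(* For such [bs] the bound [K] of the error is at most [eps] times the leading term. *)
have se : bs <= eps%:num * (4 * (green R i i - green R i j)) / K.
  by near: bs; apply: nbhs_right_le; rewrite divr_gt0 ?mulr_gt0.
have [lo _ up] := B bs s0.
move: up (lo s12) (HK bs s0 s12) => {lo B HK}.
change (gap i j) with (green R i i - green R i j).
rewrite !fctE; move: (cg_E N bs _) (M_beta _) => f M up lo MK.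
rewrite distrC ger0_norm ?subr_ge0// gtr0_norm; last by rewrite !mulr_gt0 ?invr_gt0.
apply: (@le_trans _ _ K); first by apply: le_trans MK; lra.
have -> : eps%:num * (4 / bs * (green R i i - green R i j)) =
    eps%:num * (4 * (green R i i - green R i j)) / bs by ring.
by rewrite ler_pdivlMr// mulrC -ler_pdivlMr.
Unshelve. all: by end_near. Qed.
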